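(* Let $\Omega\subset\mathbb{R}^N$ be a smooth ($C^2$), strictly convex and bounded domain, and let $g\colon\mathbb{R}^N\setminus\Omega\to\mathbb{R}$ be continuous and bounded. For $s\in(0,1)$ let $u_s:=\Upsilon^s_g$ be the $s$-convex envelope of $g$ inside $\Omega$, and let $u:=\Upsilon_g$ be the (classical) convex envelope of $g|_{\partial\Omega}$ in $\Omega$. Then $u_s\to u$ uniformly in $\overline{\Omega}$ as $s\nearrow 1$.
   Context: Strictly convex means: for any $x,y\in\overline\Omega$ the open segment $\{tx+(1-t)y: t\in(0,1)\}$ is contained in $\Omega$. For $s\in(0,1)$ let $$c(s)=\frac{2^{2s}s\,\Gamma(s+1/2)}{\pi^{1/2}\Gamma(1-s)},$$ and for a function $v\colon\mathbb{R}\to\mathbb{R}$ define the one-dimensional fractional Laplacian $\Delta^s_1 v(t)=c(s)\,\mathrm{P.V.}\int_{\mathbb{R}}\frac{v(t+r)-v(t)}{|r|^{1+2s}}\,dr$. A function $w\colon\mathbb{R}^N\to\mathbb{R}$ is called $s$-convex in $\Omega$ if for any $x,y\in\Omega$ one has $w(tx+(1-t)y)\le v(t)$ for all $t\in(0,1)$, where $v$ is the viscosity solution of $\Delta^s_1 v=0$ in $(0,1)$ with $v(t)=w(tx+(1-t)y)$ for $t\notin(0,1)$. The $s$-convex envelope of $g$ is $$\Upsilon^s_g(x)=\sup\{w(x): w \text{ is } s\text{-convex in } \overline\Omega \text{ and } w|_{\mathbb{R}^N\setminus\Omega}\le g\}.$$ The classical convex envelope of a boundary datum $h\colon\partial\Omega\to\mathbb{R}$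 is $$\Upsilon_h(x)=\sup\{v(x): v \text{ convex in } \overline\Omega,\ v|_{\partial\Omega}\le h\}.$$ *)

(* Defs.v *)
From HB Require Import structures.
From mathcomp Require Import all_boot all_order all_algebra.
From mathcomp Require Import all_classical all_reals all_analysis.
Set Implicit Arguments. Unset Strict Implicit. Unset Printing Implicit Defensive.
Import Order.TTheory GRing.Theory Num.Theory.
Import numFieldNormedType.Exports.
Local Open Scope classical_set_scope.
Local Open Scope ring_scope.

Definition Gamma {R : realType} (z : R) : R :=
  Rintegral lebesgue_measure `]0%R, +oo[%classic
    (fun t => t `^ (z - 1) * expR (- t)).

Definition frac_const {R : realType} (s : R) : R :=
  2 `^ (2 * s) * s * Gamma (s + 2^-1) / (Num.sqrt pi * Gamma (1 - s)).

Definition frac_integrand {R : realType} (s : R) (v : R -> R) (t : R) (r : R) : R :=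
  (v (t + r) - v t) / (`|r| `^ (1 + 2 * s)).

Definition frac_trunc {R : realType} (s : R) (v : R -> R) (t eps : R) : R :=
  Rintegral lebesgue_measure [set r : R | eps < `|r|] (frac_integrand s v t).

(** [frac_lap1 s v t L] : Delta^s_1 v(t) = c(s) P.V. int (v(t+r)-v(t))/|r|^(1+2s) dr
    exists (the truncated integrals are Lebesgue integrals and their limit as
    eps -> 0+ exists) and equals L. *)
Definition frac_lap1 {R : realType} (s : R) (v : R -> R) (t L : R) : Prop :=
  (forall eps : R, 0 < eps ->
     lebesgue_measure.-integrable [set r : R | eps < `|r|]
       (fun r => (frac_integrand s v t r)%:E)) /\
  ((fun eps => frac_const s * frac_trunc s v t eps) @ 0^'+ --> L).

Definition C2_real {R : realType} (phi : R -> R) : Prop :=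
  (forall t, derivable phi t 1) /\ (forall t, derivable (derive1 phi) t 1) /\
  continuous (derive1 (derive1 phi)).

(** Viscosity solution of Delta^s_1 v = 0 in (0,1) (Caffarelli--Silvestre
    definition): v continuous on [0,1]; if a C^2 function phi touches v from
    above (resp. below) at t0 on (t0-r,t0+r) c (0,1), then the function equal
    to phi on (t0-r,t0+r) and to v elsewhere has Delta^s_1 >= 0 (resp. <= 0)
    at t0. *)
Definition visc_sol {R : realType} (s : R) (v : R -> R) : Prop :=
  {within `[0%R, 1%R], continuous v} /\
  (forall (t0 r : R) (phi : R -> R),
     0 < r -> 0 < t0 - r -> t0 + r < 1 -> C2_real phi -> phi t0 = v t0 ->
     (forall t, `|t - t0| < r -> v t <= phi t) ->
     exists L, frac_lap1 s (fun t => if `|t - t0| < r then phi t else v t) t0 L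
               /\ 0 <= L) /\
  (forall (t0 r : R) (phi : R -> R),
     0 < r -> 0 < t0 - r -> t0 + r < 1 -> C2_real phi -> phi t0 = v t0 ->
     (forall t, `|t - t0| < r -> phi t <= v t) ->
     exists L, frac_lap1 s (fun t => if `|t - t0| < r then phi t else v t) t0 L
               /\ L <= 0).

Definition seg_dirichlet_sol {R : realType} {N : nat} (s : R)
    (w : 'rV[R]_N -> R) (x y : 'rV[R]_N) (v : R -> R) : Prop :=
  visc_sol s v /\
  (forall t : R, ~ (0 < t /\ t < 1) -> v t = w (t *: x + (1 - t) *: y)).

Definition s_convex_in {R : realType} {N : nat} (s : R)
    (D : set 'rV[R]_N) (w : 'rV[R]_N -> R) : Prop :=
  forall x y, D x -> D y ->
    (exists v, seg_dirichlet_sol s w x y v) /\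
    (forall v, seg_dirichlet_sol s w x y v ->
       forall t : R, 0 < t -> t < 1 -> w (t *: x + (1 - t) *: y) <= v t).

Definition s_envelope {R : realType} {N : nat} (s : R)
    (Omega : set 'rV[R]_N) (g : 'rV[R]_N -> R) (x : 'rV[R]_N) : \bar R :=
  ereal_sup [set (w x)%:E | w in
    [set w : 'rV[R]_N -> R | s_convex_in s (closure Omega) w /\
                             (forall z, ~ Omega z -> w z <= g z)]].

Definition convex_in {R : realType} {N : nat} (D : set 'rV[R]_N)
    (v : 'rV[R]_N -> R) : Prop :=
  forall x y (t : R), D x -> D y -> 0 <= t -> t <= 1 ->
    v (t *: x + (1 - t) *: y) <= t * v x + (1 - t) * v y.

(** boundary of Omega (Omega open): closure minus Omega. *)
Definition bdry {R : realType} {N : nat} (Omega : set 'rV[R]_N) : set 'rV[R]_N :=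
  closure Omega `\` Omega.

Definition conv_envelope {R : realType} {N : nat}
    (Omega : set 'rV[R]_N) (h : 'rV[R]_N -> R) (x : 'rV[R]_N) : \bar R :=
  ereal_sup [set (v x)%:E | v in
    [set v : 'rV[R]_N -> R | convex_in (closure Omega) v /\
                             (forall z, bdry Omega z -> v z <= h z)]].

Definition strictly_convex {R : realType} {N : nat} (Omega : set 'rV[R]_N) : Prop :=
  forall x y, closure Omega x -> closure Omega y -> x != y ->
    forall t : R, 0 < t -> t < 1 -> Omega (t *: x + (1 - t) *: y).

Definition C2_fun {R : realType} {N : nat} (f : 'rV[R]_N -> R) : Prop :=
  continuous f /\
  forall i j : 'I_N,
    (forall x, derivable f x (delta_mx 0 i)) /\
    continuous ('D_(delta_mx 0 i) f) /\
    (forall x, derivable ('D_(delta_mx 0 i) f) x (delta_mx 0 j)) /\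
    continuous ('D_(delta_mx 0 j) ('D_(delta_mx 0 i) f)).

Definition C2_domain {R : realType} {N : nat} (Omega : set 'rV[R]_N) : Prop :=
  exists rho : 'rV[R]_N -> R,
    C2_fun rho /\ Omega = [set x | rho x < 0] /\
    (forall x, bdry Omega x -> exists i : 'I_N, 'D_(delta_mx 0 i) rho x != 0).

(* Main.v *)
(** For linear [q] the function [(a - q)_+^s] restricts to a solution of
    [Delta^s_1 v = 0] on every segment inside [q < a], because [x_+^s] is
    [s]-harmonic on the half-line. These functions and their linear combinations
    are explicit [s]-convex competitors.

    Lower bound: at [z] the convex envelope is attained up to [e] by an affine
    function [q + c] lying below [g] on the boundary. The function
    [c + B - (B - q)_+^s] tends to [q + c] locally uniformly as [s -> 1]; outside
    Omega it may exceed [g] only away from the boundary, and there it is corrected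
    by penalties [T <= 0], [s]-harmonic on the segments of Omega, that are
    [O(1 - s)] on Omega.

    Upper bound: on [0, 1] and for [s] close to [1], a solution with exterior data
    at most [A] near [0] and at most [B] near [1] is below the chord plus [e],
    since it cannot touch a concave parabola. So the upper relaxed limit of the
    competitors is convex, and it is at most [g] on the boundary, where chords
    leave Omega immediately; hence it is at most the convex envelope. Compactness
    of the closure of Omega makes both bounds uniform. *)
Require Import Defs.
From HB Require Import structures.
From mathcomp Require Import all_boot all_order all_algebra.
From mathcomp Require Import all_classical all_reals all_analysis.
From mathcomp Require Import measurable_realfun.
From mathcomp Require Import ring lra.
Set Implicit Arguments. Unset Strict Implicit. Unset Printing Implicit Defensive.
Import Order.TTheory GRing.Theory Num.Theory.
Import numFieldNormedType.Exports.
Local Open Scope classical_set_scope.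
Local Open Scope ring_scope.

(** On every segment, s-convexity asks that a Dirichlet solution exist and that every such solution
    dominate the function. Functions that are s-harmonic along the segments of Omega meet both
    demands: each is its own solution, and the comparison then has one smooth side, which supplies
    the touching parabola. Exact s-harmonicity also survives negative coefficients, which the
    competitor and the penalties both use.

    The obstacle in the upper bound is nonlocality: a solution on a segment sees data on the whole
    line, where little more than the bound M of g is known. Up to the factor [c(s)], far data enter
    with a bounded weight and local curvature with weight [1 / (1 - s)], so a fixed concave
    curvature wins once s is close to 1.

    Uniformity does not start from continuity of the convex envelope: its oscillation near a point
    is controlled by playing the two bounds against each other at nearby points with a common s. *)

Local Notation mu := lebesgue_measure.

(** * Integrals of powers *)
Lemma continuous_powR {R : realType} (p x : R) :
  0 < x -> {for x, continuous (fun y => y `^ p)}.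
Proof.
move=> x0; apply: differentiable_continuous; apply/derivable1_diffP.
by apply: derivable_powR; rewrite in_itv/= x0.
Qed.

Lemma continuous_subspace_pos {R : realType} (A : set R) (f : R -> R) :
  (forall x, A x -> {for x, continuous f}) -> {within A, continuous f}.
Proof. by move=> cf; apply: continuous_in_subspaceT => x /set_mem; exact: cf. Qed.

Lemma is_derive_powR_prim {R : realType} (p x : R) : 0 < x -> p + 1 != 0 ->
  is_derive x 1 (fun x => x `^ (p + 1) / (p + 1)) (x `^ p).
Proof.
move=> x0 p1.
rewrite (_ : (fun x => _) = (p + 1)^-1 \*: (fun x => x `^ (p + 1))); last first.
  by apply/funext => y; rewrite /GRing.scale/= mulrC.
apply: (is_derive_eq (is_deriveZ _ (is_derive1_powR (p + 1) x0))).
by rewrite addrK /GRing.scale/= mulrA mulVf// mul1r.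
Qed.

Lemma Rintegral_powR_cc {R : realType} (p a b : R) :
  0 < a -> a < b -> p + 1 != 0 ->
  mu.-integrable `[a, b] (EFin \o (fun x : R => x `^ p)) /\
  \int[mu]_(x in `[a, b]) (x `^ p) = (b `^ (p + 1) - a `^ (p + 1)) / (p + 1).
Proof.
move=> a0 ab p1.
have cp q : {within `[a, b], continuous (fun x : R => x `^ q)}.
  apply: continuous_subspace_pos => x /=; rewrite in_itv/= => /andP[ax _].
  by apply: continuous_powR; exact: lt_le_trans ax.
split.
  by apply: continuous_compact_integrable; [exact: segment_compact|exact: cp].
rewrite /Rintegral (@continuous_FTC2 _ _ (fun x => x `^ (p + 1) / (p + 1))) //.
- by rewrite -EFinB/= mulrBl.
- split.
  + move=> x; rewrite in_itv/= => /andP[ax _].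
    have x0 : 0 < x by exact: lt_trans ax.
    by have [] := is_derive_powR_prim x0 p1.
  + apply: cvg_at_right_filter; apply: cvgMl; exact: continuous_powR.
  + apply: cvg_at_left_filter; apply: cvgMl; apply: continuous_powR.
    exact: lt_trans ab.
- move=> x; rewrite in_itv/= => /andP[ax _].
  have x0 : 0 < x by exact: lt_trans ax.
  by rewrite derive1E; have [_ ->] := is_derive_powR_prim x0 p1.
Qed.

Lemma powR_cvgy0 {R : realType} (p : R) : p < 0 -> x `^ p @[x --> +oo] --> (0 : R).
Proof.
move=> p0; apply/cvgrPdist_lt => e e0; near=> x.
have xe : e `^ p^-1 < x by near: x; exact: nbhs_pinfty_gt.
have y0 : 0 < e `^ p^-1 by exact: powR_gt0.
have x0 := lt_trans y0 xe.
rewrite sub0r normrN ger0_norm ?powR_ge0//.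
have : (e `^ p^-1) `^ (- p) < x `^ (- p).
  by apply: gt0_ltr_powR; rewrite ?oppr_gt0 ?nnegrE ?ltW.
rewrite -powRrM mulrN mulVf ?lt_eqF// powRN powRN powRr1 ?ltW//.
by rewrite ltf_pV2 ?posrE// powR_gt0.
Unshelve. all: end_near. Qed.

Lemma powR_addl1 {R : realType} (x p : R) : 0 < x -> x * x `^ p = x `^ (p + 1).
Proof.
move=> x0; rewrite [p + 1]addrC powRD; first by rewrite powRr1// ltW.
by rewrite (gt_eqF x0) implybT.
Qed.

Lemma Rintegral_powR_cy {R : realType} (p a : R) : 0 < a -> p + 1 < 0 ->
  mu.-integrable `[a, +oo[ (EFin \o (fun x : R => x `^ p)) /\
  \int[mu]_(x in `[a, +oo[) (x `^ p) = - (a `^ (p + 1) / (p + 1)).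
Proof.
move=> a0 p1.
have pN0 : p + 1 != 0 by rewrite lt_eqF.
have cp : {within `[a, +oo[, continuous (fun x : R => x `^ p)}.
  apply: continuous_subspace_pos => x /=; rewrite in_itv/= andbT => ax.
  by apply: continuous_powR; exact: lt_le_trans ax.
have E : (\int[mu]_(x in `[a, +oo[) (x `^ p)%:E = (0 - (a `^ (p + 1) / (p + 1)))%:E)%E.
  rewrite (@ge0_continuous_FTC2y _ _ (fun x => x `^ (p + 1) / (p + 1)) _ 0) //.
  - by move=> x _; exact: powR_ge0.
  - by rewrite -[X in _ --> X](mul0r (p + 1)^-1); apply: cvgMl; exact: powR_cvgy0.
  - move=> x ax; have x0 : 0 < x by exact: lt_trans ax.
    by have [] := is_derive_powR_prim x0 pN0.
  - by apply: cvg_at_right_filter; apply: cvgMl; exact: continuous_powR.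
  - move=> x; rewrite in_itv/= andbT => ax.
    have x0 : 0 < x by exact: lt_trans ax.
    by rewrite derive1E; have [_ ->] := is_derive_powR_prim x0 pN0.
split; last by rewrite /Rintegral E/= sub0r.
apply/integrableP; split.
  apply/measurable_EFinP; apply: subspace_continuous_measurable_fun => //.
under eq_integral do rewrite /= ger0_norm ?powR_ge0//.
by rewrite E ltry.
Qed.

(** * The positive part to the power s is s-harmonic *)
(** Young's inequality with exponents 1/s and 1/(1-s), applied to x^s and 1; geometrically, the
    concave power lies below its tangent at 1. *)
Lemma powR_young {R : realType} (s x : R) :
  0 < s -> s < 1 -> 0 <= x -> x `^ s <= s * x + (1 - s).
Proof.
move=> s0 s1 x0.
have := @conjugate_powR _ (x `^ s) 1 s^-1 (1 - s)^-1 (powR_ge0 _ _) ler01.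
rewrite !invr_gt0 subr_gt0 !invrK addrC subrK => /(_ s0 s1 erefl).
by rewrite mulr1 -powRrM mulfV ?gt_eqF// powRr1// powR1 mul1r mulrC.
Qed.

(** Each summand z receives the share z/(x+y) of (x+y)^s, and this share is at most z^s because r <=
    r^s on (0,1]. *)
Lemma powR_le_add {R : realType} (s x y : R) :
  0 < s -> s <= 1 -> 0 <= x -> 0 <= y -> (x + y) `^ s <= x `^ s + y `^ s.
Proof.
move=> s0 s1 x0 y0.
have [xy0|xyN0] := eqVneq (x + y) 0.
  by rewrite xy0 powR0 ?gt_eqF// addr_ge0// powR_ge0.
have xy0 : 0 < x + y by rewrite lt_def xyN0 addr_ge0.
have key z : 0 <= z -> z <= x + y -> z / (x + y) * (x + y) `^ s <= z `^ s.
  move=> z0 zxy.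
  have [->|zN0] := eqVneq z 0; first by rewrite !mul0r powR_ge0.
  have zp : 0 < z by rewrite lt_def zN0.
  rewrite -[in leRHS](divfK xyN0 z) powRM ?divr_ge0 ?(ltW xy0)//.
  apply: ler_wpM2r; first exact: powR_ge0.
  by apply: ger1_powR => //; rewrite divr_gt0//= ler_pdivrMr// mul1r.
have := lerD (key x x0 _) (key y y0 _).
rewrite -mulrDl -mulrDl divff// mul1r; apply; lra.
Qed.

Definition pospow {R : realType} (s x : R) : R := (Num.max x 0) `^ s.

Lemma pospow_pos {R : realType} (s x : R) : 0 <= x -> pospow s x = x `^ s.
Proof. by move=> x0; rewrite /pospow max_l. Qed.

Lemma pospow_neg {R : realType} (s x : R) : 0 < s -> x <= 0 -> pospow s x = 0.
Proof. by move=> s0 x0; rewrite /pospow max_r// powR0// gt_eqF. Qed.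

Lemma pospow_ge0 {R : realType} (s x : R) : 0 <= pospow s x.
Proof. exact: powR_ge0. Qed.

Lemma pospow_homo {R : realType} (s x y : R) :
  0 < s -> x <= y -> pospow s x <= pospow s y.
Proof.
move=> s0 xy; have m0 (z : R) : Num.max z 0 \in Num.nneg by rewrite nnegrE le_max lexx orbT.
apply: (ge0_ler_powR (ltW s0)) => //.
by rewrite ge_max !le_max xy lexx !orbT.
Qed.

Lemma pospowD {R : realType} (s x y : R) : 0 < s -> s <= 1 -> 0 <= y ->
  pospow s (x + y) <= pospow s x + y `^ s.
Proof.
move=> s0 s1 y0; have [x0|x0] := leP 0 x.
  by rewrite !pospow_pos ?addr_ge0// powR_le_add.
apply: (@le_trans _ _ (pospow s y)); first by apply: pospow_homo => //; lra.
by rewrite [pospow s y]pospow_pos// lerDr pospow_ge0.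
Qed.

Lemma pospowB {R : realType} (s x y : R) : 0 < s -> s <= 1 ->
  `|pospow s x - pospow s y| <= `|x - y| `^ s.
Proof.
move=> s0 s1; wlog xy : x y / y <= x => [H|].
  have [yx|/ltW yx] := leP y x; first exact: H.
  by rewrite distrC [`|x - y|]distrC; exact: H.
rewrite ger0_norm ?subr_ge0 ?pospow_homo// (ger0_norm (_ : 0 <= x - y)) ?subr_ge0//.
rewrite lerBlDl.
by have := @pospowD _ s y (x - y) s0 s1; rewrite [y + _]addrC subrK subr_ge0; apply.
Qed.

Lemma continuous_pospow {R : realType} (s : R) : 0 < s -> s <= 1 ->
  continuous (pospow s).
Proof.
move=> s0 s1 x; apply/cvgrPdist_lt => e e0.
have ep := @powR_gt0 _ e s^-1 e0.
near=> y; apply: le_lt_trans (pospowB _ _ s0 s1) _.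
have xy : `|x - y| < e `^ s^-1.
  by near: y; exact: (@nbhsx_ballx _ _ x _ ep).
have : `|x - y| `^ s < (e `^ s^-1) `^ s by apply: gt0_ltr_powR; rewrite ?nnegrE ?powR_ge0.
by rewrite -powRrM mulVf ?gt_eqF// powRr1// ltW.
Unshelve. all: end_near. Qed.

Lemma cvg_powR0_right {R : realType} (C p : R) : 0 < p -> C * e `^ p @[e --> 0^'+] --> 0.
Proof. by move=> p0; rewrite -[X in _ --> X](mulr0 C); apply: cvgMr; exact: powR_cvg0. Qed.

(** Since y^2 - 1 = 2(y-1) + (y-1)^2, both bounds on [I] agree with 2(y-1)W up to terms of second
    order in x. *)
Lemma pinch_aux {R : realType} (x y W I : R) :
  I <= W * (y ^+ 2 - 1) -> (1 - x) * (W * (y ^+ 2 - 1)) <= I ->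
  x * (y ^+ 2 - 1) * W <= 3 * x ^+ 2 * W -> (y - 1) ^+ 2 * W <= x ^+ 2 * W ->
  0 <= (y - 1) ^+ 2 * W -> 0 <= x ^+ 2 * W ->
  - (3 * x ^+ 2 * W) <= 2 * (y - 1) * W - I <= 3 * x ^+ 2 * W.
Proof. by move=> *; apply/andP; split; lra. Qed.

Section halfline.
Context {R : realType}.
Variables (s k : R).
Hypotheses (s0 : 0 < s) (s1 : s < 1) (k0 : 0 < k).

(** [a] and [b] are the forward and backward parts of the integrand for x_+^s at the point 1, with
    increments scaled by [k]; [b] vanishes beyond 1/k, and [B] is its tail integral. *)
Let K (t : R) : R := t `^ (- (1 + 2 * s)).
Let b (t : R) : R := pospow s (1 - k * t) * K t.
Let a (t : R) : R := pospow s (1 + k * t) * K t.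
Let B (u : R) : R := \int[mu]_(t in `[u, +oo[) b t.

Let cont_aff (c t : R) : {for t, continuous (fun t => 1 + c * t)}.
Proof.
by apply: continuousD; [exact: cst_continuous|apply: continuousM; [exact: cst_continuous|exact: id]].
Qed.

Let cont_K (t : R) : 0 < t -> {for t, continuous K}.
Proof. exact: continuous_powR. Qed.

Let cont_pa (c t : R) : 0 < t -> {for t, continuous (fun t => pospow s (1 + c * t) * K t)}.
Proof.
move=> t0; apply: continuousM; last exact: cont_K.
apply: (@continuous_comp _ _ _ (fun t => 1 + c * t) (pospow s)).
  exact: cont_aff.
by apply: continuous_pospow => //; exact: ltW.
Qed.

Let cont_b (t : R) : 0 < t -> {for t, continuous b}.
Proof.
move=> t0; have := @cont_pa (- k) t t0.
by rewrite (_ : (fun t => _) = b)//; apply/funext => x; rewrite mulNr.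
Qed.

Let int_K (u : R) : 0 < u -> mu.-integrable `[u, +oo[ (EFin \o K) /\
  \int[mu]_(t in `[u, +oo[) K t = u `^ (- (2 * s)) / (2 * s).
Proof.
move=> u0; have := @Rintegral_powR_cy _ (- (1 + 2 * s)) u u0.
have -> : - (1 + 2 * s) + 1 = - (2 * s) by ring.
rewrite oppr_lt0 mulr_gt0// => /(_ isT)[iK ->]; split => //.
by rewrite invrN mulrN opprK.
Qed.

Let int_b (u : R) : 0 < u -> mu.-integrable `[u, +oo[ (EFin \o b).
Proof.
move=> u0; have [iK _] := int_K u0.
apply: le_integrable iK => //.
  apply/measurable_EFinP; apply: subspace_continuous_measurable_fun => //.
  apply: continuous_subspace_pos => x /=; rewrite in_itv/= andbT => ax.
  by apply: cont_b; exact: lt_le_trans ax.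
move=> t /=; rewrite in_itv/= andbT => ut.
rewrite lee_fin !ger0_norm ?mulr_ge0 ?pospow_ge0 ?powR_ge0//.
rewrite -[leRHS]mul1r; apply: ler_wpM2r; first exact: powR_ge0.
apply: (@le_trans _ _ (pospow s 1)); last by rewrite pospow_pos// powR1.
apply: pospow_homo => //.
by rewrite lerBlDr lerDl mulr_ge0// ltW// (lt_le_trans u0).
Qed.

Let B_split (u v : R) : 0 < u -> u < v ->
  B u = \int[mu]_(t in `[u, v]) b t + B v.
Proof.
move=> u0 uv; have v0 := lt_trans u0 uv.
have /= := @Rintegral_itvB _ b (BLeft u) (BInfty _ false) v (int_b u0).
rewrite Rintegral_itv_obnd_cbnd; last first.
  apply: integrableS (int_b u0) => //; apply: subset_itvr.
  by rewrite bnd_simp ltW.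
rewrite !bnd_simp /B => /(_ (ltW uv) isT) <-.
by rewrite addrC subrK.
Qed.

Let B_deriv (u : R) : 0 < u -> is_derive u 1 B (- b u).
Proof.
move=> u0.
have h0 : 0 < u / 2 by rewrite divr_gt0.
have hu : u / 2 < u by rewrite ltr_pdivrMr// mulr_natr mulr2n ltrDl.
have [D1 D2] : derivable (fun x => \int[mu]_(t in `[u / 2, x]) b t) u 1 /\
   derive1 (fun x => \int[mu]_(t in `[u / 2, x]) b t) u = b u.
  apply: (@continuous_FTC1_closed _ b (u / 2) u (u + 1)) => //.
  - by rewrite ltrDl.
  - by apply: integrableS (int_b h0) => //; apply: subset_itvl; rewrite bnd_simp.
  - exact: cont_b.
have D : is_derive u 1 (fun x => \int[mu]_(t in `[u / 2, x]) b t) (b u).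
  by apply: DeriveDef; [exact: D1|rewrite -derive1E].
apply: (@near_eq_is_derive _ _ _ (fun x => B (u / 2) - \int[mu]_(t in `[u / 2, x]) b t)).
  near=> x; rewrite (@B_split (u / 2) x)//; first by rewrite addrC addKr.
  by near: x; exact: lt_nbhsr.
have := is_deriveB (is_derive_cst (B (u / 2)) u 1) D.
by rewrite sub0r.
Unshelve. all: end_near. Qed.

Let B_end : B k^-1 = 0.
Proof.
rewrite /B /Rintegral integral0_eq// => t /=; rewrite in_itv/= andbT => kt.
rewrite /b pospow_neg ?mul0r// subr_le0.
by rewrite -(mulVf (lt0r_neq0 k0)) mulrC ler_pM2l.
Qed.

(* The inversion [t = r / (1 + k r)] turns the integral of [a] into that of [b] up to
   an explicit term, so [F] is a primitive of [a]. *)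
Let F (r : R) : R := B (r / (1 + k * r)) - (1 + k * r) `^ s * r `^ (- (2 * s)) / s.

Let p1 (r : R) : 0 < r -> 0 < 1 + k * r.
Proof. by move=> r0; rewrite addr_gt0// mulr_gt0. Qed.

Let F_deriv (r : R) : 0 < r -> is_derive r 1 F (a r).
Proof.
move=> r0; have q0 := p1 r0.
have qN := lt0r_neq0 q0.
have daff : is_derive r 1 (fun r => 1 + k * r) k.
  apply: (is_derive_eq (is_deriveD (is_derive_cst (1 : R^o) (r : R^o) 1) (is_deriveZ k (is_derive_id (r : R^o) 1)))).
  by rewrite add0r /GRing.scale/= mulr1.
have dinv : is_derive r 1 (fun r => (1 + k * r)^-1) (- (1 + k * r) ^- 2 * k).
  exact: is_deriveV.
have du : is_derive r 1 (fun r => r / (1 + k * r)) ((1 + k * r) ^- 2).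
  apply: (is_derive_eq (is_deriveM (is_derive_id (r : R^o) 1) dinv)).
  by rewrite /GRing.scale/=; field.
have u0 : 0 < r / (1 + k * r) by rewrite divr_gt0.
have dB : is_derive r 1 (fun r => B (r / (1 + k * r)))
    (- b (r / (1 + k * r)) * (1 + k * r) ^- 2).
  exact: (@is_derive1_comp _ B (fun r => r / (1 + k * r)) r _ _ (B_deriv u0) du).
have dp : is_derive r 1 (fun r => (1 + k * r) `^ s) (s * (1 + k * r) `^ (s - 1) * k).
  exact: (@is_derive1_comp _ (fun x => x `^ s) (fun r => 1 + k * r) r _ _
    (is_derive1_powR s q0) daff).
have dE : is_derive r 1 (fun r => (1 + k * r) `^ s * r `^ (- (2 * s)) / s)
    (((1 + k * r) `^ s * (- (2 * s) * r `^ (- (2 * s) - 1)) +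
      r `^ (- (2 * s)) * (s * (1 + k * r) `^ (s - 1) * k)) / s).
  rewrite (_ : (fun r : R => _) =
     s^-1 \*: ((fun r => (1 + k * r) `^ s) * (fun r => r `^ (- (2 * s))))); last first.
    by apply/funext => x; rewrite /GRing.scale/= mulrC.
  apply: (is_derive_eq (is_deriveZ s^-1 (is_deriveM dp (is_derive1_powR (- (2 * s)) r0)))).
  by rewrite /GRing.scale/= mulrC.
apply: (is_derive_eq (is_deriveB dB dE)).
set q := 1 + k * r.
have E1 : q `^ s = q * q `^ (s - 1) by rewrite powR_addl1// subrK.
have E2 : r `^ (- (2 * s)) = r * K r.
  by rewrite /K powR_addl1//; congr (_ `^ _); ring.
have E3 : r `^ (- (2 * s) - 1) = K r by rewrite /K; congr (_ `^ _); ring.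
(* Under the inversion 1 - k t becomes 1/q, and the Jacobian is q^(-2). *)
have E4 : pospow s (1 - k * (r / q)) * K (r / q) = q ^+ 2 * q `^ (s - 1) * K r.
  have -> : 1 - k * (r / q) = q^-1 by rewrite /q; field.
  rewrite pospow_pos ?invr_ge0 ?ltW// /K powRM ?invr_ge0 ?ltW//.
  rewrite -(powR_inv1 (ltW q0)) -!powRrM mulrCA [RHS]mulrC; congr (_ * _).
  rewrite -(powR_mulrn 2 (ltW q0)) -!powRD ?(gt_eqF q0) ?implybT//.
  by congr (_ `^ _); ring.
rewrite /b E4 E1 E2 E3 /a (pospow_pos _ (ltW q0)) -/q E1.
move: (q `^ (s - 1)) (K r) => P Q; rewrite /q.
by field; rewrite gt_eqF.
Qed.

Let F_cont (r : R) : 0 < r -> {for r, continuous F}.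
Proof.
move=> r0; apply: differentiable_continuous; apply/derivable1_diffP.
by have [] := F_deriv r0.
Qed.

(** The inversion sends infinity to 1/k, where the tail [B] is already 0; the explicit term decays
    like r^(-s). *)
Let F_lim : F r @[r --> +oo] --> 0.
Proof.
rewrite -[X in _ --> X](subr0 0); apply: cvgB.
- rewrite -B_end.
  apply: (@cvg_comp _ _ _ (fun r => r / (1 + k * r)) B _ (nbhs k^-1)).
    have -> : (fun r => r / (1 + k * r)) @ +oo = (fun r => r / (1 + k * r)) r @[r --> +oo] by [].
    apply: (@squeeze_cvgr _ _ _ _ (fun r => k^-1 - k ^- 2 * r `^ (-1)) (fun=> k^-1)).
    + near=> r.
      have r0 : 0 < r by near: r; exact: nbhs_pinfty_gt.
      have q0 := p1 r0.
      rewrite (powR_inv1 (ltW r0)) ler_pdivlMr// ler_pdivrMr//.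
      rewrite (_ : (k^-1 - _) * _ = r - k ^- 2 / r); last by field; rewrite !gt_eqF.
      rewrite lerBlDr lerDl mulr_ge0 ?invr_ge0 ?exprn_ge0 ?(ltW k0) ?(ltW r0)//=.
      by rewrite mulrDr mulr1 mulrA mulVf ?gt_eqF// mul1r lerDr ltW ?invr_gt0.
    + rewrite -[X in _ --> X](subr0 k^-1); apply: cvgB; first exact: cvg_cst.
      by rewrite -[X in _ --> X](mulr0 (k ^- 2)); apply: cvgMr; apply: powR_cvgy0; lra.
    + exact: cvg_cst.
  apply: differentiable_continuous; apply/derivable1_diffP.
  have ki : 0 < k^-1 by rewrite invr_gt0.
  by have [] := B_deriv ki.
- rewrite -[X in _ --> X](mul0r s^-1); apply: cvgMl.
  apply: (@squeeze_cvgr _ _ _ _ (fun=> 0) (fun r => (1 + k) `^ s * r `^ (- s))).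
  + near=> r.
    have r1 : 1 < r by near: r; exact: nbhs_pinfty_gt.
    have r0 : 0 < r by exact: lt_trans r1.
    rewrite mulr_ge0 ?powR_ge0//=.
    have -> : r `^ (- s) = r `^ s * r `^ (- (2 * s)).
      by rewrite -powRD ?(gt_eqF r0) ?implybT//; congr (_ `^ _); ring.
    rewrite mulrA; apply: ler_wpM2r; first exact: powR_ge0.
    rewrite -powRM ?(ltW r0) ?(ltW (addr_gt0 ltr01 k0))//; apply: (ge0_ler_powR (ltW s0)).
    + by rewrite nnegrE ltW// p1.
    + by rewrite nnegrE mulr_ge0// ltW// addr_gt0.
    + by rewrite mulrDl mul1r lerD2r ltW.
  + exact: cvg_cst.
  + by rewrite -[X in _ --> X](mulr0 ((1 + k) `^ s)); apply: cvgMr; apply: powR_cvgy0; rewrite oppr_lt0.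
Unshelve. all: end_near. Qed.

Let A_int (e : R) : 0 < e ->
  mu.-integrable `[e, +oo[ (EFin \o a) /\ \int[mu]_(t in `[e, +oo[) a t = - F e.
Proof.
move=> e0.
have ca : {within `[e, +oo[, continuous a}.
  apply: continuous_subspace_pos => x /=; rewrite in_itv/= andbT => ax.
  by apply: cont_pa; exact: lt_le_trans ax.
have a0 x : 0 <= a x by rewrite mulr_ge0 ?pospow_ge0 ?powR_ge0.
have E : (\int[mu]_(x in `[e, +oo[) (a x)%:E = (0 - F e)%:E)%E.
  rewrite (@ge0_continuous_FTC2y _ _ F _ 0) //.
  - move=> x ax; have x0 : 0 < x by exact: lt_trans ax.
    by have [] := F_deriv x0.
  - by apply: cvg_at_right_filter; exact: F_cont.
  - move=> x; rewrite in_itv/= andbT => ax.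
    have x0 : 0 < x by exact: lt_trans ax.
    by rewrite derive1E; have [_ ->] := F_deriv x0.
split; last by rewrite /Rintegral E/= sub0r.
apply/integrableP; split.
  by apply/measurable_EFinP; exact: subspace_continuous_measurable_fun.
under eq_integral do rewrite /= ger0_norm ?a0//.
by rewrite E ltry.
Qed.

Let h (r : R) := (pospow s (1 + k * r) + pospow s (1 - k * r) - 2) / r `^ (1 + 2 * s).

(** The inversion carries the tail of [a] to the tail of [b] from e/(1+ke). Against the tail of [b]
    from e only the sliver in between survives. *)
Let J_eq (e : R) : 0 < e -> \int[mu]_(r in `[e, +oo[) h r =
  ((1 + k * e) `^ s - 1) * e `^ (- (2 * s)) / s
  - \int[mu]_(r in `[e / (1 + k * e), e]) b r.
Proof.
move=> e0; have [ia Ea] := A_int e0; have [iK EK] := int_K e0.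
have hE : h = (fun r => a r + b r - 2 * K r).
  by apply/funext => r; rewrite /h /a /b /K powRN -!mulrDl mulrBl.
have i2 : mu.-integrable `[e, +oo[ (EFin \o (fun r => 2 * K r)).
  rewrite (_ : _ \o _ = (fun r => 2%:E * (EFin \o K) r)%E); last exact/funext.
  exact: integrableZl.
have iab : mu.-integrable `[e, +oo[ (EFin \o (fun r => a r + b r)).
  rewrite (_ : _ \o _ = ((EFin \o a) \+ (EFin \o b))%E); last exact/funext.
  by apply: integrableD => //; exact: int_b.
have q0 := p1 e0.
have ue : e / (1 + k * e) < e.
  by rewrite ltr_pdivrMr// mulrDr mulr1 ltrDl mulr_gt0// mulr_gt0.
rewrite hE RintegralB// RintegralD//; last exact: int_b.
rewrite Ea RintegralZl// EK /F -/(B e) (B_split (divr_gt0 e0 q0) ue).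
by field; rewrite gt_eqF.
Qed.

(** Each of the two terms in [J_eq] has order e^(1-2s), which diverges for s > 1/2; their leading
    parts cancel and what remains has order e^(2-2s). *)
Lemma pospow_lap_cvg0 : \int[mu]_(r in `[e, +oo[) h r @[e --> 0^'+] --> 0.
Proof.
have s20 : 0 < 2 * s by rewrite mulr_gt0.
have p0 : 0 < 2 - 2 * s by have := s1; lra.
pose C := 3 * k ^+ 2 / (2 * s).
apply: (@squeeze_cvgr _ _ _ _ (fun e => - C * e `^ (2 - 2 * s)) (fun e => C * e `^ (2 - 2 * s))).
- near=> e.
  have e0 : 0 < e by near: e; exact: nbhs_right_gt.
  have ek : e < k^-1 by near: e; apply: nbhs_right_lt; rewrite invr_gt0.
  have ke : k * e < 1 by rewrite mulrC -ltr_pdivlMr// mul1r.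
  have q0 := p1 e0; set q := 1 + k * e in q0 *.
  have kep : 0 < k * e by rewrite mulr_gt0.
  have u0 : 0 < e / q by rewrite divr_gt0.
  have ue : e / q < e.
    by rewrite ltr_pdivrMr// mulrDr mulr1 ltrDl mulr_gt0.
  rewrite J_eq//.
  set y := q `^ s; set I := \int[mu]_(_ in _) _; set E := e `^ (- (2 * s)).
  have E0 : 0 < E by exact: powR_gt0.
  have y1 : 1 <= y.
    apply: (@le_trans _ _ (1 `^ s)); first by rewrite powR1.
    by apply: (ge0_ler_powR (ltW s0)); rewrite ?nnegrE ?(ltW q0)// lerDl ltW.
  have yk : y - 1 <= k * e.
    have := powR_young s0 s1 (ltW q0); rewrite -/y /q.
    have : s * (k * e) <= k * e by rewrite ler_piMl// ltW.
    lra.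
  have := @Rintegral_powR_cc _ (- (1 + 2 * s)) (e / q) e u0 ue.
  have -> : - (1 + 2 * s) + 1 = - (2 * s) by ring.
  rewrite oppr_eq0 gt_eqF// => /(_ isT)[iK' IK].
  have EE : (e / q) `^ (- (2 * s)) = E * y ^+ 2.
    rewrite powRM ?invr_ge0 ?ltW// -/E; congr (_ * _).
    rewrite -(powR_inv1 (ltW q0)) -powRrM -(powR_mulrn 2 (powR_ge0 _ _)) -powRrM.
    by congr (_ `^ _); ring.
  have IKE : \int[mu]_(t in `[e / q, e]) K t = E * (y ^+ 2 - 1) / (2 * s).
    by rewrite IK EE -/E; field; rewrite gt_eqF.
  have ib : mu.-integrable `[e / q, e] (EFin \o b).
    by apply: integrableS (int_b u0) => //; apply: subset_itvl; rewrite bnd_simp.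
  have I1 : I <= E * (y ^+ 2 - 1) / (2 * s).
    rewrite -IKE; apply: le_Rintegral => // t /=; rewrite in_itv/= => /andP[ut te].
    rewrite -[leRHS]mul1r; apply: ler_wpM2r; first exact: powR_ge0.
    apply: (@le_trans _ _ (pospow s 1)); last by rewrite pospow_pos// powR1.
    apply: pospow_homo => //.
    by rewrite lerBlDr lerDl mulr_ge0// ltW// (lt_le_trans u0).
  have I2 : (1 - k * e) * (E * (y ^+ 2 - 1) / (2 * s)) <= I.
    rewrite -IKE -RintegralZl//; apply: le_Rintegral => //.
      rewrite (_ : _ \o _ = (fun r => (1 - k * e)%:E * (EFin \o K) r)%E); last exact/funext.
      exact: integrableZl.
    move=> t /=; rewrite in_itv/= => /andP[ut te].
    apply: ler_wpM2r; first exact: powR_ge0.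
    have t0 : 0 < t by exact: lt_le_trans ut.
    have kt : k * t <= k * e by rewrite ler_pM2l.
    have kt0 : 0 < k * t by rewrite mulr_gt0.
    rewrite pospow_pos ?subr_ge0; last lra.
    apply: (@le_trans _ _ (1 - k * t)); first lra.
    by apply: ger1_powR; rewrite ?(ltW s1)//; lra.
  have E2 : e `^ (2 - 2 * s) = E * e ^+ 2.
    rewrite /E -(powR_mulrn 2 (ltW e0)) -powRD ?(gt_eqF e0) ?implybT//.
    by congr (_ `^ _); ring.
  rewrite E2; set W := E / (2 * s).
  have W0 : 0 < W by rewrite divr_gt0.
  have -> : (y - 1) * E / s = 2 * (y - 1) * W by rewrite /W; field; rewrite gt_eqF.
  have CW : C * (E * e ^+ 2) = 3 * (k * e) ^+ 2 * W by rewrite /C /W; field; rewrite gt_eqF.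
  rewrite mulNr CW.
  have EW : E * (y ^+ 2 - 1) / (2 * s) = W * (y ^+ 2 - 1) by rewrite mulrAC.
  rewrite EW in I1 I2.
  have y2 : (y - 1) ^+ 2 <= (k * e) ^+ 2.
    by rewrite ler_sqr ?nnegrE ?subr_ge0 ?(ltW kep).
  have x2 : (k * e) * (y ^+ 2 - 1) <= 3 * (k * e) ^+ 2.
    have -> : y ^+ 2 - 1 = (y - 1) * (y + 1) by ring.
    have : (y - 1) * (y + 1) <= k * e * 3.
      by apply: ler_pM; rewrite ?subr_ge0//; lra.
    by rewrite -(ler_pM2l kep); nra.
  have := ler_wpM2r (ltW W0) y2; have := ler_wpM2r (ltW W0) x2.
  have := sqr_ge0 (y - 1).
  move=> h0 h1 h2; have h3 := mulr_ge0 h0 (ltW W0).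
  have h4 : 0 <= (k * e) ^+ 2 * W by rewrite mulr_ge0 ?sqr_ge0// ltW.
  exact: pinch_aux.
- exact: cvg_powR0_right.
- exact: cvg_powR0_right.
Unshelve. all: end_near. Qed.
End halfline.

(** * The one-dimensional fractional Laplacian *)
Lemma integrableU {R : realType} (A B : set R) (f : R -> \bar R) :
  measurable A -> measurable B -> [disjoint A & B] ->
  mu.-integrable A f -> mu.-integrable B f -> mu.-integrable (A `|` B) f.
Proof.
move=> mA mB AB /integrableP[mfA fA] /integrableP[mfB fB].
have mf : measurable_fun (A `|` B) f by exact/measurable_funU.
apply/integrableP; split => //.
rewrite ge0_integral_setU//; last exact: measurableT_comp.
exact: lte_add_pinfty.
Qed.

Lemma integrable_opp {R : realType} (D : set R) (f : R -> R) :
  measurable D -> mu.-integrable (-%R @^-1` D) (EFin \o f) ->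
  mu.-integrable D (EFin \o (f \o -%R)) /\
  \int[mu]_(r in -%R @^-1` D) f r = \int[mu]_(r in D) f (- r).
Proof.
move=> mD; set A := _ @^-1` D => fi.
(* Extending [f] by zero makes [g] measurable on the whole line, as the change of variables for a
   pushforward is applied to it. *)
pose g : R -> R := (f \_ A) \o -%R.
have mopp : measurable_fun [set: R] (-%R : R -> R) by exact: oppr_measurable.
have mA : measurable A by rewrite -[A]setTI; exact: mopp.
have mfA : measurable_fun [set: R] (f \_ A).
  apply/(measurable_restrictT f); first exact: mA.
  by apply/measurable_EFinP; exact: (measurable_int _ fi).
have mg : measurable_fun [set: R] (EFin \o g).
  by apply/measurable_EFinP; exact: measurableT_comp.
have gA : {in A, (EFin \o g) \o -%R =1 EFin \o f}.
  by move=> x xA; rewrite /g/= opprK patchE xA.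
have giA : mu.-integrable A ((EFin \o g) \o -%R).
  by refine (eq_integrable _ _ _ _ fi) => // x xA; rewrite gA.
have gfD : {in D, EFin \o g =1 EFin \o (f \o -%R)}.
  move=> x /set_mem xD.
  by rewrite /g/= patchE mem_set// /A/= opprK.
have gi := @integrable_pushforward _ _ _ _ R (-%R : measurableTypeR R -> measurableTypeR R) mopp _ D _ mg giA mD.
have Eg := @integral_pushforward _ _ _ _ R (-%R : measurableTypeR R -> measurableTypeR R) mopp _ D _ mg giA mD.
have pushE (h : R -> \bar R) :
    (\int[pushforward mu (-%R : measurableTypeR R -> measurableTypeR R)]_(x in D) h x = \int[mu]_(x in D) h x)%E.
  by apply: eq_measure_integral => B mB _; exact: lebesgue_measureN.
have giD : mu.-integrable D (EFin \o g).
  move/integrableP : gi => [m1 m2]; apply/integrableP; split => //.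
  by move: m2; rewrite pushE.
split.
  by refine (eq_integrable _ _ _ _ giD) => // x xD; rewrite gfD.
rewrite /Rintegral; congr fine.
transitivity (\int[mu]_(x in D) (EFin \o g) x)%E; last first.
  by apply: eq_integral => x xD; rewrite gfD.
by rewrite -pushE Eg; apply: eq_integral => x xA; rewrite gA.
Qed.

Lemma opp_preimage_oy {R : realType} (e : R) :
  (-%R : R -> R) @^-1` `]e, +oo[ = `]-oo, (- e)[%classic.
Proof. by apply/seteqP; split => r /=; rewrite !in_itv/= andbT ltrNr. Qed.

Lemma opp_preimage_Nyo {R : realType} (e : R) :
  (-%R : R -> R) @^-1` `]-oo, (- e)[ = `]e, +oo[%classic.
Proof. by apply/seteqP; split => r /=; rewrite !in_itv/= andbT ltrN2. Qed.

Lemma normr_gt_setU {R : realType} (e : R) : 0 < e ->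
  [set r : R | e < `|r|] = `]-oo, (- e)[ `|` `]e, +oo[.
Proof.
move=> e0; apply/seteqP; split => r /=; rewrite !in_itv/= andbT lter_normr ltrNr.
  by case/orP => ?; [right|left].
by case=> ?; apply/orP; [right|left].
Qed.

Lemma disjoint_normr_gt {R : realType} (e : R) : 0 < e ->
  [disjoint (`]-oo, (- e)[%classic : set R) & `]e, +oo[%classic].
Proof.
move=> e0; apply/disj_setPS => r /= []; rewrite !in_itv/= andbT => r1 r2.
suff : r < r by rewrite ltxx.
by apply: lt_trans r1 _; apply: lt_trans r2; rewrite gtrN.
Qed.

(** * Truncated integrals as integrals of second differences *)

Definition second_diff {R : realType} (v : R -> R) (t r : R) : R :=
  v (t + r) + v (t - r) - 2 * v t.

Definition half_integrand {R : realType} (s : R) (v : R -> R) (t r : R) : R :=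
  second_diff v t r / r `^ (1 + 2 * s).

Definition trunc_integrable {R : realType} (s : R) (v : R -> R) (t : R) :=
  forall e : R, 0 < e ->
  mu.-integrable [set r : R | e < `|r|] (fun r => (frac_integrand s v t r)%:E).

(** Reflecting the negative half-line onto the positive one pairs the increments at r and -r. The
    principal value lives on this cancellation: second differences are quadratically small where
    single increments are only linear. *)
Lemma half_integrable_oy {R : realType} (s : R) (v : R -> R) (t e : R) : 0 < e ->
  mu.-integrable [set r : R | e < `|r|] (fun r => (frac_integrand s v t r)%:E) ->
  mu.-integrable `]e, +oo[ (EFin \o half_integrand s v t) /\
  frac_trunc s v t e = \int[mu]_(r in `]e, +oo[) half_integrand s v t r.
Proof.
move=> e0; rewrite /frac_trunc (normr_gt_setU e0) => fi.
pose f := frac_integrand s v t.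
have m1 : measurable (`]-oo, (- e)[%classic : set R) by exact: measurable_itv.
have m2 : measurable (`]e, +oo[%classic : set R) by exact: measurable_itv.
have f1 : mu.-integrable `]-oo, (- e)[ (EFin \o f).
  by apply: integrableS fi; [exact: measurableU|exact: m1|exact: subsetUl].
have f2 : mu.-integrable `]e, +oo[ (EFin \o f).
  by apply: integrableS fi; [exact: measurableU|exact: m2|exact: subsetUr].
have [f3 E] : mu.-integrable `]e, +oo[ (EFin \o (f \o -%R)) /\
    \int[mu]_(r in `]-oo, (- e)[) f r = \int[mu]_(r in `]e, +oo[) f (- r).
  by have := @integrable_opp _ `]e, +oo[%classic f m2; rewrite opp_preimage_oy => /(_ f1).
have hE : {in (`]e, +oo[%classic : set R), (fun r => f (- r) + f r) =1 half_integrand s v t}.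
  move=> r /set_mem/=; rewrite in_itv/= andbT => er.
  have r0 := lt_trans e0 er.
  rewrite /half_integrand /second_diff /f /frac_integrand normrN (gtr0_norm r0).
  by rewrite -mulrDl; congr (_ / _); ring.
split.
  have fD : mu.-integrable `]e, +oo[ ((EFin \o (f \o -%R)) \+ (EFin \o f))%E.
    by apply: integrableD => //; exact: m2.
  by refine (eq_integrable _ _ _ _ fD); [exact: m2|move=> r rD; rewrite /= -hE].
rewrite Rintegral_setU; [|exact: m1|exact: m2|exact: fi|exact: disjoint_normr_gt].
rewrite E -RintegralD; [|exact: m2|exact: f3|exact: f2].
by apply: eq_Rintegral => r rD; rewrite hE.
Qed.

Lemma frac_trunc_half {R : realType} (s : R) (v : R -> R) (t : R) :
  trunc_integrable s v t -> forall e, 0 < e ->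
  mu.-integrable `[e, +oo[ (EFin \o half_integrand s v t) /\
  frac_trunc s v t e = \int[mu]_(r in `[e, +oo[) half_integrand s v t r.
Proof.
move=> fi e e0; have e2 : 0 < e / 2 by rewrite divr_gt0.
have [h1 E] := half_integrable_oy e0 (fi _ e0).
have [h2 _] := half_integrable_oy e2 (fi _ e2).
split; last by rewrite E (Rintegral_itv_obnd_cbnd h1).
apply: integrableS h2; [exact: measurable_itv|exact: measurable_itv|].
by apply: subset_itvr; rewrite bnd_simp; lra.
Qed.

(** Growth |r|^s against the kernel |r|^(-1-2s) leaves |r|^(-1-s), which is integrable away from
    0. *)
Lemma growth_trunc_integrable {R : realType} (s : R) (v : R -> R) (t A : R) :
  0 < s -> s < 1 -> measurable_fun setT v ->
  (forall r, `|v (t + r) - v t| <= A * (1 + `|r| `^ s)) ->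
  trunc_integrable s v t.
Proof.
move=> s0 s1 mv gv e e0.
have A0 : 0 <= A.
  have := le_trans (normr_ge0 _) (gv 0).
  by rewrite normr0 powR0 ?gt_eqF// addr0 mulr1.
pose K (r : R) := `|r| `^ (- (1 + s)).
have m1 : measurable (`]-oo, (- e)[%classic : set R) by exact: measurable_itv.
have m2 : measurable (`]e, +oo[%classic : set R) by exact: measurable_itv.
have K2 : mu.-integrable `]e, +oo[ (EFin \o K).
  have := @Rintegral_powR_cy _ (- (1 + s)) e e0.
  have -> : - (1 + s) + 1 = - s by ring.
  rewrite oppr_lt0 => /(_ s0)[iK _].
  have iK2 : mu.-integrable `]e, +oo[ (EFin \o (fun x => x `^ (- (1 + s)))).
    by apply: integrableS iK; [exact: measurable_itv|exact: m2|apply: subset_itvr; rewrite bnd_simp].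
  refine (eq_integrable _ _ _ _ iK2); first exact: m2.
  move=> x /set_mem/=; rewrite in_itv/= andbT => ex.
  by rewrite /K/= gtr0_norm// (lt_trans e0).
have K1 : mu.-integrable `]-oo, (- e)[ (EFin \o K).
  have := @integrable_opp _ `]-oo, (- e)[%classic K m1.
  rewrite opp_preimage_Nyo => /(_ K2)[K3 _].
  by refine (eq_integrable _ _ _ _ K3); [exact: m1|move=> x _; rewrite /K/= normrN].
(* For |r| > e the constant 1 is absorbed by e^(-s) |r|^s. *)
pose A' := A * (e `^ (- s) + 1).
rewrite normr_gt_setU//.
have iK : mu.-integrable (`]-oo, (- e)[ `|` `]e, +oo[) (fun r => A'%:E * (K r)%:E)%E.
  apply: integrableZl; first exact: measurableU.
  by apply: integrableU => //; exact: disjoint_normr_gt.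
have mK p : measurable_fun setT (fun r : R => `|r| `^ p).
  exact: (measurableT_comp (measurable_powR p)).
apply: le_integrable iK; first exact: measurableU.
  apply/measurable_EFinP; apply: measurable_funTS.
  rewrite (_ : frac_integrand s v t = (fun r => (v (t + r) - v t) * `|r| `^ (- (1 + 2 * s)))).
    apply: measurable_funM; last exact: mK.
    apply: measurable_funB => //.
    apply: (measurableT_comp mv).
    exact: measurable_funD.
  by apply/funext => r; rewrite /frac_integrand powRN.
rewrite -normr_gt_setU// => r /= er.
have r0 : 0 < `|r| by exact: lt_trans er.
rewrite lee_fin /frac_integrand normrM normfV.
rewrite [`|_ `^ _|]ger0_norm ?powR_ge0//.
rewrite [leRHS]ger0_norm; last first.
  by rewrite mulr_ge0 ?powR_ge0// mulr_ge0// addr_ge0// powR_ge0.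
rewrite ler_pdivrMr ?powR_gt0//.
apply: le_trans (gv r) _.
rewrite -mulrA /K -powRD; last by rewrite (gt_eqF r0) implybT.
rewrite (_ : - (1 + s) + (1 + 2 * s) = s); last by ring.
rewrite /A' -mulrA ler_wpM2l// mulrDl mul1r lerD2r.
rewrite powRN mulrC ler_pdivlMr ?powR_gt0// mul1r.
by apply: (ge0_ler_powR (ltW s0)); rewrite ?nnegrE ltW.
Qed.

(** * Positivity of the normalising constant *)

Lemma powR_int01_lty {R : realType} (p : R) : -1 < p ->
  (\int[mu]_(x in `]0%R, 1%R]) (x `^ p)%:E < +oo)%E.
Proof.
move=> p1.
have q0 : 0 < p + 1 by lra.
have qN : p + 1 != 0 by rewrite gt_eqF.
(* The primitive is used on closed intervals with positive left end; starting at 1/(n+2) also keeps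
   that end strictly below 1. *)
pose F (n : nat) : set R := `[n.+2%:R^-1, 1]%classic.
have FU : \bigcup_n F n = `]0%R, 1%R]%classic.
  apply/seteqP; split => x /=.
    move=> [n _]; rewrite /F/= !in_itv/= => /andP[nx ->]; rewrite andbT.
    by apply: lt_le_trans nx; rewrite invr_gt0.
  rewrite in_itv/= => /andP[x0 x1]; exists (Num.truncn x^-1) => //.
  rewrite /F/= in_itv/= x1 andbT invf_ple ?posrE//.
  apply: (@le_trans _ _ (Num.truncn x^-1).+1%:R); last by rewrite ler_nat.
  by apply: ltW; apply: truncnS_gt.
have : (\int[mu]_(x in F i) (x `^ p)%:E)%E @[i --> \oo] -->
    (\int[mu]_(x in \bigcup_i F i) (x `^ p)%:E)%E.
  apply: ge0_nondecreasing_set_cvg_integral.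
  - move=> m n mn; apply/subsetPset => x /=; rewrite /F/= !in_itv/= => /andP[mx ->].
    rewrite andbT; apply: le_trans mx.
    by rewrite lef_pV2 ?posrE// ler_nat ltnS ltnS.
  - by move=> n; exact: measurable_itv.
  - by move=> n; apply/measurable_EFinP; apply: measurable_funTS; exact: measurable_powR.
  - by move=> n x _; rewrite lee_fin powR_ge0.
rewrite FU => cv.
apply: (@le_lt_trans _ _ ((p + 1)^-1)%:E); last exact: ltry.
move/cvg_lim : (cv) => <- //.
apply: lime_le; first by apply/cvg_ex; eexists; exact: cv.
apply: nearW => n.
have n0 : 0 < (n.+2%:R^-1 : R) by rewrite invr_gt0.
have n1 : (n.+2%:R^-1 : R) < 1 by rewrite invf_lt1// ltr1n.
have [ii II] := Rintegral_powR_cc n0 n1 qN.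
rewrite /F -[leLHS]fineK; last exact: integrable_fin_num.
by rewrite -/(Rintegral _ _ _) II lee_fin powR1 ler_pdivrMr// mulVf// gerBl powR_ge0.
Qed.

(** Finiteness matters as much as positivity, because [Rintegral] takes [fine], which sends +oo to
    0. Near 0 the integrand is below t^(z-1), near infinity below 6 t^(-2), from e^t >= t^3/6 and z
    <= 2; the interval [1,2] alone gives positive mass. *)
Lemma Gamma_gt0 {R : realType} (z : R) : 0 < z -> z <= 2 -> 0 < Gamma z.
Proof.
move=> z0 z2; pose f (t : R) := t `^ (z - 1) * expR (- t).
have f0 t : 0 <= f t by rewrite mulr_ge0 ?powR_ge0// expR_ge0.
have mf D : measurable_fun D f.
  apply: measurable_funTS; apply: measurable_funM; first exact: measurable_powR.
  by apply: measurableT_comp => //; exact: oppr_measurable.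
have mE D : measurable_fun D (EFin \o f) by exact/measurable_EFinP.
have E0 : (`]0, +oo[%classic : set R) = `]0, 1] `|` `]1, +oo[.
  by rewrite (@itv_bndbnd_setU _ _ _ (BRight 1)) ?bnd_simp.
have fin : (\int[mu]_(t in `]0%R, +oo[) (f t)%:E < +oo)%E.
  rewrite E0 ge0_integral_setU//=; last first.
  - apply/disj_setPS => r /= []; rewrite !in_itv/= andbT => /andP[_ r1] r2.
    by have := lt_le_trans r2 r1; rewrite ltxx.
  - by move=> x _; rewrite lee_fin.
  - exact: mE.
  apply: lte_add_pinfty.
  + apply: (@le_lt_trans _ _ (\int[mu]_(x in `]0%R, 1%R]) (x `^ (z - 1))%:E)%E).
      apply: ge0_le_integral => //=.
      * by move=> x _; rewrite lee_fin.
      * exact: mE.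
      * by apply/measurable_EFinP; apply: measurable_funTS; exact: measurable_powR.
      * move=> x; rewrite in_itv/= => /andP[x0 _]; rewrite lee_fin /f.
        rewrite -[leRHS]mulr1 ler_wpM2l ?powR_ge0// -expR0 ler_expR.
        by rewrite oppr_le0 ltW.
    by apply: powR_int01_lty; lra.
  + have m21 : -2 + 1 < 0 :> R by lra.
    have [i1 _] := Rintegral_powR_cy ltr01 m21.
    have i6 : mu.-integrable `[1, +oo[ (fun x : R => 6%:E * (x `^ (-2))%:E)%E.
      exact: integrableZl.
    have i7 : mu.-integrable `[1, +oo[ (EFin \o f).
      apply: le_integrable i6 => //; first exact: mE.
      move=> x /=; rewrite in_itv/= andbT => x1.
      have x0 : 0 < x by exact: lt_le_trans x1.
      rewrite lee_fin !ger0_norm ?f0 ?mulr_ge0 ?powR_ge0//.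
      apply: (@le_trans _ _ (x * expR (- x))).
        rewrite ler_wpM2r ?expR_ge0// -[leRHS]powRr1 ?(ltW x0)//.
        by apply: ler_powR => //; lra.
      rewrite powRN powR_mulrn ?(ltW x0)// expRN ler_pdivrMr ?expR_gt0//.
      have e3 := expR_ge1Dxn 2 (ltW x0).
      have {}e3 : x ^+ 3 / 6 <= expR x by apply: le_trans e3; rewrite lerDr.
      rewrite mulrAC ler_pdivlMr ?exprn_gt0// -exprS.
      by move: e3; rewrite ler_pdivrMr// mulrC.
    rewrite (_ : (\int[mu]_(t in `]1%R, +oo[) (f t)%:E)%E = \int[mu]_(t in `[1%R, +oo[) (f t)%:E)%E.
      exact: integrable_lty.
    exact: integral_itv_obnd_cbnd.
rewrite /Gamma /Rintegral -/f fine_gt0// fin andbT.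
apply: (@lt_le_trans _ _ (\int[mu]_(x in `[1%R, 2%R]) (expR (- 2) / 2)%:E)%E).
  rewrite integral_cst//= lebesgue_measure_itv/= lte_fin ltr1n.
  by rewrite -EFinD -EFinM lte_fin mulr_gt0 ?divr_gt0 ?expR_gt0//; lra.
apply: (@le_trans _ _ (\int[mu]_(x in `[1%R, 2%R]) (f x)%:E)%E); last first.
  apply: ge0_subset_integral => //=.
  - exact: mE.
  - by move=> x _; rewrite lee_fin.
  - by move=> x /=; rewrite !in_itv/= andbT => /andP[x1 _]; exact: lt_le_trans x1.
apply: ge0_le_integral => //=.
- exact: mE.
- move=> x; rewrite in_itv/= => /andP[x1 x2]; rewrite lee_fin /f mulrC.
  have x0 : 0 < x by exact: lt_le_trans x1.
  apply: ler_pM; rewrite ?expR_ge0//.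
    apply: (@le_trans _ _ (x `^ (-1))).
      by rewrite powR_inv1 ?(ltW x0)// lef_pV2 ?posrE.
    by apply: ler_powR => //; lra.
  by rewrite ler_expR lerN2.
Qed.

(** This sign is what lets inequalities pass between truncated integrals and [frac_lap1]. *)
Lemma frac_const_gt0 {R : realType} (s : R) : 0 < s -> s < 1 -> 0 < frac_const s.
Proof.
move=> s0 s1; rewrite /frac_const divr_gt0// !mulr_gt0 ?powR_gt0//.
- by apply: Gamma_gt0; lra.
- by rewrite sqrtr_gt0 pi_gt0.
- by apply: Gamma_gt0; lra.
Qed.

Lemma measurable_itvR {R : realType} (i : interval R) :
  measurable ([set` i] : set (measurableTypeR R)).
Proof. exact: measurable_itv. Qed.

Lemma Rintegral_split {R : realType} (f : R -> R) (a c : R) : a <= c ->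
  mu.-integrable `[a, +oo[ (EFin \o f) ->
  \int[mu]_(r in `[a, +oo[) f r =
  \int[mu]_(r in `[a, c]) f r + \int[mu]_(r in `[c, +oo[) f r.
Proof.
move=> ac fi.
have := @Rintegral_itvB _ f (BLeft a) (BInfty _ false) c fi.
rewrite Rintegral_itv_obnd_cbnd; last first.
  apply: integrableS fi; try exact: measurable_itvR.
  by apply: subset_itvr; rewrite bnd_simp.
by rewrite !bnd_simp => /(_ ac isT) <-; rewrite addrC subrK.
Qed.

Lemma integrable_itv_sub {R : realType} (f : R -> R) (a : R) (i : interval R) :
  (i <= `[a, +oo[)%O -> mu.-integrable `[a, +oo[ (EFin \o f) ->
  mu.-integrable [set` i] (EFin \o f).
Proof.
move=> ia fi; apply: integrableS fi; try exact: measurable_itvR.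
by move=> x /=; apply: subitvP.
Qed.

Lemma integrable_mulr {R : realType} (D : set (measurableTypeR R)) (f : R -> R) (k : R) :
  measurable D -> mu.-integrable D (EFin \o f) ->
  mu.-integrable D (EFin \o (fun r => k * f r)).
Proof. by move=> mD fi; apply: (integrableZl mD k fi). Qed.

Lemma measurable_normr_gt {R : realType} (e : R) : 0 < e ->
  measurable ([set r : R | e < `|r|] : set (measurableTypeR R)).
Proof. by move=> e0; rewrite normr_gt_setU//; apply: measurableU; exact: measurable_itvR. Qed.

(** * Estimates, existence and linearity of the operator *)

Section lap.
Context {R : realType}.
Variable s : R.
Hypotheses (s0 : 0 < s) (s1 : s < 1).
Implicit Types (f v : R -> R) (t L : R).

Let s22 : 0 < 2 - 2 * s. Proof. have := s1; lra. Qed.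
Let s20 : 0 < 2 * s. Proof. have := s0; lra. Qed.

Lemma powR_sqr_quot (r : R) : 0 < r -> r ^+ 2 / r `^ (1 + 2 * s) = r `^ (1 - 2 * s).
Proof.
move=> r0; rewrite -(powR_mulrn 2 (ltW r0)) -powRB ?(gt_eqF r0) ?implybT//.
by congr (_ `^ _); ring.
Qed.

Lemma int_sqr_quot (a e rho : R) : 0 < e -> e < rho ->
  mu.-integrable `[e, rho] (EFin \o (fun r => a * r ^+ 2 / r `^ (1 + 2 * s))) /\
  \int[mu]_(r in `[e, rho]) (a * r ^+ 2 / r `^ (1 + 2 * s)) =
    a * (rho `^ (2 - 2 * s) - e `^ (2 - 2 * s)) / (2 - 2 * s).
Proof.
move=> e0 er; have [] := @Rintegral_powR_cc _ (1 - 2 * s) e rho e0 er.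
  by rewrite (_ : 1 - 2 * s + 1 = 2 - 2 * s) ?gt_eqF//; ring.
rewrite (_ : 1 - 2 * s + 1 = 2 - 2 * s); last by ring.
move=> i1 I1.
have iE : {in (`[e, rho]%classic : set R), (fun r => a * r `^ (1 - 2 * s)) =1
    (fun r => a * r ^+ 2 / r `^ (1 + 2 * s))}.
  move=> r /set_mem/=; rewrite in_itv/= => /andP[er' _].
  by rewrite -mulrA powR_sqr_quot// (lt_le_trans e0).
split.
  have i2 : mu.-integrable `[e, rho] (fun r => a%:E * (r `^ (1 - 2 * s))%:E)%E.
    by apply: integrableZl => //; exact: measurable_itvR.
  by refine (eq_integrable _ _ _ _ i2); [exact: measurable_itvR|move=> r rD; rewrite /= -iE].
have -> : \int[mu]_(r in `[e, rho]) (a * r ^+ 2 / r `^ (1 + 2 * s)) =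
    \int[mu]_(r in `[e, rho]) (a * r `^ (1 - 2 * s)).
  by apply: eq_Rintegral => r rD; rewrite iE.
by rewrite (RintegralZl _ (measurable_itvR _) i1) I1 mulrA.
Qed.

Lemma int_tail (b eta : R) : 0 < eta ->
  mu.-integrable `[eta, +oo[ (EFin \o (fun r => b / r `^ (1 + 2 * s))) /\
  \int[mu]_(r in `[eta, +oo[) (b / r `^ (1 + 2 * s)) =
    b * eta `^ (- (2 * s)) / (2 * s).
Proof.
move=> e0; have := @Rintegral_powR_cy _ (- (1 + 2 * s)) eta e0.
have -> : - (1 + 2 * s) + 1 = - (2 * s) by ring.
rewrite oppr_lt0 => /(_ s20) [i1 I1].
have E : (fun r : R => b / r `^ (1 + 2 * s)) = (fun r => b * r `^ (- (1 + 2 * s))).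
  by apply/funext => r; rewrite powRN.
rewrite E; split.
  exact: (integrable_mulr b (measurable_itvR _) i1).
rewrite (RintegralZl _ (measurable_itvR _) i1) I1.
by field; rewrite gt_eqF.
Qed.

(** The three zones fit a contact point: quadratic control near it, maximality at middle distance,
    exterior data far away. The near zone carries the factor 1/(2-2s), the far zone 1/(2s). *)
Lemma trunc_bound f t (a b rho eta e : R) : trunc_integrable s f t ->
  0 < e -> e < rho -> rho <= eta ->
  (forall r, 0 < r -> r <= rho -> second_diff f t r <= a * r ^+ 2) ->
  (forall r, rho < r -> r <= eta -> second_diff f t r <= 0) ->
  (forall r, eta < r -> second_diff f t r <= b) ->
  frac_trunc s f t e <= a * (rho `^ (2 - 2 * s) - e `^ (2 - 2 * s)) / (2 - 2 * s)
    + b * eta `^ (- (2 * s)) / (2 * s).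
Proof.
move=> fi e0 er re H1 H2 H3.
have rho0 := lt_trans e0 er; have eta0 := lt_le_trans rho0 re.
have [hi ->] := frac_trunc_half fi e0.
rewrite (Rintegral_split (ltW er) hi).
have [hi2 _] := frac_trunc_half fi rho0.
have [hi3 _] := frac_trunc_half fi eta0.
rewrite (Rintegral_split re hi2).
have [i1 <-] := int_sqr_quot a e0 er.
have [i2 <-] := int_tail b eta0.
apply: lerD.
  apply: le_Rintegral => //.
    by apply: integrable_itv_sub hi; rewrite subitvE !bnd_simp.
  move=> r /=; rewrite in_itv/= => /andP[er' rr].
  by rewrite /half_integrand ler_wpM2r ?invr_ge0 ?powR_ge0// H1// (lt_le_trans e0).
rewrite -[leRHS]add0r; apply: lerD.
  have hi4 : mu.-integrable `]rho, eta] (EFin \o half_integrand s f t).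
    by apply: integrable_itv_sub hi2; rewrite subitvE !bnd_simp.
  rewrite -(Rintegral_itv_obnd_cbnd hi4).
  have m : measurable (`]rho, eta]%classic : set (measurableTypeR R)) by exact: measurable_itvR.
  have <- : \int[mu]_(r in `]rho, eta]) (0 : R) = 0 by rewrite Rintegral_cst ?mul0r.
  apply: le_Rintegral => //; first exact: integrable0.
  move=> r /=; rewrite in_itv/= => /andP[rr re'].
  by rewrite /half_integrand mulr_le0_ge0 ?invr_ge0 ?powR_ge0// H2.
have hi5 : mu.-integrable `]eta, +oo[ (EFin \o half_integrand s f t).
  by apply: integrable_itv_sub hi3; rewrite subitvE !bnd_simp.
have i5 : mu.-integrable `]eta, +oo[ (EFin \o (fun r => b / r `^ (1 + 2 * s))).
  by apply: integrable_itv_sub i2; rewrite subitvE !bnd_simp.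
rewrite -(Rintegral_itv_obnd_cbnd hi5) -(Rintegral_itv_obnd_cbnd i5).
apply: le_Rintegral => //.
move=> r /=; rewrite in_itv/= andbT => er'.
by rewrite /half_integrand ler_wpM2r ?invr_ge0 ?powR_ge0// H3.
Qed.

Lemma lap_bound f t L (a b rho eta : R) : frac_lap1 s f t L ->
  0 < rho -> rho <= eta ->
  (forall r, 0 < r -> r <= rho -> second_diff f t r <= a * r ^+ 2) ->
  (forall r, rho < r -> r <= eta -> second_diff f t r <= 0) ->
  (forall r, eta < r -> second_diff f t r <= b) ->
  L <= frac_const s * (a * rho `^ (2 - 2 * s) / (2 - 2 * s)
    + b * eta `^ (- (2 * s)) / (2 * s)).
Proof.
move=> [fi fL] rho0 re H1 H2 H3.
apply: (ler_cvg_to fL (g := fun e => frac_const s *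
  (a * (rho `^ (2 - 2 * s) - e `^ (2 - 2 * s)) / (2 - 2 * s)
    + b * eta `^ (- (2 * s)) / (2 * s)))).
  apply: cvgMr; apply: cvgD; last exact: cvg_cst.
  apply: cvgMl; apply: cvgMr.
  rewrite -[X in _ --> X](subr0 (rho `^ (2 - 2 * s))).
  by apply: cvgB; [exact: cvg_cst|exact: powR_cvg0].
near=> e; rewrite ler_pM2l ?frac_const_gt0//.
by apply: trunc_bound.
Unshelve. all: end_near. Qed.

Lemma half_sub (f : R -> R) t e1 e2 : trunc_integrable s f t -> 0 < e1 -> e1 <= e2 ->
  frac_trunc s f t e1 - frac_trunc s f t e2 =
  \int[mu]_(r in `[e1, e2]) half_integrand s f t r.
Proof.
move=> fi e10 e12.
have [h1 ->] := frac_trunc_half fi e10.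
have [h2 ->] := frac_trunc_half fi (lt_le_trans e10 e12).
by rewrite (Rintegral_split e12 h1) addrK.
Qed.

(** The increments of the truncated integral are dominated by those of [q]. Hence truncation plus
    [q] is nondecreasing and bounded below near 0, so it has a right limit, and [q] itself tends to
    0. *)
Lemma lap_exists f t (C d : R) : trunc_integrable s f t -> 0 < d ->
  (forall r, 0 < r -> r <= d -> `|second_diff f t r| <= C * r ^+ 2) ->
  exists L, frac_lap1 s f t L.
Proof.
move=> fi d0 H.
pose q (e : R) := C * e `^ (2 - 2 * s) / (2 - 2 * s).
pose T (e : R) := frac_trunc s f t e.
have key e1 e2 : 0 < e1 -> e1 < e2 -> e2 <= d -> `|T e1 - T e2| <= q e2 - q e1.
  move=> e10 e12 e2d; rewrite /T (half_sub fi e10 (ltW e12)).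
  have [i1 I1] := int_sqr_quot C e10 e12.
  have -> : q e2 - q e1 = C * (e2 `^ (2 - 2 * s) - e1 `^ (2 - 2 * s)) / (2 - 2 * s).
    by rewrite /q -mulrBl -mulrBr.
  have [hi _] := frac_trunc_half fi e10.
  have hi2 : mu.-integrable `[e1, e2] (EFin \o half_integrand s f t).
    by apply: integrable_itv_sub hi; rewrite subitvE !bnd_simp.
  have m : measurable (`[e1, e2]%classic : set (measurableTypeR R)) by exact: measurable_itvR.
  apply: le_trans (le_normr_Rintegral m hi2) _; rewrite -I1.
  apply: le_Rintegral => //.
    exact: integrable_norm.
  move=> r /=; rewrite in_itv/= => /andP[r1 r2].
  have r0 : 0 < r by exact: lt_le_trans r1.
  rewrite /half_integrand normrM normfV (ger0_norm (powR_ge0 _ _)).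
  by rewrite ler_wpM2r ?invr_ge0 ?powR_ge0// H// (le_trans r2).
have cvq : q e @[e --> 0^'+] --> 0.
  rewrite -[X in _ --> X](mul0r (2 - 2 * s)^-1); apply: cvgMl.
  exact: cvg_powR0_right.
have cT : cvg ((fun e => T e + q e) e @[e --> 0^'+]).
  apply: nondecreasing_at_right_is_cvgr.
    near=> x => e1 e2; rewrite !in_itv/= => /andP[e10 _] /andP[_ e2x].
    rewrite le_eqVlt => /predU1P[->//|e12].
    have e2d : e2 <= d by apply: ltW; apply: lt_trans e2x _; near: x; exact: nbhs_right_lt.
    have := key e1 e2 e10 e12 e2d; rewrite ler_norml => /andP[_]; lra.
  near=> x; exists (T d - q d) => y [e/=]; rewrite in_itv/= => /andP[e10 ex] <-.
  have ed : e < d by apply: lt_trans ex _; near: x; exact: nbhs_right_lt.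
  have := key e d e10 ed (lexx d); rewrite ler_norml => /andP[+ _].
  have C0 : 0 <= C.
    have := le_trans (normr_ge0 _) (H d d0 (lexx d)).
    by rewrite pmulr_lge0// exprn_gt0.
  have : 0 <= q e by rewrite /q divr_ge0 ?(ltW s22)// mulr_ge0// powR_ge0.
  lra.
move/cvg_ex : cT => [l cl].
exists (frac_const s * l); split => //.
apply: cvgMr.
have -> : frac_trunc s f t = (fun e => (T e + q e) - q e) by apply/funext => e; rewrite addrK.
by rewrite -[X in _ --> X](subr0 l); apply: cvgB.
Unshelve. all: end_near. Qed.

Lemma lap_le f g t L M : f t = g t -> (forall x, f x <= g x) ->
  frac_lap1 s f t L -> frac_lap1 s g t M -> L <= M.
Proof.
move=> fgt fg [fi fL] [gi gM].
apply: (ler_cvg_to fL gM); near=> e.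
have e0 : 0 < e by near: e; exact: nbhs_right_gt.
rewrite ler_pM2l ?frac_const_gt0//.
apply: le_Rintegral => //.
- exact: measurable_normr_gt.
- exact: fi.
- exact: gi.
- move=> r _; rewrite /frac_integrand ler_wpM2r ?invr_ge0 ?powR_ge0//.
  by rewrite fgt lerB.
Unshelve. all: end_near. Qed.

Lemma lap_lin f g t L M (a b : R) : frac_lap1 s f t L -> frac_lap1 s g t M ->
  frac_lap1 s (fun x => a * f x + b * g x) t (a * L + b * M).
Proof.
move=> [fi fL] [gi gM].
have E : frac_integrand s (fun x => a * f x + b * g x) t =
    (fun r => a * frac_integrand s f t r + b * frac_integrand s g t r).
  by apply/funext => r; rewrite /frac_integrand !mulrA -mulrDl; congr (_ / _); ring.
have mD := @measurable_normr_gt R.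
have fai e : 0 < e -> mu.-integrable [set r : R | e < `|r|]
    (EFin \o (fun r => a * frac_integrand s f t r)).
  by move=> e0; exact: (integrable_mulr a (mD _ e0) (fi _ e0)).
have gbi e : 0 < e -> mu.-integrable [set r : R | e < `|r|]
    (EFin \o (fun r => b * frac_integrand s g t r)).
  by move=> e0; exact: (integrable_mulr b (mD _ e0) (gi _ e0)).
split.
  move=> e e0; rewrite E.
  by apply: integrableD (fai e e0) (gbi e e0); exact: mD.
apply: (@cvg_trans _ ((fun e => a * (frac_const s * frac_trunc s f t e) +
    b * (frac_const s * frac_trunc s g t e)) e @[e --> 0^'+])).
  apply: near_eq_cvg; near=> e.
  have e0 : 0 < e by near: e; exact: nbhs_right_gt.
  rewrite /frac_trunc E (RintegralD (mD e e0) (fai e e0) (gbi e e0)).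
  rewrite (RintegralZl _ (mD e e0) (fi _ e0)) (RintegralZl _ (mD e e0) (gi _ e0)).
  ring.
by apply: cvgD; apply: cvgMr.
Unshelve. all: end_near. Qed.

Lemma lap_cst (c : R) t : frac_lap1 s (fun=> c) t 0.
Proof.
have E : frac_integrand s (fun=> c) t = cst 0.
  by apply/funext => r; rewrite /frac_integrand subrr mul0r.
split.
  by move=> e e0; rewrite E; exact: integrable0.
have Z D : Rintegral mu D (cst 0 : R -> R) = 0 by rewrite /Rintegral integral0_eq.
rewrite (_ : (fun eps => _) = cst 0); first exact: cvg_cst.
by apply/funext => e; rewrite /frac_trunc E Z mulr0.
Qed.
End lap.

(** * Second-order control of test functions and of powers *)

Lemma C2_quadratic {R : realType} (t0 A B K : R) :
  C2_real (fun t => A + B * (t - t0) + K * (t - t0) ^+ 2).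
Proof.
have D0 (a b t : R) : is_derive t 1 (fun t : R => a + b * (t - t0)) b.
  rewrite (_ : (fun _ => _) = cst a + b \*: (id - cst t0)) //.
  apply: (is_derive_eq (is_deriveD (is_derive_cst (a : R^o) (t : R^o) 1)
    (is_deriveZ b (is_deriveB (is_derive_id (t : R^o) 1) (is_derive_cst (t0 : R^o) (t : R^o) 1))))).
  by rewrite add0r subr0 /GRing.scale/= mulr1.
have D1 (t : R) : is_derive t 1 (fun t => A + B * (t - t0) + K * (t - t0) ^+ 2)
    (B + 2 * K * (t - t0)).
  rewrite (_ : (fun _ => _) = (fun t : R => A + B * (t - t0)) +
    K \*: ((fun t : R => 0 + 1 * (t - t0)) * (fun t : R => 0 + 1 * (t - t0)))); last first.
    apply/funext => x; rewrite !fctE /= -[K *: _]/(K * _); ring.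
  apply: (is_derive_eq (is_deriveD (D0 A B t) (is_deriveZ K (is_deriveM (D0 0 1 t) (D0 0 1 t))))).
  by rewrite /GRing.scale/=; ring.
have E1 : derive1 (fun t => A + B * (t - t0) + K * (t - t0) ^+ 2) =
    (fun t => B + 2 * K * (t - t0)).
  by apply/funext => t; rewrite derive1E; have [_ ->] := D1 t.
have E2 : derive1 (fun t => B + 2 * K * (t - t0)) = cst (2 * K).
  by apply/funext => t; rewrite derive1E; have [_ ->] := D0 B (2 * K) t.
split; first by move=> t; have [] := D1 t.
rewrite E1; split; first by move=> t; have [] := D0 B (2 * K) t.
by rewrite E2; exact: cst_continuous.
Qed.

(** The mean value theorem twice: for the even sum [g] on [0,h], then for the derivative of [phi]
    between t0 - c and t0 + c. [M] bounds the second derivative on the unit neighbourhood. *)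
Lemma C2_second_diff {R : realType} (phi : R -> R) (t0 : R) : C2_real phi ->
  exists C, forall h, 0 < h -> h <= 1 -> `|second_diff phi t0 h| <= C * h ^+ 2.
Proof.
move=> [d1 [d2 c2]].
have le01 : t0 - 1 <= t0 + 1 by lra.
have [M M0 HM] : exists2 M, 0 <= M & forall x, t0 - 1 <= x -> x <= t0 + 1 ->
    `|derive1 (derive1 phi) x| <= M.
  have cn : {within `[t0 - 1, t0 + 1], continuous (fun x => `|derive1 (derive1 phi) x|)}.
    apply: continuous_subspaceT => x; apply: (@continuous_comp _ _ _ (derive1 (derive1 phi)) Num.norm).
      exact: c2.
    exact: norm_continuous.
  have [c _ Hc] := EVT_max le01 cn.
  exists `|derive1 (derive1 phi) c|; first exact: normr_ge0.
  by move=> x x1 x2; apply: Hc; rewrite in_itv/= x1.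
have D1 (x : R) : is_derive x 1 phi (derive1 phi x) by rewrite derive1E; apply: DeriveDef.
have D2 (x : R) : is_derive x 1 (derive1 phi) (derive1 (derive1 phi) x).
  by rewrite [X in is_derive _ _ _ X]derive1E; apply: DeriveDef.
exists (2 * M) => h h0 h1.
pose g (x : R) := phi (t0 + x) + phi (t0 - x).
have Dsh (c x : R) : is_derive x 1 (fun x => t0 + c * x) c.
  rewrite (_ : (fun _ => _) = cst t0 + c \*: id) //.
  apply: (is_derive_eq (is_deriveD (is_derive_cst (t0 : R^o) (x : R^o) 1)
    (is_deriveZ c (is_derive_id (x : R^o) 1)))).
  by rewrite add0r /GRing.scale/= mulr1.
have gE : g = (phi \o (fun x => t0 + 1 * x)) + (phi \o (fun x => t0 + (-1) * x)).
  by apply/funext => x; rewrite !fctE /= /g mul1r mulN1r.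
have Dg (x : R) : is_derive x 1 g (derive1 phi (t0 + x) - derive1 phi (t0 - x)).
  rewrite gE.
  apply: (is_derive_eq (is_deriveD (is_derive1_comp (D1 _) (Dsh 1 x))
    (is_derive1_comp (D1 _) (Dsh (-1) x)))).
  by rewrite mul1r mulN1r mulr1 mulrN1.
have cont (f df : R -> R) (a b : R) : (forall x : R, is_derive x 1 f (df x)) -> {within `[a, b], continuous f}.
  move=> Df; apply: continuous_subspaceT => x; apply: differentiable_continuous.
  by apply/derivable1_diffP; have [] := Df x.
have [c] := @MVT _ g _ 0 h h0 (fun x _ => Dg x) (cont _ _ _ _ Dg).
rewrite in_itv/= => /andP[c0 ch] Eg.
have t0c : t0 - c < t0 + c by lra.
have [z] := @MVT _ _ _ _ _ t0c (fun x _ => D2 x) (cont _ _ _ _ D2).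
rewrite in_itv/= => /andP[z1 z2] Ez.
have -> : second_diff phi t0 h = g h - g 0 by rewrite /second_diff /g subr0 addr0; ring.
rewrite Eg Ez subr0 !normrM (gtr0_norm h0).
have -> : t0 + c - (t0 - c) = 2 * c by ring.
have c20 : 0 < 2 * c by rewrite mulr_gt0.
rewrite (gtr0_norm c20).
have {}Hz : `|derive1 (derive1 phi) z| <= M by apply: HM; lra.
have -> : 2 * M * h ^+ 2 = M * (2 * h) * h by ring.
by rewrite ler_wpM2r ?(ltW h0)// ler_pM//; lra.
Qed.

(** The upper estimate is the tangent bound for the exponent s. The lower one divides 1 + z by
    (1+z)^(1-s), which obeys the tangent bound for the exponent 1 - s. *)
Lemma powR_taylor2 {R : realType} (s z : R) : 0 < s -> s < 1 -> `|z| <= 2^-1 ->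
  `|(1 + z) `^ s - 1 - s * z| <= z ^+ 2.
Proof.
move=> s0 s1; rewrite ler_norml => /andP[z1 z2].
have w0 : 0 < 1 + z by lra.
have up := powR_young s0 s1 (ltW w0).
have s1' : 0 < 1 - s by lra.
have s1'' : 1 - s < 1 by lra.
have lo := powR_young s1' s1'' (ltW w0).
have E : (1 + z) `^ s * (1 + z) `^ (1 - s) = 1 + z.
  by rewrite -powRD ?(gt_eqF w0) ?implybT// (_ : s + (1 - s) = 1) ?powRr1 ?(ltW w0)//; ring.
have P0 : 0 < (1 + z) `^ s by rewrite powR_gt0.
set P := (1 + z) `^ s in up E P0 *; set Q := (1 + z) `^ (1 - s) in lo E.
have EQ : 1 + z <= P * (1 + (1 - s) * z).
  rewrite -E ler_pM2l//; apply: le_trans lo _; lra.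
have z20 : 0 <= z ^+ 2 by exact: sqr_ge0.
have d0 : 2^-1 <= 1 + (1 - s) * z by nra.
rewrite ler_norml; apply/andP; split; last by lra.
have : 0 < (1 + (1 - s) * z) by lra.
move: EQ d0; set D := 1 + (1 - s) * z => EQ d0 D0.
rewrite -(ler_pM2r D0).
have : (1 + s * z) * D = 1 + z + s * (1 - s) * z ^+ 2 by rewrite /D; ring.
have : s * (1 - s) <= 2^-1 by nra.
nra.
Qed.

Lemma pospow_scale {R : realType} (s x y : R) : 0 <= x ->
  pospow s (x * y) = x `^ s * pospow s y.
Proof.
move=> x0; rewrite /pospow -[X in Num.max _ X](mulr0 x) -maxr_pMr//.
by rewrite powRM// le_max lexx orbT.
Qed.

Section affine.
Context {R : realType}.
Variables (s a b : R).
Hypotheses (s0 : 0 < s) (s1 : s < 1).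
Let f (x : R) := pospow s (a + b * x).

Lemma continuous_pospow_affine : continuous f.
Proof.
move=> x; apply: (@continuous_comp _ _ _ (fun x => a + b * x) (pospow s)).
  by apply: continuousD; [exact: cst_continuous|apply: continuousM; [exact: cst_continuous|exact: id]].
exact: (continuous_pospow s0 (ltW s1)).
Qed.

Lemma pospow_affine_growth x r : `|f (x + r) - f x| <= `|b| `^ s * (1 + `|r| `^ s).
Proof.
apply: le_trans (pospowB _ _ s0 (ltW s1)) _.
have -> : a + b * (x + r) - (a + b * x) = b * r by ring.
by rewrite normrM powRM// ler_wpM2l ?powR_ge0// lerDr.
Qed.

Lemma pospow_affine_taylor t : 0 < a + b * t ->
  exists C d B, 0 < d /\ forall h, `|h| <= d -> `|f (t + h) - f t - B * h| <= C * h ^+ 2.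
Proof.
set X := a + b * t => X0; have XN : X != 0 by rewrite gt_eqF.
(* Homogeneity writes f(t+h) as X^s (1 + b h / X)^s; the radius forces |b h / X| <= 1/2, and the
   summand 1 in it covers b = 0. *)
exists (X `^ s * (b / X) ^+ 2), (X / (2 * (`|b| + 1))), (X `^ s * s * (b / X)).
have b1 : 0 < `|b| + 1 by rewrite ltr_wpDl.
split; first by rewrite divr_gt0// mulr_gt0.
move=> h; rewrite ler_pdivlMr ?mulr_gt0// => hd.
have zh : `|b / X * h| <= 2^-1.
  rewrite normrM normrM normfV (gtr0_norm X0) mulrAC ler_pdivrMr//.
  have : `|b| * `|h| <= (`|b| + 1) * `|h| by rewrite ler_wpM2r// lerDl.
  lra.
have := powR_taylor2 s0 s1 zh.
have fE : f (t + h) = X `^ s * (1 + b / X * h) `^ s.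
  rewrite /f; have -> : a + b * (t + h) = X * (1 + b / X * h) by rewrite /X; field.
  rewrite pospow_scale ?(ltW X0)// pospow_pos//.
  move: zh; rewrite ler_norml => /andP[]; lra.
have ft : f t = X `^ s by rewrite /f -/X pospow_pos// ltW.
rewrite fE ft -(ler_pM2l (powR_gt0 s X0)) => H.
have -> : X `^ s * (1 + b / X * h) `^ s - X `^ s - X `^ s * s * (b / X) * h =
  X `^ s * ((1 + b / X * h) `^ s - 1 - s * (b / X * h)) by ring.
rewrite normrM (ger0_norm (powR_ge0 _ _)).
by apply: le_trans H _; rewrite exprMn mulrA.
Qed.

(** Homogeneity moves the point to 1 with increments scaled by k = |b|/X; the sign of b only
    exchanges the two terms of the second difference. *)
Lemma pospow_affine_lap t : 0 < a + b * t -> frac_lap1 s f t 0.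
Proof.
set X := a + b * t => X0; have XN : X != 0 by rewrite gt_eqF.
have [b0|bN] := eqVneq b 0.
  have -> : f = (fun=> pospow s a) by apply/funext => x; rewrite /f b0 mul0r addr0.
  exact: lap_cst.
have fi : trunc_integrable s f t.
  apply: (@growth_trunc_integrable _ s f t (`|b| `^ s)) => //.
    exact: (continuous_measurable_fun continuous_pospow_affine).
  by move=> r; exact: pospow_affine_growth.
split; first exact: fi.
pose k := `|b| / X.
have k0 : 0 < k by rewrite divr_gt0// normr_gt0.
pose h (r : R) := (pospow s (1 + k * r) + pospow s (1 - k * r) - 2) / r `^ (1 + 2 * s).
have sc r : pospow s (X + b * r) + pospow s (X - b * r) =
    X `^ s * (pospow s (1 + k * r) + pospow s (1 - k * r)).
  have aux c : pospow s (X + c * r) = X `^ s * pospow s (1 + c / X * r).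
    by rewrite -pospow_scale ?(ltW X0)//; congr pospow; field.
  rewrite -mulNr !aux -mulrDr /k; congr (_ * _).
  have [c0|c0] := leP 0 b.
    by rewrite ger0_norm// -!mulNr.
  by rewrite ltr0_norm// -!mulNr !opprK addrC.
have hE : half_integrand s f t = (fun r => X `^ s * h r).
  apply/funext => r; rewrite /half_integrand /second_diff /f.
  have -> : a + b * (t + r) = X + b * r by rewrite /X; ring.
  have -> : a + b * (t - r) = X - b * r by rewrite /X; ring.
  rewrite sc -/X (pospow_pos _ (ltW X0)) /h mulrA; congr (_ / _); ring.
have P0 : X `^ s != 0 by rewrite gt_eqF// powR_gt0.
rewrite -[X in _ --> X](mulr0 (frac_const s)); apply: cvgMr.
have L : X `^ s * \int[mu]_(r in `[e, +oo[) h r @[e --> 0^'+] --> 0.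
  rewrite -[X in _ --> X](mulr0 (X `^ s)); apply: cvgMr.
  exact: (pospow_lap_cvg0 s0 s1 k0).
apply: (cvg_trans _ L); apply: near_eq_cvg; near=> e.
have e0 : 0 < e by near: e; exact: nbhs_right_gt.
have [hi ->] := frac_trunc_half fi e0.
  have hi2 : mu.-integrable `[e, +oo[ (EFin \o h).
    have := integrable_mulr (X `^ s)^-1 (measurable_itvR _) hi.
    rewrite hE (_ : (fun r => _ * _) = h)//.
    by apply/funext => r; rewrite mulrA mulVf// mul1r.
  by rewrite hE (RintegralZl _ (measurable_itvR _) hi2).
Unshelve. all: end_near. Qed.
End affine.

(** * Comparison with viscosity solutions *)
(** A name for the function built inside [visc_sol], equal to it by conversion. *)
Definition glue_near {R : realType} (t0 r : R) (phi v : R -> R) : R -> R :=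
  fun t => if `|t - t0| < r then phi t else v t.

Section visc.
Context {R : realType}.
Variable s : R.
Hypotheses (s0 : 0 < s) (s1 : s < 1).
Implicit Types (v w phi : R -> R) (t : R).

(* Solutions that are smooth enough (differentiable with a quadratic remainder, with
   increments of growth [|r|^s]) to be compared directly with viscosity solutions. *)
Definition s_harmonic v : Prop :=
  [/\ continuous v,
      exists A, forall x r, `|v (x + r) - v x| <= A * (1 + `|r| `^ s),
      forall t, 0 < t -> t < 1 -> frac_lap1 s v t 0 &
      forall t, 0 < t -> t < 1 -> exists C d B, 0 < d /\
        forall h, `|h| <= d -> `|v (t + h) - v t - B * h| <= C * h ^+ 2].

Lemma s_harmonic_cst (c : R) : s_harmonic (fun=> c).
Proof.
split.
- exact: cst_continuous.
- by exists 0 => x r; rewrite subrr normr0 mul0r.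
- by move=> *; exact: lap_cst.
- move=> t _ _; exists 0, 1, 0; split => // h _.
  by rewrite subrr !mul0r subr0 normr0.
Qed.

Lemma s_harmonic_lin v w (a b : R) : s_harmonic v -> s_harmonic w ->
  s_harmonic (fun t => a * v t + b * w t).
Proof.
move=> [cv [A gv] lv tv] [cw [A' gw] lw tw]; split.
- by move=> x; apply: cvgD; apply: cvgMr; [exact: cv|exact: cw].
- exists (`|a| * A + `|b| * A') => x r.
  have -> : a * v (x + r) + b * w (x + r) - (a * v x + b * w x) =
    a * (v (x + r) - v x) + b * (w (x + r) - w x) by ring.
  apply: le_trans (ler_normD _ _) _; rewrite !normrM mulrDl -!mulrA.
  by apply: lerD; rewrite ler_wpM2l.
- move=> t t0 t1; rewrite -[X in frac_lap1 _ _ _ X](_ : a * 0 + b * 0 = 0); last by ring.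
  by apply: lap_lin => //; [exact: lv|exact: lw].
- move=> t t0 t1.
  have [C [d [B [d0 H]]]] := tv t t0 t1; have [C' [d' [B' [d'0 H']]]] := tw t t0 t1.
  exists (`|a| * C + `|b| * C'), (Num.min d d'), (a * B + b * B'); split.
    by rewrite lt_min d0.
  move=> h; rewrite le_min => /andP[hd hd'].
  have -> : a * v (t + h) + b * w (t + h) - (a * v t + b * w t) - (a * B + b * B') * h =
    a * (v (t + h) - v t - B * h) + b * (w (t + h) - w t - B' * h) by ring.
  apply: le_trans (ler_normD _ _) _; rewrite !normrM mulrDl -!mulrA.
  by apply: lerD; rewrite ler_wpM2l ?H ?H'.
Qed.

Lemma s_harmonic_pospow (a b : R) :
  (forall t, 0 < t -> t < 1 -> 0 < a + b * t) -> s_harmonic (fun t => pospow s (a + b * t)).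
Proof.
move=> H; split.
- exact: continuous_pospow_affine.
- by exists (`|b| `^ s) => x r; exact: pospow_affine_growth.
- by move=> t t0 t1; apply: pospow_affine_lap => //; exact: H.
- by move=> t t0 t1; apply: pospow_affine_taylor => //; exact: H.
Qed.

Lemma measurable_glue t0 r phi v : measurable_fun setT phi -> measurable_fun setT v ->
  measurable_fun setT (glue_near t0 r phi v).
Proof.
move=> mp mv; apply: measurable_fun_ifT => //.
apply: measurable_fun_ltr => //.
apply: (measurableT_comp (@normr_measurable _ setT)) => //.
exact: measurable_funB.
Qed.

Lemma C2_continuous phi : C2_real phi -> continuous phi.
Proof.
move=> [d1 _] x; apply: differentiable_continuous; apply/derivable1_diffP; exact: d1.
Qed.

(** [visc_sol] demands that the value exist for every test function before it has a sign. Existence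
    needs the growth of [v] far away, boundedness of [phi] in between and its second differences at
    the centre. *)
Lemma glue_lap t0 r phi v : s_harmonic v -> 0 < r -> C2_real phi -> phi t0 = v t0 ->
  exists L, frac_lap1 s (glue_near t0 r phi v) t0 L.
Proof.
move=> [cv [A gv] lv tv] r0 Cphi pv.
have cphi := C2_continuous Cphi.
have g0 : glue_near t0 r phi v t0 = v t0 by rewrite /glue_near subrr normr0 r0.
have [M M0 HM] : exists2 M, 0 <= M & forall h, `|h| < r -> `|phi (t0 + h) - phi t0| <= M.
  have le01 : t0 - r <= t0 + r by lra.
  have cn : {within `[t0 - r, t0 + r], continuous (fun x => `|phi x - phi t0|)}.
    apply: continuous_subspaceT => x.
    apply: (@continuous_comp _ _ _ (fun x => phi x - phi t0) Num.norm); last exact: norm_continuous.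
    by apply: continuousB; [exact: cphi|exact: cst_continuous].
  have [c _ Hc] := EVT_max le01 cn.
  exists `|phi c - phi t0|; first exact: normr_ge0.
  by move=> h hr; apply: Hc; rewrite in_itv/=; move: hr; rewrite ltr_norml => /andP[]; lra.
have A0 : 0 <= A.
  have := le_trans (normr_ge0 _) (gv 0 0).
  by rewrite normr0 powR0 ?gt_eqF// addr0 mulr1.
have fi : trunc_integrable s (glue_near t0 r phi v) t0.
  apply: (@growth_trunc_integrable _ s _ t0 (A + M)) => //.
    by apply: measurable_glue; apply: continuous_measurable_fun.
  move=> h; rewrite g0 /glue_near.
  have -> : t0 + h - t0 = h by ring.
  have p0 : 0 <= `|h| `^ s by exact: powR_ge0.
  case: ifPn => hr.
    by rewrite -pv; apply: le_trans (HM h hr) _; nra.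
  by apply: le_trans (gv t0 h) _; rewrite ler_wpM2r ?addr_ge0// lerDl.
have [C HC] := C2_second_diff t0 Cphi.
pose d := Num.min 1 (r / 2).
have d0 : 0 < d by rewrite lt_min ltr01 divr_gt0.
apply: (@lap_exists _ s s1 _ t0 C d) => // h h0 hd.
have h1 : h <= 1 by apply: le_trans hd _; rewrite ge_min lexx.
have hr : h < r.
  apply: le_lt_trans hd _; rewrite gt_min; apply/orP; right.
  by rewrite ltr_pdivrMr// mulr_natr mulr2n ltrDl.
have := HC h h0 h1; rewrite /second_diff g0 -pv /glue_near.
have -> : t0 + h - t0 = h by ring.
have -> : t0 - h - t0 = - h by ring.
by rewrite normrN (gtr0_norm h0) hr.
Qed.

(** The glued function lies on one side of [v] and meets it at t0, so monotonicity of the operator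
    gives the sign. *)
Lemma s_harmonic_visc v : s_harmonic v -> visc_sol s v.
Proof.
move=> hv; have [cv gv lv tv] := hv; split; first exact: continuous_subspaceT.
split => t0 r phi r0 t01 t02 Cphi pv tp.
  have [L HL] := glue_lap hv r0 Cphi pv; exists L; split => //.
  apply: (lap_le s0 s1 _ _ (lv t0 _ _) HL); try lra.
    by rewrite /glue_near subrr normr0 r0.
  by move=> x; rewrite /glue_near; case: ifPn => // ?; exact: tp.
have [L HL] := glue_lap hv r0 Cphi pv; exists L; split => //.
apply: (lap_le s0 s1 _ _ HL (lv t0 _ _)); try lra.
  by rewrite /glue_near subrr normr0 r0.
by move=> x; rewrite /glue_near; case: ifPn => // ?; exact: tp.
Qed.

(** At a negative minimum m of w - v, the Taylor parabola of the smooth function v, lifted to w,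
    touches w from below. The operator applied to v minus the glued function is then nonnegative,
    yet beyond distance 1 the data agree and contribute a fixed negative amount. *)
Lemma s_harmonic_le v w : s_harmonic v -> visc_sol s w ->
  (forall t, ~ (0 < t /\ t < 1) -> w t = v t) ->
  forall t, 0 < t -> t < 1 -> v t <= w t.
Proof.
move=> hv [cw [_ below]] wv t t_0 t_1; have [cv gv lv tv] := hv.
rewrite leNgt; apply/negP => wvt.
have cwv : {within `[0, 1], continuous (fun x => w x - v x)}.
  by move=> x; apply: continuousB; [exact: cw|exact: continuous_subspaceT].
have [c c01 Hc] := EVT_min ler01 cwv.
set m := w c - v c in Hc.
have m0 : m < 0.
  by apply: le_lt_trans (Hc t _) _; rewrite ?in_itv/= ?ltW ?subr_lt0.
have c0 : 0 < c.
  rewrite lt_neqAle; move: c01; rewrite in_itv/= => /andP[-> _]; rewrite andbT.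
  apply/eqP => c0; move: m0; rewrite /m -c0 wv ?subrr ?ltxx//.
  by case.
have c1 : c < 1.
  rewrite lt_neqAle; move: c01; rewrite in_itv/= => /andP[_ ->]; rewrite andbT.
  apply/eqP => c1; move: m0; rewrite /m c1 wv ?subrr ?ltxx//.
  by case.
have [C [d [B [d0 HC]]]] := tv c c0 c1.
have Hm x : m <= w x - v x.
  have [x01|x01] := pselect (0 < x /\ x < 1).
    by apply: Hc; rewrite in_itv/= !ltW//; case: x01.
  by rewrite (wv x x01) subrr ltW.
(* Near c the second difference is at most 4C h^2: 2C from the remainder of v and 2C from the
   parabola. The radius r makes the resulting integral smaller than the tail -m/s. *)
have [r [r0 rd rc r1 rsmall]] : exists r, [/\ 0 < r, r <= d, r < c, r < 1 - c &
    4 * C / (2 - 2 * s) * r `^ (2 - 2 * s) < - m / s].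
  have ms : 0 < - m / s by rewrite divr_gt0// oppr_gt0.
  have p0 : 0 < 2 - 2 * s by have := s1; lra.
  have H := @cvg_powR0_right R (4 * C / (2 - 2 * s)) _ p0.
  suff : \forall r \near 0^'+, [/\ 0 < r, r <= d, r < c, r < 1 - c &
    4 * C / (2 - 2 * s) * r `^ (2 - 2 * s) < - m / s] by move/filter_ex.
  near=> r; split.
  - by near: r; exact: nbhs_right_gt.
  - by near: r; exact: nbhs_right_le.
  - by near: r; exact: nbhs_right_lt.
  - by near: r; apply: nbhs_right_lt; rewrite subr_gt0.
  - near: r; exact: (cvgr_lt _ H).
(* Curvature -2C puts the parabola below v + m by the quadratic remainder, and v + m is below w. *)
pose phi x := w c + B * (x - c) + (- C) * (x - c) ^+ 2.
have pc : phi c = w c by rewrite /phi subrr mulr0 expr0n/= mulr0 !addr0.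
have touch x : `|x - c| < r -> phi x <= w x.
  move=> xr; have := HC (x - c) (ltW (lt_le_trans xr rd)).
  rewrite [c + _]addrC subrK ler_norml => /andP[H1 _].
  have := Hm x; rewrite /phi /m; lra.
have cr0 : 0 < c - r by lra.
have cr1 : c + r < 1 by lra.
have [L [HL L0]] := below c r phi r0 cr0 cr1 (C2_quadratic c (w c) B (- C)) pc touch.
have C0 : 0 <= C.
  have := le_trans (normr_ge0 _) (HC d _); rewrite gtr0_norm// => /(_ (lexx d)).
  by rewrite pmulr_lge0// exprn_gt0.
pose F x := 1 * v x + (-1) * glue_near c r phi w x.
have lapF : frac_lap1 s F c (1 * 0 + (-1) * L) by apply: lap_lin => //; exact: lv.
have Fc : F c = - m by rewrite /F /glue_near subrr normr0 r0 pc /m; ring.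
have Fout x : r <= `|x - c| -> F x <= - m.
  by move=> xr; rewrite /F /glue_near ltNge xr/=; have := Hm x; lra.
have shp h : c + h - c = h by ring.
have shm h : c - h - c = - h by ring.
have := lap_bound s0 s1 (a := 4 * C) (b := 2 * m) (rho := r) (eta := 1) lapF r0.
have r_1 : r <= 1 by lra.
move=> /(_ r_1) H.
have : 1 * 0 + (-1) * L <= frac_const s * (4 * C * r `^ (2 - 2 * s) / (2 - 2 * s) +
    2 * m * 1 `^ (- (2 * s)) / (2 * s)).
  apply: H.
  - move=> h h0 hr; rewrite /second_diff Fc.
    have h20 : 0 <= C * h ^+ 2 by rewrite mulr_ge0// sqr_ge0.
    have [hr'|hr'] := ltP h r; last first.
      have := Fout (c + h); have := Fout (c - h).
      rewrite (shp h) (shm h) normrN (gtr0_norm h0) => /(_ hr') H1 /(_ hr') H2.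
      lra.
    rewrite /F /glue_near (shp h) (shm h) normrN (gtr0_norm h0) hr' /phi (shp h) (shm h).
    have hd : `|h| <= d by rewrite (gtr0_norm h0); lra.
    have := HC h hd; have := HC (- h); rewrite normrN => /(_ hd).
    rewrite !ler_norml sqrrN => /andP[_ H1] /andP[_ H2]; rewrite /m; lra.
  - move=> h rh h1; rewrite /second_diff Fc.
    have h0 : 0 < h by lra.
    have := Fout (c + h); have := Fout (c - h).
    rewrite (shp h) (shm h) normrN (gtr0_norm h0) => /(_ (ltW rh)) H1 /(_ (ltW rh)) H2.
    lra.
  (* Beyond distance 1 both points have left (0,1), where F vanishes, so the second difference is
     exactly 2m. *)
  - move=> h h1; rewrite /second_diff Fc.
    have h0 : 0 < h by lra.
    have hr : r <= h by lra.
    rewrite /F /glue_near (shp h) (shm h) normrN (gtr0_norm h0) ltNge hr/=.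
    rewrite !wv; [|lra..]; lra.
rewrite powR1 mulr1.
have E : 2 * m / (2 * s) = m / s by field; rewrite gt_eqF.
rewrite E.
have lt0 : 4 * C * r `^ (2 - 2 * s) / (2 - 2 * s) + m / s < 0.
  have : 4 * C / (2 - 2 * s) * r `^ (2 - 2 * s) = 4 * C * r `^ (2 - 2 * s) / (2 - 2 * s).
    by rewrite mulrAC.
  move: rsmall; rewrite mulNr; lra.
have := frac_const_gt0 s0 s1; move: lt0; set X := _ + _; nra.
Unshelve. all: end_near. Qed.

(** A constant touches v from above at an interior maximum. Beyond distance 1 both arguments lie in
    the exterior, where v is at most M, so a maximum above M makes the operator strictly
    negative. *)
Lemma visc_le_max v (M : R) : visc_sol s v ->
  (forall t, ~ (0 < t /\ t < 1) -> v t <= M) -> forall t, v t <= M.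
Proof.
move=> [cv [above _]] vM t.
have [[t_0 t_1]|t01] := pselect (0 < t /\ t < 1); last exact: vM.
rewrite leNgt; apply/negP => vt.
have [c c01 Hc] := EVT_max ler01 cv.
have vc : M < v c by apply: lt_le_trans vt (Hc t _); rewrite in_itv/= !ltW.
have [c0 c1] : 0 < c /\ c < 1 by apply: contrapT => /vM; rewrite leNgt vc.
have Hm x : v x <= v c.
  have [x01|x01] := pselect (0 < x /\ x < 1); last exact: le_trans (vM x x01) (ltW vc).
  by apply: Hc; rewrite in_itv/= !ltW//; case: x01.
pose r := Num.min c (1 - c) / 2.
have mn0 : 0 < Num.min c (1 - c) by rewrite lt_min c0 subr_gt0.
have r0 : 0 < r by rewrite divr_gt0.
have mnc : Num.min c (1 - c) <= c by rewrite ge_min lexx.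
have mnc1 : Num.min c (1 - c) <= 1 - c by rewrite ge_min lexx orbT.
pose phi x := v c + 0 * (x - c) + 0 * (x - c) ^+ 2.
have phiE x : phi x = v c by rewrite /phi !mul0r !addr0.
have cr0 : 0 < c - r by rewrite /r; lra.
have cr1 : c + r < 1 by rewrite /r; lra.
have [L [HL L0]] := above c r phi r0 cr0 cr1 (C2_quadratic c (v c) 0 0) (phiE c)
   (fun x _ => le_trans (Hm x) (eq_ind_r (fun y => v c <= y) (lexx _) (phiE x))).
have {}HL : frac_lap1 s (glue_near c r phi v) c L := HL.
have gc : glue_near c r phi v c = v c by rewrite /glue_near subrr normr0 r0 phiE.
have gx x : glue_near c r phi v x <= v c by rewrite /glue_near; case: ifP => // _; rewrite ?phiE.
have H := lap_bound s0 s1 (a := 0) (b := 2 * (M - v c)) (rho := 1) (eta := 1) HL ltr01 (lexx 1).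
have : L <= frac_const s * (0 * 1 `^ (2 - 2 * s) / (2 - 2 * s) +
    2 * (M - v c) * 1 `^ (- (2 * s)) / (2 * s)).
  apply: H.
  - move=> h _ _; rewrite mul0r /second_diff gc.
    have := gx (c + h); have := gx (c - h); lra.
  - by move=> h h1 /(lt_le_trans h1); rewrite ltxx.
  - move=> h h1; rewrite /second_diff gc.
    have h0 : 0 < h by lra.
    have hr : r <= h by rewrite /r; lra.
    have shp := addrAC c h (- c); rewrite subrr add0r in shp.
    have shm := addrAC c (- h) (- c); rewrite subrr add0r in shm.
    rewrite /glue_near shp shm normrN (gtr0_norm h0) ltNge hr/=.
    have : v (c + h) <= M by apply: vM; lra.
    have : v (c - h) <= M by apply: vM; lra.
    lra.
rewrite powR1 !mulr1 !mul0r add0r.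
have E : 2 * (M - v c) / (2 * s) = (M - v c) / s by field; rewrite gt_eqF.
rewrite E.
have lt0 : (M - v c) / s < 0 by rewrite pmulr_llt0 ?invr_gt0// subr_lt0.
have := frac_const_gt0 s0 s1; move: lt0; set X := _ / _; nra.
Qed.

End visc.

(** * The chord barrier for s close to 1 *)

Lemma barrier_quot {R : realFieldType} (s k b P z : R) : 0 < s -> s < 1 ->
  - (2 * k) * (z * P) / (2 - 2 * s) + b * P / (2 * s) =
  P * (b / (2 * s) - k * z / (1 - s)).
Proof. by move=> s0 s1; field; apply/andP; split; rewrite gt_eqF//; lra. Qed.

(** For s > 1/2 the tail is at most b, and the lower bound on s says exactly that k z / (1 - s)
    exceeds b. *)
Lemma barrier_quot_lt0 {R : realFieldType} (s k b z : R) : 2^-1 < s -> s < 1 -> 0 < b ->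
  1 - k * z / b < s -> b / (2 * s) - k * z / (1 - s) < 0.
Proof.
move=> s2 s1 b0 sk; have s0 : 0 < s by lra.
have s1' : 0 < 1 - s by lra.
rewrite subr_lt0; apply: (@le_lt_trans _ _ b).
  by rewrite ler_pdivrMr ?mulr_gt0//; nra.
by rewrite ltr_pdivlMr// mulrC -ltr_pdivlMr//; lra.
Qed.

(* If [v - Q] had a positive maximum for the parabola [Q] of second derivative
   [- 2 * k], the negative contribution [- 2 * k * y `^ (2 - 2 * s) / (2 - 2 * s)]
   near the contact point would outweigh the bounded tail as [s] tends to [1]. *)
Lemma visc_barrier {R : realType} (M e eta : R) : 0 <= M -> 0 < e -> 0 < eta ->
  exists sb : R, [/\ 2^-1 <= sb, sb < 1 & forall (s : R) v A B, sb < s -> s < 1 ->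
    visc_sol s v -> `|A| <= M -> `|B| <= M ->
    (forall t, ~ (0 < t /\ t < 1) -> v t <= M) ->
    (forall t, - eta < t -> t <= 0 -> v t <= A) ->
    (forall t, 1 <= t -> t < 1 + eta -> v t <= B) ->
    forall t, 0 <= t -> t <= 1 -> v t <= (1 - t) * A + t * B + e].
Proof.
move=> M0 e0 eta0.
pose k := Num.min e 1.
have k0 : 0 < k by rewrite lt_min e0 ltr01.
have ke : k <= e by rewrite ge_min lexx.
have k1 : k <= 1 by rewrite ge_min lexx orbT.
(* At distance y beyond an end, the slope of the chord and the bump together cost at most (2M + 2k)
   y <= k/4, less than the lift k/2 of [Q]. *)
pose y := Num.min eta (k / (8 * (M + 1))).
have y0 : 0 < y by rewrite lt_min eta0 divr_gt0// mulr_gt0//; lra.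
have ye : y <= eta by rewrite ge_min lexx.
have yk : y * (8 * (M + 1)) <= k.
  rewrite -ler_pdivlMr; last by rewrite mulr_gt0//; lra.
  by rewrite ge_min lexx orbT.
have yM : 0 <= y * M by rewrite mulr_ge0// ltW.
have y1 : y <= 1 by lra.
(* Twice the bound 5M + 1 obtained below for the rise of the glued function above its contact
   value. *)
pose b := 10 * M + 2.
have b0 : 0 < b by rewrite /b; lra.
have y2 : 0 < k * y ^+ 2 by rewrite mulr_gt0// exprn_gt0.
have bM : 10 * M + 2 <= b by [].
clearbody b y k.
exists (Num.max 2^-1 (1 - k * y ^+ 2 / b)); split.
- by rewrite le_max lexx.
- rewrite gt_max gtrBl divr_gt0// andbT; lra.
move=> s v A B; rewrite gt_max => /andP[s2 sk] s1 hv Am Bm vM vA vB.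
have s0 : 0 < s by lra.
have [cv [above _]] := hv.
move: Am Bm; rewrite !ler_norml => /andP[A1 A2] /andP[B1 B2].
(* The chord, lifted by k/2 to dominate the data just outside [0,1], plus a concave bump of height
   at most k/4; the total excess stays below k <= e. *)
pose Q t := A + (B - A) * t + k / 2 + k * (t * (1 - t)).
have QA t : - y < t -> t <= 0 -> A <= Q t.
  move=> t1 t2; rewrite /Q.
  have : (B - A) * t >= - (2 * M) * y by nra.
  have : t * (1 - t) >= - (2 * y) by nra.
  nra.
have QB t : 1 <= t -> t < 1 + y -> B <= Q t.
  move=> t1 t2; rewrite /Q.
  have : (A - B) * (1 - t) >= - (2 * M) * y by nra.
  have : t * (1 - t) >= - (2 * y) by nra.
  nra.
suff vQ t : 0 <= t -> t <= 1 -> v t <= Q t.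
  move=> t t0 t1; apply: le_trans (vQ t t0 t1) _; rewrite /Q.
  have : t * (1 - t) <= 1 / 4 by have := sqr_ge0 (t - 1 / 2); nra.
  nra.
move=> t_0 t_1; rewrite leNgt; apply/negP => vt.
have cQ : {within `[0, 1], continuous (fun x => v x - Q x)}.
  move=> x; apply: continuousB; first exact: cv.
  apply: continuous_subspaceT => {}x.
  have -> : Q = (fun t => (A + k / 2) + ((B - A) + k) * (t - 0) + (- k) * (t - 0) ^+ 2).
    by apply/funext => u; rewrite /Q; ring.
  exact: (C2_continuous (C2_quadratic _ _ _ _)).
have [c c01 Hc] := EVT_max ler01 cQ.
set m := v c - Q c in Hc.
have m0 : 0 < m.
  by apply: lt_le_trans (Hc t _); rewrite ?subr_gt0// in_itv/= t_0.
move: c01; rewrite in_itv/= => /andP[c_0 c_1].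
have c0 : 0 < c.
  rewrite lt_neqAle c_0 andbT; apply/eqP => c0; move: m0; rewrite /m -c0.
  have : v 0 <= A by apply: vA => //; lra.
  have : A <= Q 0 by apply: QA => //; lra.
  lra.
have c1 : c < 1.
  rewrite lt_neqAle c_1 andbT; apply/eqP => c1; move: m0; rewrite /m c1.
  have : v 1 <= B by apply: vB => //; lra.
  have : B <= Q 1 by apply: QB => //; lra.
  lra.
have Hm x : - y < x -> x < 1 + y -> v x <= Q x + m.
  move=> x1 x2; have [x0|x0] := leP x 0.
    have : v x <= A by apply: vA => //; lra.
    have := QA x x1 x0; lra.
  have [x3|x3] := leP 1 x.
    have : v x <= B by apply: vB => //; lra.
    have := QB x x3 x2; lra.
  have : v x - Q x <= m by apply: Hc; rewrite in_itv/= !ltW.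
  lra.
pose r := Num.min c (1 - c) / 2.
have mn0 : 0 < Num.min c (1 - c) by rewrite lt_min c0 subr_gt0.
have r0 : 0 < r by rewrite divr_gt0.
have mnc : Num.min c (1 - c) <= c by rewrite ge_min lexx.
have mnc1 : Num.min c (1 - c) <= 1 - c by rewrite ge_min lexx orbT.
pose phi x := v c + (B - A + k * (1 - 2 * c)) * (x - c) + (- k) * (x - c) ^+ 2.
have phiE x : phi x = Q x + m by rewrite /phi /Q /m /Q; ring.
have rc : r + r <= c by rewrite /r; lra.
have rc1 : r + r <= 1 - c by rewrite /r; lra.
clearbody r.
have cr0 : 0 < c - r by lra.
have cr1 : c + r < 1 by lra.
have pc : phi c = v c by rewrite phiE /m; ring.
have touch x : `|x - c| < r -> v x <= phi x.
  by rewrite ltr_norml => /andP[x1 x2]; rewrite phiE; apply: Hm; clear - x1 x2 rc rc1 y0 r0; lra.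
have [L [HL L0]] := above c r phi r0 cr0 cr1 (C2_quadratic c (v c) _ (- k)) pc touch.
have {}HL : frac_lap1 s (glue_near c r phi v) c L := HL.
have gc : glue_near c r phi v c = v c by rewrite /glue_near subrr normr0 r0.
have gQ x : - y < x -> x < 1 + y -> glue_near c r phi v x <= Q x + m.
  by move=> x1 x2; rewrite /glue_near; case: ifP => _; rewrite ?phiE//; exact: Hm.
have vcE : v c = Q c + m by rewrite /m; ring.
have Qc : - M <= Q c.
  rewrite /Q; have cc : 0 <= c * (1 - c) by rewrite mulr_ge0// subr_ge0.
  have AB : - M <= A + (B - A) * c by clear - A1 B1 c0 c1; nra.
  clear - cc AB k0; nra.
(* In the window the function is below Q + m with Q <= 4M + 1, elsewhere below M, while the contact
   value is at least m - M. *)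
have g5 x : glue_near c r phi v x <= v c + (5 * M + 1).
  have [xw|xw] := boolP ((- y < x) && (x < 1 + y)).
    move/andP : xw => [x1 x2]; apply: le_trans (gQ x x1 x2) _.
    have : Q x <= 4 * M + 1.
      have : x * (1 - x) <= 1 / 4 by have := sqr_ge0 (x - 1 / 2); nra.
      have : A + (B - A) * x <= 4 * M by clear - A1 A2 B1 B2 x1 x2 yM y0 y1 yk k1 M0; nra.
      rewrite /Q; clear - k0 k1; nra.
    lra.
  have xr : r <= `|x - c|.
    rewrite ler_normr; move: xw; rewrite negb_and -!leNgt => /orP[xw|xw].
      by apply/orP; right; clear - xw rc y0 r0; lra.
    by apply/orP; left; clear - xw rc1 y0 r0; lra.
  rewrite /glue_near ltNge xr/=.
  have : v x <= M by apply: vM => -[xp xp1]; move: xw; rewrite (lt_trans _ xp) ?oppr_lt0// (lt_trans xp1)// ltrDl.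
  lra.
have H := lap_bound s0 s1 (a := - (2 * k)) (b := b) (rho := y) (eta := y) HL y0 (lexx y).
have : L <= frac_const s * (- (2 * k) * y `^ (2 - 2 * s) / (2 - 2 * s) +
    b * y `^ (- (2 * s)) / (2 * s)).
  apply: H.
  - move=> h h0 hy; rewrite /second_diff gc.
    have H1 : glue_near c r phi v (c + h) <= Q (c + h) + m by apply: gQ; clear - c0 c1 h0 hy y0; lra.
    have H2 : glue_near c r phi v (c - h) <= Q (c - h) + m by apply: gQ; clear - c0 c1 h0 hy y0; lra.
    rewrite vcE; move: H1 H2; rewrite /Q; clear; lra.
  - by move=> h h1 /(lt_le_trans h1); rewrite ltxx.
  - move=> h h1; rewrite /second_diff gc.
    have := g5 (c + h); have := g5 (c - h); clear - bM; lra.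
have E : y `^ (2 - 2 * s) = y ^+ 2 * y `^ (- (2 * s)).
  by rewrite -(powR_mulrn 2 (ltW y0)) -powRD ?(gt_eqF y0) ?implybT.
rewrite E.
have P0 : 0 < y `^ (- (2 * s)) by exact: powR_gt0.
move: P0; set P := y `^ _ => P0.
rewrite (barrier_quot _ _ _ _ s0 s1) => Lle.
have lt0 := barrier_quot_lt0 s2 s1 b0 sk.
have /(le_lt_trans Lle) : frac_const s * (P * (b / (2 * s) - k * y ^+ 2 / (1 - s))) < 0.
  by rewrite (pmulr_rlt0 _ (frac_const_gt0 s0 s1)) (pmulr_rlt0 _ P0).
by rewrite ltNge L0.
Qed.

(** * Separation by linear forms *)
Section HahnBanach.
Context {R : realType} {V : lmodType R}.
Implicit Types (p q : V -> R) (x y z e : V).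

Definition sublinear p :=
  (forall x y, p (x + y) <= p x + p y) /\
  (forall (a : R) x, 0 < a -> p (a *: x) <= a * p x).

Lemma sublinear0 p : sublinear p -> p 0 = 0.
Proof.
move=> [_ hp]; apply/eqP; rewrite eq_le; apply/andP; split.
  have h0 : 0 < 2^-1 :> R by rewrite invr_gt0.
  by have := hp 2^-1 0 h0; rewrite scaler0; lra.
have h0 : 0 < 2 :> R by [].
by have := hp 2 0 h0; rewrite scaler0; lra.
Qed.

Lemma sublinearZ p (a : R) x : sublinear p -> 0 <= a -> p (a *: x) = a * p x.
Proof.
move=> hp; rewrite le_eqVlt => /predU1P[<-|a0].
  by rewrite scale0r mul0r sublinear0.
have [_ H] := hp; apply/eqP; rewrite eq_le H//=.
have := H a^-1 (a *: x); rewrite invr_gt0 scalerA mulVf ?gt_eqF// scale1r => /(_ a0).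
by rewrite ler_pdivlMl.
Qed.

Lemma sublinearN p x : sublinear p -> 0 <= p x + p (- x).
Proof. by move=> hp; rewrite -(sublinear0 hp) -(subrr x); apply: hp.1. Qed.

(** [q] is the infimum over t >= 0 of p(x + t e) - t p(e), that is, p straightened along e; t = 1 at
    the vector -e gives the last clause. *)
Lemma sublinear_line p e : sublinear p ->
  exists q, [/\ sublinear q, forall x, q x <= p x & q (- e) <= - p e].
Proof.
move=> hp; have [hp1 hp2] := hp.
pose S x : set R := [set p (x + t *: e) - t * p e | t in [set t : R | 0 <= t]].
have S0 x : S x !=set0.
  by exists (p (x + 0 *: e) - 0 * p e); exists 0; [exact: lexx|].
have Sl x : has_lbound (S x).
  exists (- p (- x)) => _ [t /= t0 <-].
  have := hp1 (x + t *: e) (- x); rewrite addrAC subrr add0r sublinearZ//; lra.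
pose q x := inf (S x).
have qle x (t : R) : 0 <= t -> q x <= p (x + t *: e) - t * p e.
  by move=> t0; apply: ge_inf => //; exists t.
exists q; split; last 2 first.
- by move=> x; have := qle x 0 (lexx 0); rewrite scale0r addr0 mul0r subr0.
- by have := qle (- e) 1 ler01; rewrite scale1r addNr mul1r sublinear0// sub0r.
split.
- move=> x y.
  have key (t : R) : 0 <= t -> q (x + y) - (p (x + t *: e) - t * p e) <= q y.
    move=> t0; apply: lb_le_inf => // _ [u /= u0 <-].
    have := qle (x + y) (t + u) (addr_ge0 t0 u0).
    have -> : x + y + (t + u) *: e = (x + t *: e) + (y + u *: e) by rewrite scalerDl addrACA.
    have := hp1 (x + t *: e) (y + u *: e); lra.
  rewrite -lerBlDr; apply: lb_le_inf => // _ [t /= t0 <-].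
  have := key t t0; lra.
- move=> a x a0; rewrite -ler_pdivrMl//; apply: lb_le_inf => // _ [t /= t0 <-].
  rewrite ler_pdivrMl//; apply: le_trans (qle _ (a * t) _) _.
    by rewrite mulr_ge0// ltW.
  have -> : a *: x + (a * t) *: e = a *: (x + t *: e) by rewrite scalerDr scalerA.
  by rewrite sublinearZ ?(ltW a0)// mulrBr mulrA.
Qed.

(** Straightening along a new vector keeps the old ones straight: lowering q decreases q(-e) and
    increases -q(e). *)
Lemma sublinear_lines p (es : seq V) : sublinear p ->
  exists q, [/\ sublinear q, forall x, q x <= p x &
     forall e, e \in es -> q (- e) <= - q e].
Proof.
move=> hp; elim: es => [|e es [q [hq qp qes]]].
  by exists p; split => //.
have [q' [hq' q'q q'e]] := sublinear_line e hq.
exists q'; split => //.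
- by move=> x; exact: le_trans (qp x).
- move=> e'; rewrite inE => /predU1P[->|e'es].
    by apply: le_trans q'e _; rewrite lerN2.
  apply: le_trans (q'q _) _; apply: le_trans (qes _ e'es) _.
  by rewrite lerN2.
Qed.

(** Stated as an induction principle, so that one notion serves row vectors and their product with
    the reals. *)
Definition spanning (es : seq V) := forall P : V -> Prop,
  P 0 -> (forall e, e \in es -> P e) -> (forall x y, P x -> P y -> P (x + y)) ->
  (forall (a : R) x, P x -> P (a *: x)) -> forall x, P x.

(** Straightening along z comes first and pins the value there: later steps only lower the
    functional, also at -z, so once linear it is at least p(z) at z. *)
Lemma Hahn_Banach_fin p z (es : seq V) : spanning es -> sublinear p ->
  exists q, [/\ forall x y, q (x + y) = q x + q y,
     forall (a : R) x, q (a *: x) = a * q x,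
     forall x, q x <= p x & q z = p z].
Proof.
move=> span hp.
have [p1 [hp1 p1p p1z]] := sublinear_line z hp.
have [q [hq qp1 qes]] := sublinear_lines es hp1.
have qN x : q (- x) <= - q x -> q (- x) = - q x.
  by move=> h; have := sublinearN x hq; lra.
pose lin x := q (- x) = - q x.
have linD x y : lin x -> lin y -> q (x + y) = q x + q y /\ lin (x + y).
  rewrite /lin => lx ly.
  have h1 := hq.1 x y; have := hq.1 (- x) (- y); rewrite -opprD lx ly => h2.
  have := sublinearN (x + y) hq => h3; split; lra.
have linZ (a : R) x : lin x -> q (a *: x) = a * q x.
  move=> lx; have [a0|a0] := leP 0 a; first by rewrite sublinearZ.
  have -> : a *: x = (- a) *: (- x) by rewrite scalerN scaleNr opprK.
  by rewrite sublinearZ ?oppr_ge0 ?(ltW a0)// lx mulrNN.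
have linall x : lin x.
  apply: (span lin).
  - by rewrite /lin oppr0 (sublinear0 hq) oppr0.
  - by move=> e ees; apply: qN; exact: qes.
  - by move=> u v lu lv; exact: (linD u v lu lv).2.
  - by move=> a u lu; rewrite /lin -scaleNr !linZ// mulNr.
exists q; split.
- by move=> x y; exact: (linD x y (linall x) (linall y)).1.
- by move=> a x; exact: linZ.
- by move=> x; exact: le_trans (p1p x).
- apply/eqP; rewrite eq_le (le_trans (qp1 z) (p1p z))/=.
  have := linall z; have := qp1 (- z); rewrite /lin; lra.
Qed.

(** Hahn-Banach for the Minkowski gauge of A about o, with value 1 as the separating level. Interior
    is meant algebraically, one direction at a time, so that the lemma also serves epigraphs. *)
Lemma separation (A : set V) (o z : V) (es : seq V) : spanning es ->
  (forall x y (t : R), A x -> A y -> 0 <= t -> t <= 1 -> A (t *: x + (1 - t) *: y)) ->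
  (forall d, exists2 t : R, 0 < t & A (o + t *: d)) -> ~ A z ->
  exists q : V -> R, [/\ forall x y, q (x + y) = q x + q y,
     forall (a : R) x, q (a *: x) = a * q x,
     1 <= q (z - o) & forall a, A a -> q (a - o) <= 1].
Proof.
move=> span Acvx Aint zA.
have Ao : A o by have [t _] := Aint 0; rewrite scaler0 addr0.
pose S d : set R := [set l : R | 0 < l /\ A (o + l^-1 *: d)].
have S0 d : S d !=set0.
  have [t t0 At] := Aint d; exists t^-1; split; first by rewrite invr_gt0.
  by rewrite invrK.
have Sl d : has_lbound (S d) by exists 0 => l [/ltW].
pose p d := inf (S d).
have hp : sublinear p.
  split.
  - move=> x y.
    have key (l m : R) : S x l -> S y m -> p (x + y) <= l + m.
      move=> [l0 Al] [m0 Am]; apply: ge_inf => //; split; first exact: addr_gt0.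
      have lm : l + m != 0 by rewrite gt_eqF// addr_gt0.
      have := Acvx _ _ (l / (l + m)) Al Am.
      rewrite ler_pdivlMr ?addr_gt0// mul0r ler_pdivrMr ?addr_gt0// mul1r.
      rewrite (ltW l0) lerDl (ltW m0) => /(_ isT isT).
      congr A; have -> : 1 - l / (l + m) = m / (l + m) by field.
      rewrite !scalerDr addrACA -scalerDl -mulrDl divff// scale1r.
      rewrite !scalerA; congr (_ + (_ + _)); congr (_ *: _); field;
        by rewrite ?lm ?(gt_eqF l0) ?(gt_eqF m0).
    rewrite -lerBlDr; apply: lb_le_inf => // l Sxl.
    rewrite lerBlDr -lerBlDl; apply: lb_le_inf => // m Sym.
    by rewrite lerBlDl; exact: key.
  - move=> a x a0; rewrite -ler_pdivrMl//; apply: lb_le_inf => // l [l0 Al].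
    rewrite ler_pdivrMl//; apply: ge_inf => //; split; first exact: mulr_gt0.
    by rewrite scalerA invfM mulrAC mulVf ?gt_eqF// mul1r.
have pz : 1 <= p (z - o).
  apply: lb_le_inf => // l [l0 Al]; rewrite leNgt; apply/negP => l1; apply: zA.
  have := Acvx _ _ l Al Ao (ltW l0) (ltW l1); congr A.
  rewrite scalerDr scalerA divff ?gt_eqF// scale1r.
  by rewrite scalerBl scale1r [_ + (z - o)]addrC addrACA subrr addr0 subrK.
have [q [qD qZ qp qz]] := Hahn_Banach_fin (z - o) span hp.
exists q; split => //; first by rewrite qz.
move=> a Aa; apply: le_trans (qp _) _; apply: ge_inf => //; split => //.
by rewrite invr1 scale1r addrC subrK.
Qed.
End HahnBanach.

(** Compactness as an induction principle: a property stable under subsets and finite unions holds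
    on K once it holds near each point. It covers both penalties and uniform estimates. *)
Lemma compact_ind {T : ptopologicalType} (K : set T) (Q : set T -> Prop) :
  compact K -> Q set0 -> (forall A B, Q A -> Q B -> Q (A `|` B)) ->
  (forall A B, A `<=` B -> Q B -> Q A) ->
  (forall x, K x -> exists U, [/\ open U, U x & Q (U `&` K)]) -> Q K.
Proof.
move=> cK Q0 QU QS loc.
have /choice[f Hf] : forall x, exists U, K x -> [/\ open U, U x & Q (U `&` K)].
  move=> x; have [Kx|nKx] := pselect (K x).
    by have [U HU] := loc x Kx; exists U.
  by exists set0.
move: cK; rewrite compact_cover => /(_ T K f) [].
- by move=> i /Hf[].
- by move=> x Kx; exists x => //; have [] := Hf x Kx.
move=> D' D'K KD'.
have QD (s : seq T) : {subset s <= K} -> Q (\bigcup_(i in [set` s]) (f i `&` K)).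
  elim: s => [|x s IH] sK.
    by apply: QS Q0 => y [i].
  have xK : K x by apply/set_mem; apply: sK; rewrite inE eqxx.
  have [_ _ Qx] := Hf x xK.
  have Qs : Q (\bigcup_(i in [set` s]) (f i `&` K)).
    by apply: IH => i si; apply: sK; rewrite inE si orbT.
  apply: QS (QU _ _ Qx Qs) => y [i /= ].
  rewrite inE => /predU1P[->|si] fy; first by left.
  by right; exists i.
apply: QS (QD (finmap.enum_fset D') _) => [x Kx|i iD]; last exact: D'K.
by have [i /= iD fi] := KD' x Kx; exists i.
Qed.

(** * Linear forms on row vectors *)

Section rV.
Context {R : realType} {N : nat}.
Local Notation V := 'rV[R]_N.
Implicit Types (x y z : V).

Definition linear_form (q : V -> R) :=
  (forall x y, q (x + y) = q x + q y) /\ (forall (a : R) x, q (a *: x) = a * q x).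

Lemma linear_form0 q : linear_form q -> q 0 = 0.
Proof. by move=> [_ h]; rewrite -(scale0r 0) h mul0r. Qed.

Lemma linear_formN q x : linear_form q -> q (- x) = - q x.
Proof. by move=> [_ h]; rewrite -scaleN1r h mulN1r. Qed.

Lemma linear_formB q x y : linear_form q -> q (x - y) = q x - q y.
Proof. by move=> h; rewrite h.1 linear_formN. Qed.

Lemma linear_form_seg q x y (t : R) : linear_form q ->
  q (t *: x + (1 - t) *: y) = q y + (q x - q y) * t.
Proof. by move=> [h1 h2]; rewrite h1 !h2; ring. Qed.

Lemma ler_coord_norm x (j : 'I_N) : `|x 0 j| <= `|x|.
Proof.
by rewrite [leRHS]/Num.norm/= mx_normrE; apply/bigmax_geP; right => /=; exists (0, j).
Qed.

Lemma linear_form_bound q : linear_form q ->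
  exists2 C : R, 0 <= C & forall x, `|q x| <= C * `|x|.
Proof.
move=> hq; have [h1 h2] := hq.
exists (\sum_(j < N) `|q (delta_mx 0 j)|); first by apply: sumr_ge0.
move=> x; rewrite {1}(row_sum_delta x).
have -> : q (\sum_(j < N) x 0 j *: delta_mx 0 j) = \sum_(j < N) x 0 j * q (delta_mx 0 j).
  rewrite (big_morph q h1 (linear_form0 hq)).
  by apply: eq_bigr => j _; rewrite h2.
apply: le_trans (ler_norm_sum _ _ _) _; rewrite mulr_suml.
apply: ler_sum => j _; rewrite normrM mulrC ler_wpM2l//.
exact: ler_coord_norm.
Qed.

Lemma nbhs_rVP x (A : set V) :
  nbhs x A <-> exists2 r : R, 0 < r & forall y, `|y - x| < r -> A y.
Proof.
split=> [/nbhs_ballP[r /= r0 H]|[r r0 H]].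
  by exists r => // y yx; apply: H; rewrite mx_norm_ball /ball_/= distrC.
apply/nbhs_ballP; exists r => //= y; rewrite mx_norm_ball /ball_/= distrC.
exact: H.
Qed.

Lemma linear_form_continuous q : linear_form q -> continuous q.
Proof.
move=> hq x; have [C C0 HC] := linear_form_bound hq.
have C1 : 0 < C + 1 by lra.
move=> A /nbhs_normP[e /= e0 HA]; apply: (nbhs_rVP x (q @^-1` A)).2.
exists (e / (C + 1)); first by rewrite divr_gt0.
move=> y /=; rewrite ltr_pdivlMr// mulrC => xy; apply: HA => /=; rewrite distrC.
rewrite -linear_formB//; apply: le_lt_trans (HC _) _; apply: le_lt_trans xy.
by rewrite ler_wpM2r//; lra.
Qed.

Lemma open_normP (A : set V) x : open A -> A x ->
  exists2 r : R, 0 < r & forall y, `|y - x| < r -> A y.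
Proof. by move=> oA Ax; apply/nbhs_rVP; exact: open_nbhs_nbhs. Qed.

Lemma spanning_rV : spanning [seq delta_mx 0 j : V | j <- enum 'I_N].
Proof.
move=> P P0 Pe PD PZ x; rewrite (row_sum_delta x).
apply: (big_ind P) => // i _; apply: PZ; apply: Pe.
by apply: map_f; rewrite mem_enum.
Qed.

Lemma spanning_rVR : spanning ((0, 1) :: [seq (delta_mx 0 j, 0) : V * R | j <- enum 'I_N]).
Proof.
move=> P P0 Pe PD PZ [x a].
have -> : (x, a) = (\sum_(j < N) x 0 j *: (delta_mx 0 j, 0)) + a *: (0, 1) :> V * R.
  have E (t : seq 'I_N) : \sum_(j <- t) x 0 j *: (delta_mx 0 j, 0) =
      (\sum_(j <- t) x 0 j *: delta_mx 0 j, 0) :> V * R.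
    elim: t => [|j t IH]; rewrite ?big_nil ?big_cons ?IH//.
    by apply: injective_projections => //=; rewrite scaler0 addr0.
  rewrite E -row_sum_delta; apply: injective_projections => /=.
    by rewrite scaler0 addr0.
  by rewrite add0r; symmetry; exact: mulr1.
apply: (PD); last by apply: (PZ); apply: (Pe); rewrite inE eqxx.
apply: (big_ind P); [exact: P0|exact: PD|move=> i _; apply: PZ; apply: Pe].
by rewrite inE; apply/orP; right; apply: map_f; rewrite mem_enum.
Qed.
End rV.

(** * Strictly convex domains and ridge functions *)
Section domain.
Context {R : realType} {N : nat}.
Local Notation V := 'rV[R]_N.
Implicit Types (x y z o d : V) (w : V -> R).

Lemma continuous_line o d : continuous (fun l : R => o + l *: d).
Proof.
move=> l A /nbhs_rVP[r r0 HA].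
have d1 : 0 < `|d| + 1 by rewrite ltr_wpDl.
apply/nbhs_ballP; exists (r / (`|d| + 1)) => /=; first by rewrite divr_gt0.
move=> m; rewrite /ball/= ltr_pdivlMr// => lm; apply: HA.
rewrite opprD addrACA subrr add0r -scalerBl normrZ distrC.
apply: le_lt_trans lm; rewrite ler_wpM2l// lerDl//.
Qed.

Lemma closure_normP (A : set V) x (r : R) : closure A x -> 0 < r ->
  exists2 y, A y & `|y - x| < r.
Proof.
move=> Ax r0; have [] := Ax [set y | `|y - x| < r].
  by apply/nbhs_rVP; exists r.
by move=> y [Ay yx]; exists y.
Qed.

Variable Omega : set V.
Hypothesis oO : open Omega.
Hypothesis bO : bounded_set Omega.
Hypothesis scO : strictly_convex Omega.

Lemma Omega_closure x : Omega x -> closure Omega x.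
Proof. exact: subset_closure. Qed.

Lemma closure_bound : exists2 D : R, 0 < D & forall x, closure Omega x -> `|x| <= D.
Proof.
have [B [_ HB]] := bO.
have B0 : B < Num.max B 0 + 1 by rewrite ltr_pwDr// le_max lexx.
exists (Num.max B 0 + 2) => [|x Ox].
  by rewrite ltr_wpDl// le_max lexx orbT.
have [y Oy yx] := closure_normP Ox (@ltr01 R).
have := HB _ B0 y Oy => /= yB.
have -> : x = y - (y - x) by rewrite opprB addrCA subrr addr0.
apply: le_trans (ler_normB _ _) _; lra.
Qed.

Lemma compact_closure : compact (closure Omega).
Proof.
apply: bounded_closed_compact; last exact: closed_closure.
have [D D0 HD] := closure_bound.
exists D; split; first exact: num_real.
by move=> E DE x Ox /=; exact: le_trans (HD x Ox) (ltW DE).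
Qed.

Lemma closure_seg x y (t : R) : closure Omega x -> closure Omega y ->
  0 <= t -> t <= 1 -> closure Omega (t *: x + (1 - t) *: y).
Proof.
move=> Ox Oy; rewrite le_eqVlt => /predU1P[<- _|t0].
  by rewrite scale0r add0r subr0 scale1r.
rewrite le_eqVlt => /predU1P[->|t1].
  by rewrite subrr scale0r addr0 scale1r.
have [<-|xy] := eqVneq x y; first by rewrite -scalerDl addrC subrK scale1r.
by apply: Omega_closure; exact: scO.
Qed.

(** The parameters at which the ray meets the closure form a compact set; l is its maximum. *)
Lemma exit_point o d : closure Omega o -> d != 0 -> exists l : R,
  [/\ 0 <= l, closure Omega (o + l *: d) & forall m, l < m -> ~ closure Omega (o + m *: d)].
Proof.
move=> Oo d0.
have [D D0 HD] := closure_bound.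
have dp : 0 < `|d| by rewrite normr_gt0.
pose T : set R := `[0, 2 * D / `|d|] `&` (fun l : R => o + l *: d) @^-1` closure Omega.
have TE l : 0 <= l -> closure Omega (o + l *: d) -> T l.
  move=> l0 Ol; split => //=; rewrite in_itv/= l0/= ler_pdivlMr//.
  have := ler_normB (o + l *: d) o; rewrite addrAC subrr add0r normrZ (ger0_norm l0).
  have := HD _ Ol; have := HD _ Oo; lra.
have compT : compact T.
  apply: (@subclosed_compact _ _ `[0, 2 * D / `|d|]) => //.
  - apply: closedI; first exact: interval_closed.
    apply: preimage_closed; last exact: closed_closure.
    by move=> l _; exact: continuous_line.
  - exact: segment_compact.
  - by move=> l [].
have T0 : T !=set0 by exists 0; apply: TE; rewrite ?lexx// scale0r addr0.
have cid : {within T, continuous (id : R -> R)}.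
  by apply: continuous_subspaceT => r; exact: cvg_id.
have [l] := compact_EVT_max T0 compT cid.
move=> /set_mem lT lmax; have [l1 l2] := lT.
exists l; split; [|exact: l2|].
  by move: l1; rewrite /= in_itv/= => /andP[].
move=> m lm Om; have l0 : 0 <= l by move: l1; rewrite /= in_itv/= => /andP[].
have := lmax m; rewrite inE => /(_ (TE m (le_trans l0 (ltW lm)) Om)).
by rewrite leNgt lm.
Qed.

(** The exit point itself is included: by openness, a point of Omega there would let the ray
    continue inside. *)
Lemma exit_not_Omega o d (l : R) : d != 0 ->
  (forall m, l < m -> ~ closure Omega (o + m *: d)) ->
  forall m, l <= m -> ~ Omega (o + m *: d).
Proof.
move=> d0 H m lm Om.
have dp : 0 < `|d| by rewrite normr_gt0.
have [r r0 Hr] := open_normP oO Om.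
pose e := r / (2 * `|d|).
have e0 : 0 < e by rewrite divr_gt0// mulr_gt0.
apply: (H (m + e)); first by rewrite (le_lt_trans lm)// ltrDl.
apply: Omega_closure; apply: Hr.
rewrite scalerDl addrA [_ - _]addrC addKr normrZ gtr0_norm//.
rewrite /e invfM mulrA divfK ?gt_eqF//.
by rewrite ltr_pdivrMr// mulr_natr mulr2n ltrDl.
Qed.

Variable g : V -> R.
Variable M : R.
Hypothesis gM : forall z, ~ Omega z -> `|g z| <= M.
Hypothesis N0 : (0 < N)%N.

(** Exiting along a fixed direction both ways yields a segment whose extension stays off Omega, so
    its one-dimensional exterior data are controlled by g. A nonzero direction exists because N >
    0. *)
Lemma chord z : Omega z -> exists x y (t : R),
  [/\ closure Omega x, closure Omega y, 0 < t /\ t < 1, z = t *: x + (1 - t) *: y &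
   forall tau : R, ~ (0 < tau /\ tau < 1) -> ~ Omega (tau *: x + (1 - tau) *: y)].
Proof.
move=> Oz; pose d : V := const_mx 1.
have d0 : d != 0.
  apply/eqP => /rowP/(_ (Ordinal N0)); rewrite !mxE => /eqP.
  by rewrite oner_eq0.
have dN0 : - d != 0 by rewrite oppr_eq0.
have [l [l0 Ol lmax]] := exit_point (Omega_closure Oz) d0.
have [m [m0 Om mmax]] := exit_point (Omega_closure Oz) dN0.
have Hl := exit_not_Omega d0 lmax; have Hm := exit_not_Omega dN0 mmax.
have lp : 0 < l.
  by rewrite lt_def l0 andbT; apply/eqP => l00; apply: (Hl 0); rewrite ?l00 ?scale0r ?addr0.
have mp : 0 < m.
  by rewrite lt_def m0 andbT; apply/eqP => m00; apply: (Hm 0); rewrite ?m00 ?scale0r ?addr0.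
have lm : l + m != 0 by rewrite gt_eqF// addr_gt0.
have E (tau : R) : tau *: (z + l *: d) + (1 - tau) *: (z + m *: - d) =
    z + (tau * (l + m) - m) *: d.
  rewrite !scalerDr addrACA -scalerDl [tau + _]addrC subrK scale1r; congr (_ + _).
  by rewrite !scalerN !scalerA -scaleNr -scalerDl; congr (_ *: _); ring.
exists (z + l *: d), (z + m *: - d), (m / (l + m)); split => //.
- split; first by rewrite divr_gt0// addr_gt0.
  by rewrite ltr_pdivrMr ?addr_gt0// mul1r ltrDr.
- by rewrite E divfK// subrr scale0r addr0.
- move=> tau taun; rewrite E.
  have [t0|t0] := leP tau 0.
    have -> : (tau * (l + m) - m) *: d = (m - tau * (l + m)) *: - d.
      by rewrite scalerN -scaleNr opprB.
    apply: Hm; have : tau * (l + m) <= 0 by rewrite mulr_le0_ge0// addr_ge0.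
    lra.
  apply: Hl; have t1 : 1 <= tau by rewrite leNgt; apply/negP => t1; exact: taun.
  have : 1 * (l + m) <= tau * (l + m) by rewrite ler_wpM2r// addr_ge0.
  lra.
Qed.

Definition admissible s w := s_convex_in s (closure Omega) w /\
  (forall z, ~ Omega z -> w z <= g z).

Lemma gle z : ~ Omega z -> g z <= M.
Proof. by move/gM; rewrite ler_norml => /andP[]. Qed.

Lemma gge z : ~ Omega z -> - M <= g z.
Proof. by move/gM; rewrite ler_norml => /andP[]. Qed.

(** The one-dimensional maximum principle on such a chord; the bound does not depend on s. *)
Lemma admissible_le s w : 0 < s -> s < 1 -> admissible s w -> forall z, w z <= M.
Proof.
move=> s0 s1 [cw wg] z; have [Oz|Oz] := pselect (Omega z); last first.
  exact: le_trans (wg z Oz) (gle Oz).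
have [x [y [t [Ox Oy [t0 t1] -> H]]]] := chord Oz.
have [[v [hv vw]] Hv] := cw x y Ox Oy.
apply: le_trans (Hv v (conj hv vw) t t0 t1) _.
apply: (visc_le_max s0 s1 hv) => tau /[dup] /H nO /vw ->.
exact: le_trans (wg _ nO) (gle nO).
Qed.

(** Equality along segments, rather than an inequality, makes the class a vector space; this allows
    subtracting powers. *)
Definition ridge s w := forall x y, closure Omega x -> closure Omega y ->
  s_harmonic s (fun t => w (t *: x + (1 - t) *: y)).

(** The restriction of w to a segment is itself a Dirichlet solution, and [s_harmonic_le] puts it
    below any other. *)
Lemma ridge_s_convex s w : 0 < s -> s < 1 -> ridge s w -> s_convex_in s (closure Omega) w.
Proof.
move=> s0 s1 hw x y Ox Oy; have hv := hw x y Ox Oy; split.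
  by eexists; split; first exact: (s_harmonic_visc s0 s1 hv).
move=> v [hv' vw] t t0 t1.
exact: (s_harmonic_le s0 s1 hv hv').
Qed.

Lemma ridge_cst s (c : R) : ridge s (fun=> c).
Proof. by move=> x y _ _; exact: s_harmonic_cst. Qed.

Lemma ridge_lin s w w' (a b : R) : ridge s w -> ridge s w' ->
  ridge s (fun z => a * w z + b * w' z).
Proof. by move=> h h' x y Ox Oy; apply: s_harmonic_lin; [exact: h|exact: h']. Qed.

Lemma ridge_pospow s q (a : R) : 0 < s -> s < 1 -> linear_form q ->
  (forall x, closure Omega x -> q x < a) -> ridge s (fun z => pospow s (a - q z)).
Proof.
move=> s0 s1 hq qa x y Ox Oy.
have E : (fun t : R => pospow s (a - q (t *: x + (1 - t) *: y))) =
    (fun t => pospow s ((a - q y) + (q y - q x) * t)).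
  by apply/funext => t; rewrite linear_form_seg//; congr pospow; ring.
rewrite E; apply: s_harmonic_pospow => // t t0 t1.
have := qa _ (closure_seg Ox Oy (ltW t0) (ltW t1)); rewrite linear_form_seg//; lra.
Qed.

Lemma admissible_cst s : 0 < s -> s < 1 -> admissible s (fun=> - M).
Proof.
move=> s0 s1; split; last by move=> z; exact: gge.
by apply: ridge_s_convex => //; exact: ridge_cst.
Qed.
End domain.

(** * The upper bound *)
Section limsup.
Context {R : realType} {N : nat}.
Local Notation V := 'rV[R]_N.
Implicit Types (x y z o d : V) (w : V -> R) (s a b e : R).

Lemma within_continuous_normP (A : set V) (f : V -> R) z e :
  {within A, continuous f} -> A z -> 0 < e ->
  exists2 r : R, 0 < r & forall y, A y -> `|y - z| < r -> `|f y - f z| < e.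
Proof.
move=> /subspace_continuousP cf Az e0.
have /(cf z Az) : nbhs (f z) [set u | `|u - f z| < e].
  by apply/nbhs_ballP; exists e => //= u; rewrite /ball/= distrC.
move=> H; have : nbhs z [set y | A y -> `|f y - f z| < e] by exact: H.
by move=> /nbhs_rVP[r r0 Hr]; exists r => // y Ay /Hr/(_ Ay).
Qed.

Lemma seg_shift x y (t : R) : t *: x + (1 - t) *: y = y + t *: (x - y).
Proof. by rewrite scalerBl scale1r scalerBr addrCA. Qed.

Lemma seg_shiftC x y (t : R) : t *: x + (1 - t) *: y = x + (1 - t) *: (y - x).
Proof. by rewrite -seg_shift subKr addrC. Qed.

Variables (Omega : set V) (g : V -> R) (M : R).
Hypothesis oO : open Omega.
Hypothesis bO : bounded_set Omega.
Hypothesis scO : strictly_convex Omega.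
Hypothesis cg : {within ~` Omega, continuous g}.
Hypothesis gM : forall z, ~ Omega z -> `|g z| <= M.
Hypothesis N0 : (0 < N)%N.

(* [a] bounds the admissible functions eventually, as [s] tends to [1] and [y] to [z]. *)
Definition near_ub z a := exists2 r : R, 0 < r &
  forall s w y, 0 < s -> 1 - r < s -> s < 1 -> admissible Omega g s w ->
    closure Omega y -> `|y - z| < r -> w y <= a.

(** For z' near z a translated and slightly shortened chord passes through z'. Its small
    prolongations stay in Omega close to x and y, where [a] and [b] apply, and the chord barrier
    gives the interpolated bound. *)
Lemma near_ub_seg x y (t a b e : R) : closure Omega x -> closure Omega y -> x != y ->
  0 < t -> t < 1 -> 0 < e -> near_ub x a -> near_ub y b ->
  near_ub (t *: x + (1 - t) *: y) (t * a + (1 - t) * b + e).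
Proof.
move=> Ox Oy xy t0 t1 e0 [rx rx0 Hx] [ry ry0 Hy].
set z := t *: x + (1 - t) *: y.
have Oz : Omega z by exact: scO.
pose r := Num.min rx ry.
have r0 : 0 < r by rewrite lt_min rx0.
have rrx : r <= rx by rewrite ge_min lexx.
have rry : r <= ry by rewrite ge_min lexx orbT.
have xyN : 0 < `|x - y| by rewrite normr_gt0 subr_eq0.
have zy : z - y = t *: (x - y) by rewrite /z seg_shift addrC addKr.
have zx : z - x = (1 - t) *: (y - x).
  by rewrite /z seg_shiftC addrC addKr.
have yx0 : y - x != 0 by rewrite subr_eq0 eq_sym.
have t1' : 0 < 1 - t by rewrite subr_gt0.
(* Pulling the ends towards z by the fraction th brings them inside Omega, where there is room to
   move, yet within r/2 of x and y. *)
pose th := Num.min 2^-1 (r / (4 * (`|x - y|))).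
have th0 : 0 < th by rewrite lt_min invr_gt0 ltr0n/= divr_gt0// mulr_gt0.
have th1 : th < 1 by rewrite gt_min invf_lt1// ltr1n.
have thr : th * `|x - y| < r / 2.
  apply: (@le_lt_trans _ _ (r / 4)).
    apply: (@le_trans _ _ (r / (4 * `|x - y|) * `|x - y|)).
      by rewrite ler_wpM2r// ge_min lexx orbT.
    by rewrite invfM mulrA divfK ?gt_eqF.
  lra.
pose x1 := th *: z + (1 - th) *: x.
pose y1 := th *: z + (1 - th) *: y.
have x1x : `|x1 - x| < r / 2.
  rewrite /x1 seg_shift [x + _]addrC addrK zx scalerA normrZ distrC gtr0_norm ?mulr_gt0//.
  by apply: le_lt_trans thr; rewrite ler_wpM2r// ler_piMr ?(ltW th0)//; lra.
have y1y : `|y1 - y| < r / 2.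
  rewrite /y1 seg_shift [y + _]addrC addrK zy scalerA normrZ gtr0_norm ?mulr_gt0//.
  by apply: le_lt_trans thr; rewrite ler_wpM2r// ler_piMr ?(ltW th0)//; lra.
have cz := Omega_closure Oz.
have Ox1 : Omega x1.
  apply: scO => //; rewrite -subr_eq0 zx scaler_eq0 negb_or yx0 andbT gt_eqF//.
have Oy1 : Omega y1.
  apply: scO => //; rewrite -subr_eq0 zy scaler_eq0 negb_or subr_eq0 xy andbT gt_eqF//.
have zE : z = t *: x1 + (1 - t) *: y1.
  by apply/rowP => j; rewrite /x1 /y1 /z !mxE; ring.
have [p p0 Hp] := open_normP oO Ox1; have [q q0 Hq] := open_normP oO Oy1.
pose u := Num.min (r / 2) (Num.min p q).
have u0 : 0 < u by rewrite !lt_min p0 q0 divr_gt0.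
have ur : u <= r / 2 by rewrite ge_min lexx.
have up : u <= p by rewrite !ge_min lexx !orbT.
have uq : u <= q by rewrite !ge_min lexx !orbT.
(* Prolonging the chord by the fraction eta displaces its ends by at most u/2; the translation uses
   the other half of u. *)
pose eta := u / (2 * (`|x1 - y1| + 1)).
have D1 : 0 < `|x1 - y1| + 1 by rewrite ltr_wpDl.
have eta0 : 0 < eta by rewrite divr_gt0// mulr_gt0.
have etaD : eta * `|x1 - y1| <= u / 2.
  rewrite /eta invfM mulrA -mulrA ler_piMr ?divr_ge0 ?(ltW u0)//.
  by rewrite mulrC ler_pdivrMr// mul1r lerDl.
have M0 : 0 <= `|M| + `|a| + `|b| by rewrite !addr_ge0.
have [sb [sb2 sb1 Hsb]] := visc_barrier M0 e0 eta0.
pose k := Num.min (u / 2) (1 - sb).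
have k0 : 0 < k by rewrite lt_min subr_gt0 sb1 divr_gt0.
have ku : k <= u / 2 by rewrite ge_min lexx.
have ks : k <= 1 - sb by rewrite ge_min lexx orbT.
have kr : k <= r by lra.
have na : `|a| <= `|M| + `|a| + `|b| by rewrite addrAC lerDr addr_ge0.
have nb : `|b| <= `|M| + `|a| + `|b| by rewrite lerDr addr_ge0.
clear thr xyN t1' th0 th1 Ox1 Oy1 zx zy yx0.
clearbody k eta u x1 y1 th r.
exists k => // s w z' s0 sk s1 hw Oz' zz'.
pose D := z' - z.
pose x' := x1 + D; pose y' := y1 + D.
have xy' : x' - y' = x1 - y1 by rewrite /x' /y' opprD addrACA subrr addr0.
have z'E : z' = t *: x' + (1 - t) *: y'.
  by rewrite /x' /y' /D zE; apply/rowP => j; rewrite !mxE; ring.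
have bx (c : V) : `|c| <= u / 2 -> `|x' + c - x1| < u.
  move=> cu; have -> : x' + c - x1 = D + c.
    by apply/rowP => j; rewrite /x' !mxE; ring.
  apply: le_lt_trans (ler_normD _ _) _; rewrite [ltRHS](splitr u).
  exact: ltr_leD (lt_le_trans zz' ku) cu.
have by_ (c : V) : `|c| <= u / 2 -> `|y' + c - y1| < u.
  move=> cu; have -> : y' + c - y1 = D + c.
    by apply/rowP => j; rewrite /y' !mxE; ring.
  apply: le_lt_trans (ler_normD _ _) _; rewrite [ltRHS](splitr u).
  exact: ltr_leD (lt_le_trans zz' ku) cu.
have wx (c : V) : `|c| <= u / 2 -> w (x' + c) <= a.
  move=> cu; have cu' := bx c cu.
  apply: (Hx s w (x' + c) s0 _ s1 hw).
  - by apply: le_lt_trans sk; rewrite lerB// (le_trans kr).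
  - by apply: Omega_closure; apply: Hp; exact: lt_le_trans cu' up.
  have -> : x' + c - x = (x' + c - x1) + (x1 - x) by rewrite addrA subrK.
  apply: le_lt_trans (ler_normD _ _) (lt_le_trans _ rrx).
  by rewrite [ltRHS](splitr r) ltrD// (lt_le_trans cu' ur).
have wy (c : V) : `|c| <= u / 2 -> w (y' + c) <= b.
  move=> cu; have cu' := by_ c cu.
  apply: (Hy s w (y' + c) s0 _ s1 hw).
  - by apply: le_lt_trans sk; rewrite lerB// (le_trans kr).
  - by apply: Omega_closure; apply: Hq; exact: lt_le_trans cu' uq.
  have -> : y' + c - y = (y' + c - y1) + (y1 - y) by rewrite addrA subrK.
  apply: le_lt_trans (ler_normD _ _) (lt_le_trans _ rry).
  by rewrite [ltRHS](splitr r) ltrD// (lt_le_trans cu' ur).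
clearbody x' y' D.
have n00 : `|0 : V| <= u / 2 by rewrite normr0 divr_ge0 ?(ltW u0).
have Ox' : closure Omega x'.
  by have := bx 0 n00; rewrite addr0 => h; apply: Omega_closure; apply: Hp; exact: lt_le_trans h up.
have Oy' : closure Omega y'.
  by have := by_ 0 n00; rewrite addr0 => h; apply: Omega_closure; apply: Hq; exact: lt_le_trans h uq.
have [[v [hv vw]] Hv] := hw.1 x' y' Ox' Oy'.
rewrite z'E; apply: le_trans (Hv v (conj hv vw) t t0 t1) _.
rewrite [t * a + _]addrC.
have ss : sb < s by apply: le_lt_trans sk; rewrite lerBrDl -lerBrDr.
(* The parameter runs from y to x, so [b] is the value at 0 and [a] the value at 1. *)
apply: (Hsb s v b a ss s1 hv nb na _ _ _ t (ltW t0) (ltW t1)).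
- move=> tau ntau; rewrite vw//.
  apply: le_trans (admissible_le oO bO gM N0 s0 s1 hw _) _.
  by rewrite -addrA (le_trans (ler_norm M))// lerDl addr_ge0.
- move=> tau tau1 tau0; rewrite vw; last by case=> h _; move: (lt_le_trans h tau0); rewrite ltxx.
  rewrite seg_shift; apply: wy; rewrite xy' normrZ; apply: le_trans etaD.
  by rewrite ler_wpM2r// (ler0_norm tau0) lerNl ltW.
- move=> tau tau1 tau2; rewrite vw; last by case=> _ h; move: (lt_le_trans h tau1); rewrite ltxx.
  have -> : tau *: x' + (1 - tau) *: y' = x' + (1 - tau) *: (y' - x').
    by rewrite seg_shiftC.
  apply: wx; rewrite normrZ [`|y' - x'|]distrC xy'; apply: le_trans etaD.
  by rewrite ler_wpM2r// ler0_norm ?subr_le0// opprB lerBlDl ltW.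
Qed.
End limsup.

Lemma bdry_arith {R : realFieldType} (t e A G ka : R) : 0 <= t -> t <= ka ->
  - A <= G -> 0 < e -> ka * (2 * A + e) <= e / 4 -> 0 <= 2 * A + e ->
  t * (A + e) + (1 - t) * (G + e / 4) + e / 4 <= G + e.
Proof.
move=> t0 tk AG e0 h A0.
have h1 : t * (2 * A + e) <= ka * (2 * A + e) by rewrite ler_wpM2r.
have h2 : t * (A + e - (G + e / 4)) <= t * (2 * A + e) by rewrite ler_wpM2l//; lra.
lra.
Qed.

Section limsup_boundary.
Context {R : realType} {N : nat}.
Local Notation V := 'rV[R]_N.
Implicit Types (x y z o d : V) (w : V -> R) (s a b e : R).
Variables (Omega : set V) (g : V -> R) (M : R).
Hypothesis oO : open Omega.
Hypothesis bO : bounded_set Omega.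
Hypothesis scO : strictly_convex Omega.
Hypothesis cg : {within ~` Omega, continuous g}.
Hypothesis gM : forall z, ~ Omega z -> `|g z| <= M.
Hypothesis N0 : (0 < N)%N.

(** The chord from o through z' leaves the closure just beyond z'. Its continuation lies off Omega
    near z, so the data at that end are close to g(z); the end o has only the crude bound but a
    small weight at z'. *)
Lemma near_ub_bdry o z e : Omega o -> closure Omega z -> ~ Omega z -> 0 < e ->
  near_ub Omega g z (g z + e).
Proof.
move=> Oo Oz nOz e0; have co := Omega_closure Oo.
have [D D0 HD] := closure_bound bO.
have e4 : 0 < e / 4 by rewrite divr_gt0.
have [r0 r00 Hr0] := within_continuous_normP cg nOz e4.
have DB y : closure Omega y -> `|y - o| <= 2 * D.
  move=> Oy; apply: le_trans (ler_normB _ _) _.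
  have := HD _ Oy; have := HD _ co; lra.
have M0 := normr_ge0 M.
have ME : 0 < 2 * `|M| + e by lra.
(* An overshoot factor below 1 + ka keeps the exit point near z and gives o a weight at most ka, too
   small for the crude bound to cost more than e/4. *)
pose ka := Num.min (r0 / (8 * D)) (e / (4 * (2 * `|M| + e))).
have ka0 : 0 < ka by rewrite lt_min !divr_gt0 ?mulr_gt0.
have kaD : ka * (2 * D) <= r0 / 4.
  apply: (@le_trans _ _ (r0 / (8 * D) * (2 * D))).
    by rewrite ler_wpM2r ?ge_min ?lexx// mulr_ge0// ltW.
  by rewrite le_eqVlt; apply/predU1P; left; field; rewrite gt_eqF.
have kaM : ka * (2 * `|M| + e) <= e / 4.
  apply: (@le_trans _ _ (e / (4 * (2 * `|M| + e)) * (2 * `|M| + e))).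
    by rewrite ler_wpM2r ?ge_min ?lexx ?orbT// ltW.
  by rewrite le_eqVlt; apply/predU1P; left; field; rewrite gt_eqF.
clearbody ka; have k1 : 0 < 1 + ka by lra.
have zo : z != o by apply/eqP => zo; apply: nOz; rewrite zo.
have zo0 : z - o != 0 by rewrite subr_eq0.
(* Otherwise z would lie strictly between this point and o, hence in Omega by strict convexity. *)
have npz : ~ closure Omega (o + (1 + ka) *: (z - o)).
  move=> Op; apply: nOz.
  have -> : z = (1 + ka)^-1 *: (o + (1 + ka) *: (z - o)) + (1 - (1 + ka)^-1) *: o.
    by apply/rowP => j; rewrite !mxE; field; rewrite gt_eqF.
  apply: scO => //; last 2 first.
  - by rewrite invr_gt0.
  - by rewrite invf_lt1//; lra.
  by rewrite -subr_eq0 addrAC subrr add0r scaler_eq0 negb_or zo0 gt_eqF.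
have [rho rho0 Hrho] := open_normP (closed_openC (@closed_closure _ Omega)) npz.
pose eta := r0 / (8 * D).
have eta0 : 0 < eta by rewrite divr_gt0// mulr_gt0.
have etaD : eta * (2 * D) = r0 / 4 by rewrite /eta; field; rewrite gt_eqF.
clearbody eta; have M'0 : 0 <= `|M| + e by lra.
have [sb [sb2 sb1 Hsb]] := visc_barrier M'0 e4 eta0.
have MM : M <= `|M| by exact: ler_norm.
have gz := gM nOz.
have gzM : `|g z + e / 4| <= `|M| + e.
  apply: le_trans (ler_normD _ _) _; rewrite (gtr0_norm e4); lra.
have gz1 : - `|M| <= g z by move: gz; rewrite ler_norml => /andP[]; lra.
(* The four terms put s above the barrier threshold, z' close to z, the exit parameter below 1 + ka,
   and z' away from o. *)
pose k := Num.min (Num.min (1 - sb) (r0 / 4)) (Num.min (rho / (1 + ka)) `|z - o|).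
have k0 : 0 < k by rewrite !lt_min subr_gt0 sb1 !divr_gt0//= normr_gt0.
have kk1 : k <= 1 - sb by rewrite !ge_min lexx.
have kk2 : k <= r0 / 4 by rewrite !ge_min lexx !orbT.
have kk3 : k <= rho / (1 + ka) by rewrite !ge_min lexx !orbT.
have kk4 : k <= `|z - o| by rewrite !ge_min lexx !orbT.
clearbody k; exists k => // s w z' s0 sk s1 hw Oz' zz'.
have [d dE] : exists d, d = z' - o by exists (z' - o).
have d0 : d != 0.
  rewrite dE; apply/eqP => /eqP; rewrite subr_eq0 => /eqP z'o.
  by move: zz'; rewrite z'o distrC ltNge kk4.
have z'E : z' = o + 1 *: d by rewrite scale1r dE addrC subrK.
have [l [l0 Ol lmax]] := exit_point bO co d0.
have Hl := exit_not_Omega oO d0 lmax.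
have l1 : 1 <= l.
  by rewrite leNgt; apply/negP => /lmax; rewrite -z'E.
have lp : 0 < l by exact: lt_le_trans ltr01 l1.
have lk : l < 1 + ka.
  rewrite ltNge; apply/negP => kl.
  apply: (Hrho (o + (1 + ka) *: d)).
    have -> : o + (1 + ka) *: d - (o + (1 + ka) *: (z - o)) = (1 + ka) *: (z' - z).
      by apply/rowP => j; rewrite dE !mxE; ring.
    rewrite normrZ (gtr0_norm k1) mulrC -(ltr_pdivlMr _ _ k1).
    exact: lt_le_trans zz' kk3.
  have -> : o + (1 + ka) *: d = ((1 + ka) / l) *: (o + l *: d) + (1 - (1 + ka) / l) *: o.
    by apply/rowP => j; rewrite !mxE; field; rewrite gt_eqF.
  have kl0 : 0 <= (1 + ka) / l by exact: divr_ge0 (ltW k1) (ltW lp).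
  have kl1 : (1 + ka) / l <= 1 by rewrite (ler_pdivrMr _ _ lp) mul1r.
  exact: (closure_seg scO Ol co kl0 kl1).
have far tau : 1 <= tau -> tau < 1 + eta -> w (o + (tau * l) *: d) <= g z + e / 4.
  move=> tau1 tau2.
  have nO : ~ Omega (o + (tau * l) *: d) by apply: Hl; rewrite ler_peMl// ltW.
  apply: le_trans (hw.2 _ nO) _.
  have : `|g (o + (tau * l) *: d) - g z| < e / 4.
    apply: (Hr0 _ nO).
    have -> : o + (tau * l) *: d - z =
      (tau - 1) *: (o + l *: d - o) + (l - 1) *: (z' - o) + (z' - z).
      by apply/rowP => j; rewrite dE !mxE; ring.
    apply: le_lt_trans (ler_normD _ _) _.
    have h1 : `|(tau - 1) *: (o + l *: d - o)| <= r0 / 4.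
      rewrite normrZ -etaD; apply: (ler_pM (normr_ge0 _) (normr_ge0 _) _ (DB _ Ol)).
      by rewrite ger0_norm; [rewrite lerBlDl; exact: ltW tau2|rewrite subr_ge0].
    have h2 : `|(l - 1) *: (z' - o)| <= r0 / 4.
      rewrite normrZ; apply: le_trans kaD.
      apply: (ler_pM (normr_ge0 _) (normr_ge0 _) _ (DB _ Oz')).
      by rewrite ger0_norm; [rewrite lerBlDl; exact: ltW lk|rewrite subr_ge0].
    have := ler_normD ((tau - 1) *: (o + l *: d - o)) ((l - 1) *: (z' - o)); lra.
  by rewrite ltr_norml => /andP[_]; lra.
(* For l = 1 the point z' is itself the exit point, lies off Omega and is bounded by g directly. *)
move: l1; rewrite le_eqVlt => /predU1P[l1|l1].
  have := far 1 (lexx 1); rewrite ltrDl => /(_ eta0).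
  by rewrite mul1r -l1 -z'E; lra.
have [[v [hv vw]] Hv] := hw.1 _ _ Ol co.
have segE (tau : R) : tau *: (o + l *: d) + (1 - tau) *: o = o + (tau * l) *: d.
  by apply/rowP => j; rewrite !mxE; ring.
have li0 : 0 < l^-1 by rewrite invr_gt0.
have li1 : l^-1 < 1 by rewrite invf_lt1.
have := Hv v (conj hv vw) l^-1 li0 li1.
rewrite segE (mulVf (lt0r_neq0 lp)) -z'E => wv; apply: le_trans wv _.
have wM y : w y <= `|M| + e.
  by apply: le_trans (admissible_le oO bO gM N0 s0 s1 hw y) _; lra.
have Hb : v l^-1 <= (1 - l^-1) * (`|M| + e) + l^-1 * (g z + e / 4) + e / 4.
  have ss : sb < s by apply: le_lt_trans sk; rewrite lerBrDl -lerBrDr.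
  have nM : `|(`|M| + e)| <= `|M| + e by rewrite (ger0_norm M'0).
  apply: (Hsb s v _ _ ss s1 hv nM gzM _ _ _ _ (ltW li0) (ltW li1)).
  - by move=> tau ntau; rewrite vw.
  - move=> tau _ tau0; rewrite vw; first exact: wM.
    by case => h _; move: (lt_le_trans h tau0); rewrite ltxx.
  - move=> tau tau1 tau2; rewrite vw; last first.
      by case => _ h; move: (lt_le_trans h tau1); rewrite ltxx.
    by rewrite segE; exact: far.
apply: le_trans Hb _.
rewrite -[X in _ + X * _ + _](subKr 1 l^-1).
have kl : 1 - l^-1 <= ka.
  have h1 : 1 - l^-1 <= l - 1.
    rewrite -(ler_pM2r lp) mulrBl mul1r (mulVf (lt0r_neq0 lp)).
    by rewrite ler_peMr ?subr_ge0 ?(ltW l1).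
  by apply: le_trans h1 _; rewrite lerBlDl ltW.
apply: (bdry_arith _ kl gz1 e0 kaM (ltW ME)).
by rewrite subr_ge0 (ltW li1).
Qed.
End limsup_boundary.

(** * Affine minorants of convex functions *)
Lemma epi_arith {R : realFieldType} (th vt vz x1 x2 b : R) : 0 < th ->
  th * (x1 + x2 + 1) = 2^-1 -> th * (vt - vz) <= th * x1 -> th * - b <= th * x2 ->
  th * vt + (1 - th) * vz < vz + 1 + th * b.
Proof. by move=> *; lra. Qed.

Section minorant.
Context {R : realType} {N : nat}.
Local Notation V := 'rV[R]_N.
Implicit Types (x y z o d : V) (v : V -> R) (e : R).
Variables (Omega : set V).
Hypothesis oO : open Omega.
Hypothesis bO : bounded_set Omega.
Hypothesis scO : strictly_convex Omega.

Lemma open_line z d : Omega z -> exists t : R, [/\ 0 < t, t <= 1 &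
  forall a : R, 0 <= a -> a <= t -> Omega (z + a *: d)].
Proof.
move=> Oz; have [r r0 Hr] := open_normP oO Oz.
have d1 : 0 < `|d| + 1 by rewrite ltr_wpDl.
exists (Num.min 1 (r / (2 * (`|d| + 1)))); split.
- by rewrite lt_min ltr01 divr_gt0// mulr_gt0.
- by rewrite ge_min lexx.
move=> a a0; rewrite le_min => /andP[_ ar]; apply: Hr.
rewrite addrAC subrr add0r normrZ (ger0_norm a0).
move: ar; rewrite ler_pdivlMr ?mulr_gt0// => ar.
have : a * `|d| <= a * (`|d| + 1) by rewrite ler_wpM2l// lerDl.
lra.
Qed.

(** The point (z, v z) is separated from the strict epigraph, taken about (z, v z + 1). The vertical
    coefficient is then forced to be -1: separation gives one inequality, points just above (z, v z)
    the other. *)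
Lemma subgradient v z : convex_in (closure Omega) v -> Omega z ->
  exists2 q, linear_form q & forall y, closure Omega y -> v z + q (y - z) <= v y.
Proof.
move=> cv Oz; have cz := Omega_closure Oz.
pose A : set (V * R) := [set p | closure Omega p.1 /\ v p.1 < p.2].
have Acvx (p p' : V * R) (t : R) : A p -> A p' -> 0 <= t -> t <= 1 ->
    A (t *: p + (1 - t) *: p').
  case: p p' => [y a] [y' a'] [/= Oy va] [/= Oy' va'] t0 t1.
  split => /=; first exact: closure_seg.
  apply: le_lt_trans (cv y y' t Oy Oy' t0 t1) _.
  have [->|tN0] := eqVneq t 0.
    by rewrite !mul0r !add0r subr0 /GRing.scale/= !mul1r mul0r add0r.
  rewrite /GRing.scale/=; apply: ltr_leD.
    by rewrite ltr_pM2l// lt_def tN0.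
  by rewrite ler_wpM2l ?subr_ge0// ltW.
have Aint (p : V * R) : exists2 t : R, 0 < t & A ((z, v z + 1) + t *: p).
  case: p => d al.
  have [t [t0 t1 Ht]] := open_line d Oz.
  (* [K] dominates the rise of v along t d and the vertical shift; scaled by 1/(2K), together they
     cost less than the unit height of the base point. *)
  pose K := `|v (z + t *: d) - v z| + `|t * al| + 1.
  have K1 : 1 <= K by rewrite lerDr addr_ge0.
  have K0 : 0 < K by rewrite (lt_le_trans ltr01).
  pose th := (2 * K)^-1.
  have th0 : 0 < th by rewrite invr_gt0 mulr_gt0.
  have thK : th * K = 2^-1 by rewrite /th; field; rewrite gt_eqF.
  have th1 : th <= 1 by rewrite invf_le1 ?mulr_gt0//; lra.
  exists (th * t); first by rewrite mulr_gt0.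
  have Ot : Omega (z + t *: d) by apply: Ht; [exact: ltW|exact: lexx].
  split => /=.
    by apply: Omega_closure; apply: Ht; rewrite ?mulr_ge0 ?(ltW th0) ?(ltW t0)// ler_piMl// ltW.
  have -> : z + (th * t) *: d = th *: (z + t *: d) + (1 - th) *: z.
    by apply/rowP => j; rewrite !mxE; ring.
  apply: le_lt_trans (cv _ _ _ (Omega_closure Ot) cz (ltW th0) th1) _.
  rewrite /GRing.scale/=.
  have h1 : th * (v (z + t *: d) - v z) <= th * `|v (z + t *: d) - v z|.
    by rewrite ler_wpM2l ?(ltW th0)// ler_norm.
  have h2 : th * - (t * al) <= th * `|t * al|.
    by rewrite ler_wpM2l ?(ltW th0)// -normrN ler_norm.
  rewrite -mulrA; exact: (epi_arith th0 thK h1 h2).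
have nA : ~ A (z, v z) by case=> /= _; rewrite ltxx.
have [q [qD qZ q1 qA]] := separation spanning_rVR Acvx Aint nA.
have qN p : q (- p) = - q p by rewrite -scaleN1r qZ mulN1r.
have dec (y : V) (a : R) : q (y, a) = q (y, 0) + a * q (0, 1).
  rewrite -qZ -qD; congr q; apply: injective_projections => /=.
    by rewrite scaler0 addr0.
  by rewrite add0r; symmetry; exact: mulr1.
have q00 : q (0, 0) = 0 by rewrite (_ : (0, 0) = 0 *: (0, 0)) ?qZ ?mul0r ?scale0r.
have key y a : closure Omega y -> v y < a -> q (y - z, 0) + (a - v z - 1) * q (0, 1) <= 1.
  move=> Oy va; have := qA (y, a) (conj Oy va).
  have -> : (y, a) - (z, v z + 1) = (y - z, a - v z - 1).
    by apply: injective_projections; [|rewrite /= opprD addrA].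
  by rewrite dec.
have bN1 : q (0, 1) <= - 1.
  have E : (z, v z) - (z, v z + 1) = (0, - 1).
    by apply: injective_projections; rewrite /= ?subrr// opprD addrA subrr sub0r.
  by move: q1; rewrite E dec q00; lra.
have bE : q (0, 1) = - 1.
  apply/eqP; rewrite eq_le bN1/=; apply/ler_addgt0Pl => e e0.
  (* At height e/(1+e) above (z, v z) the separation inequality reads -b <= 1 + e. *)
  have c0 : 0 < e / (1 + e) by rewrite divr_gt0//; lra.
  have := key z (v z + e / (1 + e)) cz; rewrite ltrDl => /(_ c0).
  rewrite subrr q00 add0r; set b := q _.
  have -> : (v z + e / (1 + e) - v z - 1) * b = - b / (1 + e) by field; lra.
  rewrite ler_pdivrMr; last lra.
  lra.
exists (fun y => q (y, 0)).
  split=> [x y|a x].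
    by rewrite -qD; congr q; apply: injective_projections => //=; rewrite addr0.
  by rewrite -qZ; congr q; apply: injective_projections => //=; rewrite scaler0.
move=> y Oy; apply/ler_addgt0Pl => e e0.
have := key y (v y + e) Oy; rewrite ltrDl bE => /(_ e0); lra.
Qed.

(** Separation gives only a weak inequality. Strictness comes from the midpoint of y and z: it is
    interior, so it can be moved along z - o, where q increases, without leaving Omega. *)
Lemma strict_support o z : Omega o -> closure Omega z -> ~ Omega z ->
  exists2 q, linear_form q & forall y, closure Omega y -> y != z -> q y < q z.
Proof.
move=> Oo Oz nOz.
have Acvx x y (t : R) : Omega x -> Omega y -> 0 <= t -> t <= 1 -> Omega (t *: x + (1 - t) *: y).
  move=> Ox Oy; rewrite le_eqVlt => /predU1P[<- _|t0].
    by rewrite scale0r add0r subr0 scale1r.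
  rewrite le_eqVlt => /predU1P[->|t1].
    by rewrite subrr scale0r addr0 scale1r.
  have [<-|xy] := eqVneq x y; first by rewrite -scalerDl addrC subrK scale1r.
  by apply: scO => //; exact: Omega_closure.
have Aint d : exists2 t : R, 0 < t & Omega (o + t *: d).
  have [t [t0 t1 Ht]] := open_line d Oo; exists t => //.
  by apply: Ht; [exact: ltW|exact: lexx].
have [q [qD qZ q1 qA]] := separation spanning_rV Acvx Aint nOz.
have hq : linear_form q by [].
exists q => // y Oy yz.
pose m := 2^-1 *: y + (1 - 2^-1) *: z.
have Om : Omega m by apply: scO => //; rewrite ?invr_gt0// invf_lt1// ltr1n.
have [t [t0 t1 Ht]] := open_line (z - o) Om.
have := qA _ (Ht t (ltW t0) (lexx t)).
rewrite linear_formB// qD qZ /m linear_form_seg//.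
move: q1; rewrite linear_formB//.
have -> : q o = q o + 0 by rewrite addr0.
move=> q1 H.
have : 0 < t * (q z - q o) by rewrite mulr_gt0//; lra.
lra.
Qed.

Variables (g : V -> R) (M : R).
Hypothesis cg : {within ~` Omega, continuous g}.
Hypothesis gM : forall z, ~ Omega z -> `|g z| <= M.

Lemma closed_bdry : closed (bdry Omega).
Proof. by apply: closedI; [exact: closed_closure|exact: open_closedC]. Qed.

Lemma compact_bdry : compact (bdry Omega).
Proof.
by apply: (subclosed_compact closed_bdry (compact_closure bO)) => x [].
Qed.

(** At an interior point a subgradient does it. At a boundary point v may have no finite slope;
    there an affine function of value v(z) - e at z descends steeply along a strictly supporting
    form, and continuity of g handles the points near z. *)
Lemma affine_minorant o v z e : Omega o -> convex_in (closure Omega) v ->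
  (forall y, bdry Omega y -> v y <= g y) -> closure Omega z -> 0 < e ->
  exists q c, [/\ linear_form q, forall y, bdry Omega y -> q y + c <= g y &
    v z - e <= q z + c].
Proof.
move=> Oo cv vg Oz e0.
have [Oz'|nOz] := pselect (Omega z).
  have [q hq Hq] := subgradient cv Oz'.
  exists q, (v z - q z); split => //; last by rewrite addrCA subrr addr0; lra.
  move=> y /[dup] -[Oy nOy] by_; apply: le_trans (vg y by_).
  by have := Hq y Oy; rewrite linear_formB//; lra.
have [q hq Hq] := strict_support Oo Oz nOz.
have [r r0 Hr] := within_continuous_normP cg nOz e0.
have vz := vg z (conj Oz nOz).
(* the slope K must beat the oscillation of g away from z *)
have [K K0 HK] : exists2 K : R, 0 <= K & forall y, bdry Omega y ->
    ~ (`|y - z| < r) -> `|v z| + M <= K * (q z - q y).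
  pose B := bdry Omega `&` ~` [set y | `|y - z| < r].
  have oB : open [set y | `|y - z| < r].
    rewrite openE => y /= yz; apply/nbhs_rVP; exists (r - `|y - z|); first by rewrite subr_gt0.
    move=> x xy /=; have -> : x - z = (x - y) + (y - z) by rewrite addrA subrK.
    by apply: le_lt_trans (ler_normD _ _) _; lra.
  have cB : compact B.
    apply: (subclosed_compact _ compact_bdry); last by move=> y [].
    by apply: closedI; [exact: closed_bdry|exact: open_closedC].
  have [B0|/set0P nB0] := eqVneq B set0.
    exists 0 => // y by_ ny; exfalso.
    have : B y by split.
    by rewrite B0.
  have ch : {within B, continuous (fun y => q z - q y)}.
    apply: continuous_subspaceT => y; apply: continuousB.
      exact: cst_continuous.
    exact: (linear_form_continuous hq).
  have [c cB' Hc] := compact_EVT_min nB0 cB ch.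
  move: cB'; rewrite inE => -[[Oc nOc] nc].
  have cz : c != z.
    by apply/eqP => cz; apply: nc; rewrite /= cz subrr normr0.
  have h0 : 0 < q z - q c by rewrite subr_gt0; exact: Hq.
  have M0 : 0 <= M := le_trans (normr_ge0 _) (gM nOz).
  exists ((`|v z| + M) / (q z - q c)).
    exact: divr_ge0 (addr_ge0 (normr_ge0 _) M0) (ltW h0).
  move=> y by_ ny; rewrite mulrAC ler_pdivlMr// ler_wpM2l ?addr_ge0//.
  by apply: Hc; rewrite inE.
exists (fun y => K * q y), (v z - e - K * q z); split; last by lra.
  split=> [x y|a x]; first by rewrite hq.1 mulrDr.
  by rewrite hq.2 mulrCA.
move=> y /[dup] -[Oy nOy] by_.
have [->|yz] := eqVneq y z; first by lra.
have qy := Hq y Oy yz.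
have [yr|yr] := pselect (`|y - z| < r).
  have := Hr y nOy yr; rewrite ltr_norml => /andP[gy _].
  have : 0 <= K * (q z - q y) by rewrite mulr_ge0// subr_ge0 ltW.
  lra.
have := HK y by_ yr; have := gM nOy; rewrite ler_norml => /andP[gy _].
have := ler_norm (v z); lra.
Qed.
End minorant.

(** * Penalties and the lower bound *)
(** Write x = x^s x^(1-s); the second factor is at most 1 + (1-s) X by the tangent bound, and x^s <=
    X. The error is O(1-s) uniformly on (0,X]. *)
Lemma powR_ge_lin {R : realType} (s x X : R) : 0 < s -> s < 1 -> 0 < x -> x <= X -> 1 <= X ->
  x - (1 - s) * X ^+ 2 <= x `^ s.
Proof.
move=> s0 s1 x0 xX X1.
have X0 : 0 < X by exact: lt_le_trans X1.
have s10 : 0 < 1 - s by rewrite subr_gt0.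
have s11 : 1 - s < 1 by rewrite gtrBl.
have h1 : x `^ (1 - s) <= X `^ (1 - s).
  by apply: (ge0_ler_powR (ltW s10)); rewrite ?nnegrE ?(ltW x0) ?(ltW X0).
have h2 := powR_young s10 s11 (ltW X0).
have h3 : x `^ s <= X.
  apply: (@le_trans _ _ (X `^ s)).
    by apply: (ge0_ler_powR (ltW s0)); rewrite ?nnegrE ?(ltW x0) ?(ltW X0).
  by apply: ler1_powR => //; exact: ltW.
have E : x = x `^ s * x `^ (1 - s).
  by rewrite -powRD ?(gt_eqF x0) ?implybT// (_ : s + (1 - s) = 1) ?powRr1 ?(ltW x0)//; ring.
have p0 : 0 <= x `^ s by exact: powR_ge0.
have h4 : x <= x `^ s * (1 + (1 - s) * X).
  by rewrite {1}E; apply: ler_wpM2l => //; lra.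
have h5 : x `^ s * ((1 - s) * X) <= X * ((1 - s) * X).
  by apply: ler_wpM2r => //; apply: mulr_ge0; exact: ltW.
lra.
Qed.

Lemma powR_le_lin {R : realType} (s x : R) : 0 < s -> s < 1 -> 0 <= x ->
  x `^ s <= x + (1 - s).
Proof.
move=> s0 s1 x0; apply: le_trans (powR_young s0 s1 x0) _.
by rewrite lerD2r ler_piMl// ltW.
Qed.

Section penalty.
Context {R : realType} {N : nat}.
Local Notation V := 'rV[R]_N.
Implicit Types (x y z o d : V) (w : V -> R) (s a b e : R) (S : set V).
Variable Omega : set V.
Hypothesis oO : open Omega.
Hypothesis bO : bounded_set Omega.
Hypothesis scO : strictly_convex Omega.

(* Adding [T] to a competitor lowers it by [K] on [S] at a cost [O(1 - s)] in Omega. *)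
Definition penalizable S := forall K : R, 0 <= K -> exists2 C : R, 0 <= C &
  forall s, 0 < s -> s < 1 -> exists T : V -> R,
    [/\ ridge Omega s T, forall y, T y <= 0,
        forall y, closure Omega y -> - (C * (1 - s)) <= T y &
        forall y, S y -> T y <= - K].

Lemma penalizable0 : penalizable set0.
Proof.
move=> K K0; exists 0 => // s s0 s1; exists (fun=> 0); split => //.
  exact: ridge_cst.
by move=> y _; rewrite mul0r oppr0.
Qed.

Lemma penalizableS S S' : S `<=` S' -> penalizable S' -> penalizable S.
Proof.
move=> SS h K K0; have [C C0 HC] := h K K0; exists C => // s s0 s1.
have [T [T1 T2 T3 T4]] := HC s s0 s1; exists T; split => // y /SS; exact: T4.
Qed.

Lemma penalizableU S S' : penalizable S -> penalizable S' -> penalizable (S `|` S').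
Proof.
move=> h h' K K0; have [C C0 HC] := h K K0; have [C' C'0 HC'] := h' K K0.
exists (C + C'); first exact: addr_ge0.
move=> s s0 s1.
have [T [T1 T2 T3 T4]] := HC s s0 s1; have [T' [T'1 T'2 T'3 T'4]] := HC' s s0 s1.
exists (fun z => 1 * T z + 1 * T' z); split.
- exact: ridge_lin.
- by move=> y; have := T2 y; have := T'2 y; lra.
- by move=> y Oy; have := T3 y Oy; have := T'3 y Oy; lra.
- by move=> y [/T4|/T'4]; have := T2 y; have := T'2 y; lra.
Qed.

(* [(x + eta)_+^s - x_+^s - eta^s <= 0] by subadditivity; it vanishes in the limit for [x > 0]
   and equals [- eta^s] for [x <= - eta] *)
Lemma penalizable_halfspace (q : V -> R) (a eta : R) : linear_form q ->
  (forall x, closure Omega x -> q x < a) -> 0 < eta -> eta <= 1 ->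
  penalizable [set y | a + eta <= q y].
Proof.
move=> hq qa eta0 eta1 K K0.
have [D D0 HD] := closure_bound bO.
have [Cq Cq0 HCq] := linear_form_bound hq.
pose k := K / eta.
have k0 : 0 <= k by rewrite divr_ge0// ltW.
pose X := `|a| + Cq * D + 2.
have CD : 0 <= Cq * D by rewrite mulr_ge0// ltW.
have X1 : 1 <= X by have := normr_ge0 a; rewrite /X; lra.
exists (k * (X ^+ 2 + 2)); first by rewrite mulr_ge0// addr_ge0// sqr_ge0.
move=> s s0 s1.
have qa' x : closure Omega x -> q x < a + eta by move=> Ox; have := qa x Ox; lra.
exists (fun z => k * (1 * pospow s (a + eta - q z) + (-1) * pospow s (a - q z)) +
   1 * (- (k * eta `^ s))).
(* With eta <= 1 the drop k eta^s on the half-space is at least k eta = K. *)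
have se : eta <= eta `^ s by apply: ger1_powR; rewrite ?eta0 ?eta1 ?(ltW s1).
split.
- apply: (@ridge_lin _ _ _ _ _ (fun=> - (k * eta `^ s))); last exact: ridge_cst.
  by apply: ridge_lin; exact: ridge_pospow.
- move=> y; have := @pospowD _ s (a - q y) eta s0 (ltW s1) (ltW eta0).
  rewrite addrAC => h.
  have : k * (pospow s (a + eta - q y) - pospow s (a - q y) - eta `^ s) <= 0.
    by rewrite mulr_ge0_le0//; lra.
  lra.
- move=> y Oy; have ay := qa y Oy.
  have qy : `|q y| <= Cq * D by apply: le_trans (HCq y) _; rewrite ler_wpM2l// HD.
  have x0 : 0 < a - q y by rewrite subr_gt0.
  have x1 : 0 < a + eta - q y by lra.
  have xX : a + eta - q y <= X.
    have := ler_norm a; move: qy; rewrite ler_norml /X => /andP[]; lra.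
  rewrite !pospow_pos ?(ltW x0) ?(ltW x1)//.
  have h1 := powR_ge_lin s0 s1 x1 xX X1.
  have h2 := powR_le_lin s0 s1 (ltW x0).
  have h3 := powR_le_lin s0 s1 (ltW eta0).
  have h : - ((X ^+ 2 + 2) * (1 - s)) <= (a + eta - q y) `^ s - (a - q y) `^ s - eta `^ s.
    lra.
  have := ler_wpM2l k0 h; lra.
- move=> y /= ay; rewrite !pospow_neg//; try lra.
  have : k * eta <= k * eta `^ s by rewrite ler_wpM2l.
  rewrite {1}/k divfK ?gt_eqF//; lra.
Qed.

(** In the supremum norm the outside of a ball is a finite union of coordinate half-spaces. *)
Lemma penalizable_far (D : R) : (forall x, closure Omega x -> `|x| <= D) ->
  penalizable [set y | D + 2 <= `|y|].
Proof.
move=> HD.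
have hs (c : R) (j : 'I_N) : `|c| = 1 -> penalizable [set y | D + 2 <= c * y 0 j].
  move=> c1; rewrite (_ : D + 2 = (D + 1) + 1); last by ring.
  apply: penalizable_halfspace => //.
    by split=> [x y|b x]; rewrite mxE ?mulrDr// mulrCA.
  move=> x Ox; apply: le_lt_trans (ler_norm _) _; rewrite normrM c1 mul1r.
  by apply: le_lt_trans (ler_coord_norm x j) _; have := HD x Ox; lra.
have hj (j : 'I_N) : penalizable [set y | D + 2 <= `|y 0 j|].
  apply: (penalizableS _ (penalizableU (hs 1 j (normr1 _)) (hs (-1) j (normrN1 _)))).
  move=> y /=; rewrite mul1r mulN1r ler_normr => /orP[|]; first by left.
  by right.
have hall (t : seq 'I_N) : penalizable [set y | exists2 j, j \in t & D + 2 <= `|y 0 j|].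
  elim: t => [|j t IH].
    by apply: (penalizableS _ penalizable0) => y [].
  apply: (penalizableS _ (penalizableU (hj j) IH)) => y /= [i].
  by rewrite inE => /predU1P[->|it] h; [left|right; exists i].
have D2 : forall x, closure Omega x -> 0 <= D.
  by move=> x Ox; exact: le_trans (normr_ge0 x) (HD x Ox).
have [[x Ox]|nO] := pselect (exists x, closure Omega x); last first.
  move=> K K0; exists 0 => // s s0 s1; exists (fun=> - K); split.
  - exact: ridge_cst.
  - by move=> y; rewrite oppr_le0.
  - by move=> y Oy; exfalso; apply: nO; exists y.
  - by [].
apply: (penalizableS _ (hall (enum 'I_N))) => y /= yD.
have y0 : mx_norm y != 0.
  have := D2 x Ox; move: yD; rewrite /Num.norm/= => yD D0.
  by rewrite gt_eqF//; lra.
have [[i j] /= yij] := mx_norm_neq0 y0.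
exists j; first by rewrite mem_enum.
by move: yD; rewrite {1}/Num.norm/= yij ord1.
Qed.

(** Separating a point slightly closer to o than z, still off the closure, turns weak separation
    into a gap of at least k at z. The gap leaves room for a half-space offset k/4 and an open
    neighbourhood. *)
Lemma penalizable_point o z : Omega o -> ~ closure Omega z ->
  exists U, [/\ open U, U z & penalizable U].
Proof.
move=> Oo nz; have co := Omega_closure Oo.
have [r r0 Hr] := open_normP (closed_openC (@closed_closure _ Omega)) nz.
have d1 : 0 < `|z - o| + 1 by rewrite ltr_wpDl.
pose k := Num.min 2^-1 (r / (2 * (`|z - o| + 1))).
have k0 : 0 < k by rewrite lt_min invr_gt0 ltr0n/= divr_gt0// mulr_gt0.
have k2 : k <= 2^-1 by rewrite ge_min lexx.
have kr : k * `|z - o| < r.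
  apply: (@le_lt_trans _ _ (r / 2)); last by lra.
  apply: (@le_trans _ _ (k * (`|z - o| + 1))).
    by apply: ler_wpM2l; [exact: ltW|rewrite lerDl].
  have h : k <= r / (2 * (`|z - o| + 1)) by rewrite ge_min lexx orbT.
  have := ler_wpM2r (ltW d1) h.
  by have -> : r / (2 * (`|z - o| + 1)) * (`|z - o| + 1) = r / 2 by field; rewrite gt_eqF.
clearbody k.
pose z' := o + (1 - k) *: (z - o).
have nz' : ~ closure Omega z'.
  apply: Hr; have -> : z' - z = (- k) *: (z - o).
    by apply/rowP => j; rewrite /z' !mxE; ring.
  by rewrite normrZ normrN (gtr0_norm k0).
have Acvx x y (t : R) : closure Omega x -> closure Omega y -> 0 <= t -> t <= 1 ->
    closure Omega (t *: x + (1 - t) *: y) by exact: closure_seg.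
have Aint d : exists2 t : R, 0 < t & closure Omega (o + t *: d).
  have [t [t0 t1 Ht]] := open_line oO d Oo; exists t => //.
  by apply: Omega_closure; apply: Ht; [exact: ltW|exact: lexx].
have [q [qD qZ q1 qA]] := separation spanning_rV Acvx Aint nz'.
have hq : linear_form q by split.
have k1 : 0 < 1 - k by lra.
have qz : 1 + k <= q z - q o.
  move: q1; rewrite /z' addrAC subrr add0r qZ linear_formB// => q1.
  have : 1 <= (1 - k) * (q z - q o) by [].
  move=> {}q1; rewrite -(ler_pM2l k1); apply: le_trans q1.
  have := sqr_ge0 k; lra.
pose U := [set y | (q o + 1 + k / 4) + k / 4 < q y].
exists U; split.
- rewrite (_ : U = q @^-1` [set u | q o + 1 + k / 4 + k / 4 < u])//.
  apply: open_comp; last exact: open_gt.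
  by move=> y _; exact: linear_form_continuous.
- by rewrite /U/=; lra.
- apply: (penalizableS (S' := [set y | (q o + 1 + k / 4) + k / 4 <= q y])).
    by move=> y /ltW.
  apply: penalizable_halfspace => //; try lra.
  by move=> x Ox; have := qA x Ox; rewrite linear_formB//; lra.
Qed.

Variables (g : V -> R) (M : R).
Hypothesis cg : {within ~` Omega, continuous g}.
Hypothesis gM : forall z, ~ Omega z -> `|g z| <= M.

Lemma lower_barrier o (q : V -> R) (c e : R) : Omega o -> linear_form q ->
  (forall y, bdry Omega y -> q y + c <= g y) -> 0 < e ->
  exists2 r : R, 0 < r & forall s, 0 < s -> 1 - r < s -> s < 1 ->
    exists2 w, admissible Omega g s w &
      forall y, closure Omega y -> q y + c - e <= w y.
Proof.
move=> Oo hq qg e0.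
have [D D0 HD] := closure_bound bO.
have [Cq Cq0 HCq] := linear_form_bound hq.
(* The exterior points where the unpenalised competitor may exceed g: those beyond radius D + 2 and
   those where the margin e/2 fails. *)
pose S := [set y | ~ Omega y /\ ~ (`|y| <= D + 2 /\ q y + c - e / 2 <= g y)].
have penS : penalizable S.
  pose Kc : set V := [set y | `|y| <= D + 2] `&` ~` Omega.
  have cK : compact Kc.
    apply: bounded_closed_compact.
      exists (D + 2); split; first exact: num_real.
      by move=> E DE x [/= xD _]; exact: le_trans xD (ltW DE).
    apply: closedI; last exact: open_closedC.
    rewrite (_ : [set y | _] = ~` [set y | D + 2 < `|y|]); last first.
      by apply/seteqP; split => y /=; rewrite leNgt => /negP.
    apply: open_closedC; rewrite openE => y /= yD; apply/nbhs_rVP.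
    exists (`|y| - (D + 2)); first by rewrite subr_gt0.
    move=> x xy /=; have := ler_normB x (x - y).
    have -> : x - (x - y) = y by rewrite opprB addrCA subrr addr0.
    lra.
  have penK : penalizable (S `&` Kc).
    apply: (@compact_ind _ Kc (fun A => penalizable (S `&` A)) cK).
    - by rewrite setI0; exact: penalizable0.
    - by move=> A B hA hB; rewrite setIUr; exact: penalizableU.
    - by move=> A B AB; apply: penalizableS; exact: setIS.
    move=> x [xD nOx].
    have [Ox|nOx'] := pselect (closure Omega x); last first.
      have [U [oU Ux pU]] := penalizable_point Oo nOx'.
      exists U; split => //; apply: (penalizableS _ pU) => y [_ []] //.
    have e8 : 0 < e / 8 by rewrite divr_gt0.
    have [r r0 Hr] := within_continuous_normP cg nOx e8.
    have Cq1 : 0 < Cq + 1 by lra.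
    pose r' := Num.min r (e / (8 * (Cq + 1))).
    have r'0 : 0 < r' by rewrite lt_min r0 divr_gt0// mulr_gt0.
    exists [set y | `|y - x| < r']; split.
    - rewrite openE => y /= yx; apply/nbhs_rVP; exists (r' - `|y - x|).
        by rewrite subr_gt0.
      move=> y' y'y /=; have -> : y' - x = (y' - y) + (y - x) by rewrite addrA subrK.
      by apply: le_lt_trans (ler_normD _ _) _; lra.
    - by rewrite /= subrr normr0.
    (* Near a boundary point g and q each vary by at most e/8, so the margin e/2 holds and S is
       empty there. *)
    - apply: (penalizableS _ penalizable0) => y [[nOy nG] [/= yx [yD _]]].
      apply: nG; split => //.
      have yr : `|y - x| < r by apply: lt_le_trans yx _; rewrite ge_min lexx.
      have := Hr y nOy yr; rewrite ltr_norml => /andP[gy _].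
      have yr2 : (Cq + 1) * `|y - x| <= e / 8.
        have h : `|y - x| <= e / (8 * (Cq + 1)).
          by apply: ltW; apply: lt_le_trans yx _; rewrite ge_min lexx orbT.
        have := ler_wpM2l (ltW Cq1) h.
        have -> : (Cq + 1) * (e / (8 * (Cq + 1))) = e / 8 by field; rewrite gt_eqF.
        by [].
      have qyx : q y - q x <= e / 8.
        rewrite -linear_formB//; apply: le_trans (ler_norm _) _.
        apply: le_trans (HCq _) _; apply: le_trans yr2.
        by rewrite ler_wpM2r// lerDl.
      have := qg x (conj Ox nOx); lra.
  apply: (penalizableS _ (penalizableU (penalizable_far HD) penK)) => y Sy.
  have [yD|yD] := leP (D + 2) `|y|; first by left.
  by right; split => //; split; [exact: ltW|case: Sy].
(* This choice gives B - q >= 1 on the ball of radius D + 2. The unpenalised competitor is below c +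
   B everywhere, so [K] pushes it below -|M| on S. *)
pose B := Cq * (D + 2) + 1.
pose K := `|c + B| + `|M|.
have K0 : 0 <= K by rewrite addr_ge0.
have [C C0 HC] := penS K K0.
pose X := 2 * (Cq * (D + 2)) + 2.
have CD : 0 <= Cq * (D + 2) by rewrite mulr_ge0//; lra.
have X1 : 1 <= X by rewrite /X; lra.
have X20 : 0 < X ^+ 2 by rewrite exprn_gt0//; lra.
have C1 : 0 < 1 + C by lra.
pose r := Num.min (e / (4 * X ^+ 2)) (e / (4 * (1 + C))).
have r0 : 0 < r by rewrite lt_min; apply/andP; split; apply: divr_gt0 => //; exact: mulr_gt0.
have rX : r * X ^+ 2 <= e / 4.
  have h : r <= e / (4 * X ^+ 2) by rewrite ge_min lexx.
  have := ler_wpM2r (ltW X20) h.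
  by have -> : e / (4 * X ^+ 2) * X ^+ 2 = e / 4 by field; rewrite gt_eqF//; lra.
have rC : r * (1 + C) <= e / 4.
  have h : r <= e / (4 * (1 + C)) by rewrite ge_min lexx orbT.
  have := ler_wpM2r (ltW C1) h.
  by have -> : e / (4 * (1 + C)) * (1 + C) = e / 4 by field; rewrite gt_eqF.
exists r => // s s0 sr s1.
have [T [T1 T2 T3 T4]] := HC s s0 s1.
have s1r : 1 - s <= r by lra.
have sX : (1 - s) * X ^+ 2 <= e / 4 by apply: le_trans rX; rewrite ler_wpM2r// ltW.
have sC : (1 - s) * (1 + C) <= e / 4 by apply: le_trans rC; rewrite ler_wpM2r// ltW.
have qB y : `|y| <= D + 2 -> - (Cq * (D + 2)) <= q y /\ q y <= Cq * (D + 2).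
  move=> yD; have : `|q y| <= Cq * (D + 2) by apply: le_trans (HCq y) _; rewrite ler_wpM2l.
  by rewrite ler_norml => /andP.
have OD y : closure Omega y -> `|y| <= D + 2 by move=> /HD; lra.
(* The shift 3e/4 pays e/4 for replacing the power by a linear function and leaves the margin e/2
   off S; in the closure, power and penalty together lose at most another e/4. *)
exists (fun y => 1 * ((-1) * pospow s (B - q y) + 1 * (c + B - 3 * e / 4)) + 1 * T y).
  split.
    apply: ridge_s_convex => //; apply: ridge_lin => //.
    apply: (@ridge_lin _ _ _ _ _ (fun=> c + B - 3 * e / 4)); last exact: ridge_cst.
    apply: ridge_pospow => // x Ox; have := (qB x (OD x Ox)).2; rewrite /B; lra.
  move=> y nOy.
  have [[yD qgy]|nG] := pselect (`|y| <= D + 2 /\ q y + c - e / 2 <= g y).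
    have [q1 q2] := qB y yD.
    have x0 : 0 < B - q y by rewrite /B; lra.
    have xX : B - q y <= X by rewrite /B /X; lra.
    have := powR_ge_lin s0 s1 x0 xX X1; rewrite (pospow_pos _ (ltW x0)).
    have := T2 y; lra.
  have := T4 y (conj nOy nG); have := pospow_ge0 s (B - q y).
  have := gM nOy; rewrite ler_norml => /andP[gy _].
  have := ler_norm M; have := ler_norm (c + B); rewrite /K; lra.
move=> y Oy; have [q1 q2] := qB y (OD y Oy).
have x0 : 0 <= B - q y by rewrite /B; lra.
have := powR_le_lin s0 s1 x0; rewrite (pospow_pos _ x0).
have := T3 y Oy; lra.
Qed.
End penalty.

(** * Convergence of the envelopes *)
(** Serves both envelopes: the member [w0] excludes -oo and the bound [M] excludes +oo, so [fine]
    loses nothing. *)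
Lemma ereal_sup_funP {R : realType} {T : Type} (F : set (T -> R)) (z : T) (M : R) w0 :
  F w0 -> (forall w, F w -> w z <= M) ->
  let u := ereal_sup [set (w z)%:E | w in F] in
  [/\ u \is a fin_num, forall w, F w -> w z <= fine u,
      forall a, (forall w, F w -> w z <= a) -> fine u <= a &
      forall e, 0 < e -> exists2 w, F w & fine u - e < w z].
Proof.
move=> F0 FM u.
have ub a : (forall w, F w -> w z <= a) -> (u <= a%:E)%E.
  by move=> Fa; apply: ge_ereal_sup => _ [w Fw <-]; rewrite lee_fin; exact: Fa.
have lb w : F w -> ((w z)%:E <= u)%E by move=> Fw; apply: ereal_sup_ubound; exists w.
have uf : u \is a fin_num.
  rewrite fin_numElt (lt_le_trans (ltNyr (w0 z)) (lb _ F0))/=.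
  exact: le_lt_trans (ub M FM) (ltry M).
split => //.
- by move=> w Fw; rewrite -lee_fin fineK//; exact: lb.
- by move=> a Fa; rewrite -lee_fin fineK//; exact: ub.
- move=> e e0; apply: contrapT => H.
  have : (u <= (fine u - e)%:E)%E.
    by apply: ub => w Fw; rewrite leNgt; apply/negP => h; apply: H; exists w.
  by rewrite -{1}(fineK uf) lee_fin; lra.
Qed.

Section envelopes.
Context {R : realType} {N : nat}.
Local Notation V := 'rV[R]_N.
Implicit Types (x y z o d : V) (w v : V -> R) (s a b e : R).
Variables (Omega : set V) (g : V -> R) (M : R).
Hypothesis oO : open Omega.
Hypothesis bO : bounded_set Omega.
Hypothesis scO : strictly_convex Omega.
Hypothesis cg : {within ~` Omega, continuous g}.
Hypothesis gM : forall z, ~ Omega z -> `|g z| <= M.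
Hypothesis N0 : (0 < N)%N.

Definition convex_minorant : set (V -> R) := [set v | convex_in (closure Omega) v /\
  (forall z, bdry Omega z -> v z <= g z)].

Lemma convex_minorant_le v z : convex_minorant v -> closure Omega z -> v z <= M.
Proof.
move=> [cv vg] Oz.
have [Oz'|nOz] := pselect (Omega z); last first.
  exact: le_trans (vg z (conj Oz nOz)) (gle gM nOz).
have [x [y [t [Ox Oy [t0 t1] -> H]]]] := chord oO bO N0 Oz'.
have end1 : ~ Omega x.
  have := H 1; rewrite scale1r subrr scale0r addr0; apply.
  by rewrite ltxx => -[].
have end0 : ~ Omega y.
  have := H 0; rewrite scale0r subr0 scale1r add0r; apply.
  by rewrite ltxx => -[].
apply: le_trans (cv x y t Ox Oy (ltW t0) (ltW t1)) _.
have hx : v x <= M := le_trans (vg x (conj Ox end1)) (gle gM end1).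
have hy : v y <= M := le_trans (vg y (conj Oy end0)) (gle gM end0).
have t1' : 0 <= 1 - t by rewrite subr_ge0 ltW.
have := ler_wpM2l (ltW t0) hx; have := ler_wpM2l t1' hy; lra.
Qed.

Lemma convex_minorant_cst : convex_minorant (fun=> - M).
Proof.
split=> [x y t _ _ _ _|z [_ nOz]]; last exact: (gge gM nOz).
by rewrite -mulrDl addrC subrK mul1r.
Qed.

Let u z := fine (conv_envelope Omega g z).

Lemma conv_envelopeP z : closure Omega z ->
  [/\ conv_envelope Omega g z \is a fin_num,
      forall v, convex_minorant v -> v z <= u z,
      forall a, (forall v, convex_minorant v -> v z <= a) -> u z <= a &
      forall e, 0 < e -> exists2 v, convex_minorant v & u z - e < v z].
Proof.
move=> Oz; apply: (ereal_sup_funP convex_minorant_cst) => v cv.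
exact: convex_minorant_le.
Qed.

Lemma s_envelopeP s z : 0 < s -> s < 1 ->
  [/\ s_envelope s Omega g z \is a fin_num,
      forall w, admissible Omega g s w -> w z <= fine (s_envelope s Omega g z) &
      forall a, (forall w, admissible Omega g s w -> w z <= a) ->
        fine (s_envelope s Omega g z) <= a].
Proof.
move=> s0 s1.
have [h1 h2 h3 _] := @ereal_sup_funP _ _ (admissible Omega g s) z M _
  (admissible_cst gM s0 s1) (fun w hw => admissible_le oO bO gM N0 s0 s1 hw z).
by split.
Qed.

Lemma near_ub_le z a b : a <= b -> near_ub Omega g z a -> near_ub Omega g z b.
Proof.
move=> ab [r r0 H]; exists r => // s w y s0 sr s1 hw Oy yz.
exact: le_trans (H s w y s0 sr s1 hw Oy yz) ab.
Qed.

Lemma near_ub_conv_envelope o z e : Omega o -> closure Omega z -> 0 < e ->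
  near_ub Omega g z (u z + e).
Proof.
move=> Oo Oz e0.
pose A y : set R := [set a | near_ub Omega g y a].
(* The upper relaxed limit, encoded as the infimum of eventual local bounds, so that convexity is
   read off from bounds at two points. *)
pose U y := inf (A y).
have AM y : A y M.
  exists 1 => // s w y' s0 _ s1 hw _ _.
  exact: (admissible_le oO bO gM N0 s0 s1 hw).
have Alb y : closure Omega y -> lbound (A y) (- M).
  move=> Oy a [r r0 H].
  (* Every eventual bound must hold for the admissible constant -M at this s, which keeps the
     infimum from being vacuous. *)
  pose s := 1 - Num.min r 1 / 2.
  have m0 : 0 < Num.min r 1 by rewrite lt_min r0 ltr01.
  have m1 : Num.min r 1 <= 1 by rewrite ge_min lexx orbT.
  have mr : Num.min r 1 <= r by rewrite ge_min lexx.
  have s0 : 0 < s by rewrite /s; lra.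
  have s1 : s < 1 by rewrite /s; lra.
  have sr : 1 - r < s by rewrite /s; lra.
  apply: (H s (fun=> - M) y s0 sr s1 (admissible_cst gM s0 s1) Oy).
  by rewrite subrr normr0.
have Ahi y : closure Omega y -> has_inf (A y).
  by move=> Oy; split; [exists M|exists (- M); exact: Alb].
have Uub y e' : closure Omega y -> 0 < e' -> near_ub Omega g y (U y + e').
  move=> Oy e'0; have [a Aa aU] := inf_adherent e'0 (Ahi y Oy).
  exact: near_ub_le (ltW aU) Aa.
have Ule y a : closure Omega y -> near_ub Omega g y a -> U y <= a.
  by move=> Oy Aa; apply: ge_inf => //; exact: (Ahi y Oy).2.
have CU : convex_minorant U.
  split=> [x y t Ox Oy|y [Oy nOy]]; last first.
    apply/ler_addgt0Pl => e' e'0; rewrite addrC; apply: Ule => //.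
    exact: (near_ub_bdry oO bO scO cg gM N0 Oo Oy nOy e'0).
  rewrite le_eqVlt => /predU1P[<- _|t0].
    by rewrite scale0r add0r subr0 scale1r mul0r add0r mul1r.
  rewrite le_eqVlt => /predU1P[->|t1].
    by rewrite subrr scale0r addr0 scale1r mul0r addr0 mul1r.
  have [<-|xy] := eqVneq x y.
    by rewrite -scalerDl -mulrDl addrC subrK scale1r mul1r.
  apply/ler_addgt0Pl => e' e'0.
  have e2 : 0 < e' / 2 by rewrite divr_gt0.
  have := near_ub_seg oO bO scO gM N0 Ox Oy xy t0 t1 e2 (Uub x _ Ox e2) (Uub y _ Oy e2).
  move=> /(Ule _ _ (closure_seg scO Ox Oy (ltW t0) (ltW t1))); lra.
have [_ uU _ _] := conv_envelopeP Oz.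
by apply: near_ub_le (Uub z e Oz e0); rewrite lerD2r; exact: uU.
Qed.

Lemma near_lb_conv_envelope o z e : Omega o -> closure Omega z -> 0 < e ->
  exists2 r : R, 0 < r & forall s, 0 < s -> 1 - r < s -> s < 1 ->
    exists2 w, admissible Omega g s w &
      forall y, closure Omega y -> `|y - z| < r -> u z - e <= w y.
Proof.
move=> Oo Oz e0; have e4 : 0 < e / 4 by rewrite divr_gt0.
have [_ _ _ uap] := conv_envelopeP Oz.
have [v [cv vg] uv] := uap _ e4.
have [q [c [hq qg qz]]] := affine_minorant oO bO scO cg gM Oo cv vg Oz e4.
have [r r0 Hr] := lower_barrier oO bO scO cg gM Oo hq qg e4.
have [C C0 HC] := linear_form_bound hq.
have C1 : 0 < C + 1 by lra.
pose r' := Num.min r (e / (4 * (C + 1))).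
have r'0 : 0 < r' by rewrite lt_min r0 divr_gt0// mulr_gt0.
have r'r : r' <= r by rewrite ge_min lexx.
have r'e : (C + 1) * r' <= e / 4.
  have h : r' <= e / (4 * (C + 1)) by rewrite ge_min lexx orbT.
  have := ler_wpM2l (ltW C1) h.
  by have -> : (C + 1) * (e / (4 * (C + 1))) = e / 4 by field; rewrite gt_eqF.
exists r' => // s s0 sr s1.
have sr' : 1 - r < s by lra.
have [w hw Hw] := Hr s s0 sr' s1.
exists w => // y Oy yz; apply: le_trans (Hw y Oy).
have : `|q (y - z)| <= e / 4.
  apply: le_trans (HC _) _; apply: le_trans r'e.
  by apply: ler_pM => //; [rewrite lerDl|exact: ltW].
by rewrite linear_formB// ler_norml => /andP[]; lra.
Qed.

(** The bounds at z place the s-envelope at y near u(z), whereas the claim concerns u(y). The same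
    bounds centred at y, used at one auxiliary parameter t, show that u(y) and u(z) are close. *)
Lemma s_envelope_near o z e : Omega o -> closure Omega z -> 0 < e ->
  exists2 r : R, 0 < r & forall s y, 0 < s -> 1 - r < s -> s < 1 ->
    closure Omega y -> `|y - z| < r ->
    `|fine (s_envelope s Omega g y) - u y| < e.
Proof.
move=> Oo Oz e0; have e4 : 0 < e / 4 by rewrite divr_gt0.
have e16 : 0 < e / 16 by rewrite divr_gt0.
have [r r0 Hr] := near_ub_conv_envelope Oo Oz e4.
have [p p0 Hp] := near_lb_conv_envelope Oo Oz e4.
exists (Num.min r p); first by rewrite lt_min r0.
have mr : Num.min r p <= r by rewrite ge_min lexx.
have mp : Num.min r p <= p by rewrite ge_min lexx orbT.
move=> s y s0 srp s1 Oy yz.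
have yr : `|y - z| < r by exact: lt_le_trans yz mr.
have yp : `|y - z| < p by exact: lt_le_trans yz mp.
have sr : 1 - r < s by lra.
have sp : 1 - p < s by lra.
have [_ su1 su2] := s_envelopeP y s0 s1.
have us1 : fine (s_envelope s Omega g y) <= u z + e / 4.
  by apply: su2 => w hw; exact: (Hr s w y s0 sr s1 hw Oy yr).
have us2 : u z - e / 4 <= fine (s_envelope s Omega g y).
  have [w hw Hw] := Hp s s0 sp s1.
  exact: le_trans (Hw y Oy yp) (su1 w hw).
have [r' r'0 Hr'] := near_ub_conv_envelope Oo Oy e16.
have [p' p'0 Hp'] := near_lb_conv_envelope Oo Oy e16.
pose m := Num.min (Num.min 1 (Num.min r p)) (Num.min r' p').
have m0 : 0 < m by rewrite !lt_min ltr01 r0 p0 r'0.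
have m1 : m <= 1 by rewrite !ge_min lexx.
have mr1 : m <= r by rewrite !ge_min lexx !orbT.
have mp1 : m <= p by rewrite !ge_min lexx !orbT.
have mr2 : m <= r' by rewrite !ge_min lexx !orbT.
have mp2 : m <= p' by rewrite !ge_min lexx !orbT.
pose t := 1 - m / 2.
have t0 : 0 < t by rewrite /t; lra.
have t1 : t < 1 by rewrite /t; lra.
have tr : 1 - r < t by rewrite /t; lra.
have tp : 1 - p < t by rewrite /t; lra.
have tr' : 1 - r' < t by rewrite /t; lra.
have tp' : 1 - p' < t by rewrite /t; lra.
have yy (x : R) : 0 < x -> `|y - y| < x by rewrite subrr normr0.
(* The competitor from z gives u(z) - e/4 <= w(y) <= u(y) + e/16, the one from y gives u(y) - e/16
   <= w'(y) <= u(z) + e/4; with the previous e/4 the total is 9e/16. *)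
have [w hw Hw] := Hp t t0 tp t1.
have [w' hw' Hw'] := Hp' t t0 tp' t1.
have h1 := Hw y Oy yp.
have h2 := Hr' t w y t0 tr' t1 hw Oy (yy _ r'0).
have h3 := Hw' y Oy (yy _ p'0).
have h4 := Hr t w' y t0 tr t1 hw' Oy yr.
by rewrite ltr_norml; apply/andP; split; lra.
Qed.

Lemma s_envelope_cvg o e : Omega o -> 0 < e ->
  exists2 r : R, 0 < r & forall s y, 0 < s -> 1 - r < s -> s < 1 ->
    closure Omega y -> `|fine (s_envelope s Omega g y) - u y| < e.
Proof.
move=> Oo e0.
apply: (@compact_ind _ (closure Omega) (fun S => exists2 r : R, 0 < r &
  forall s y, 0 < s -> 1 - r < s -> s < 1 -> S y ->
    `|fine (s_envelope s Omega g y) - u y| < e) (compact_closure bO)).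
- by exists 1.
- move=> A B [r r0 Hr] [p p0 Hp]; exists (Num.min r p); first by rewrite lt_min r0.
  move=> s y s0 srp s1 [Ay|By].
    by apply: Hr => //; apply: le_lt_trans srp; rewrite lerB// ge_min lexx.
  by apply: Hp => //; apply: le_lt_trans srp; rewrite lerB// ge_min lexx orbT.
- move=> A B AB [r r0 Hr]; exists r => // s y s0 sr s1 /AB; exact: Hr.
move=> z Oz; have [r r0 Hr] := s_envelope_near Oo Oz e0.
exists [set y | `|y - z| < r]; split.
- rewrite openE => y /= yz; apply/nbhs_rVP; exists (r - `|y - z|).
    by rewrite subr_gt0.
  move=> x xy /=; have -> : x - z = (x - y) + (y - z) by rewrite addrA subrK.
  by apply: le_lt_trans (ler_normD _ _) _; lra.
- by rewrite /= subrr normr0.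
- by exists r => // s y s0 sr s1 [yz Oy]; exact: Hr.
Qed.
End envelopes.

Theorem theorem1p1 (R : realType) (N : nat) (Omega : set 'rV[R]_N)
    (g : 'rV[R]_N -> R) :
  (0 < N)%N ->
  open Omega -> connected Omega -> Omega !=set0 -> bounded_set Omega ->
  C2_domain Omega -> strictly_convex Omega ->
  {within ~` Omega, continuous g} ->
  (exists M : R, forall z, ~ Omega z -> `|g z| <= M) ->
  (forall x, closure Omega x -> conv_envelope Omega g x \is a fin_num) /\
  (forall e : R, 0 < e ->
     \forall s \near 1^'-, forall x, closure Omega x ->
        s_envelope s Omega g x \is a fin_num /\
        `|fine (s_envelope s Omega g x) - fine (conv_envelope Omega g x)| < e).
Proof.
move=> N0 oO _ [x0 Ox0] bO _ scO cg [M gM]; split.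
  by move=> x Ox; have [] := conv_envelopeP oO bO gM N0 Ox.
move=> e e0; have [r r0 Hr] := s_envelope_cvg oO bO scO cg gM N0 Ox0 e0.
near=> s.
have s0 : 0 < s by near: s; exact: nbhs_left_gt.
have s1 : s < 1 by near: s; exact: nbhs_left_lt.
have sr : 1 - r < s by near: s; apply: nbhs_left_gt; rewrite gtrBl.
move=> x Ox.
split; last exact: Hr.
by have [] := s_envelopeP oO bO gM N0 x s0 s1.
Unshelve. all: end_near. Qed.
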